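(* Assume $0<\alpha,\beta\le 1$, $\alpha+\beta<2$, and let $$\theta_0=\min\left\{\frac{(2-\alpha-\beta)\pi}{2\beta},\frac{\pi}{2}\right\}.$$ For any $\tau>0$ the function $\psi_{\alpha,\beta}(t,\tau)$, as a function of $t>0$, admits an analytic extension to the sector $|\arg t|<\theta_0$, which is bounded on each sector $|\arg t|\le\theta$, $0<\theta<\theta_0$.
   Context: Kernels (principal branches of powers, $t,\tau>0$, any $c>0$): for $0<\alpha<1$, $f_\alpha(t,\tau)=\frac{1}{2\pi i}\int_{c-i\infty}^{c+i\infty}e^{z\tau-tz^\alpha}\,dz$; for $0<\beta<1$, $\varphi_\beta(t,\tau)=\frac{1}{2\pi i}\int_{c-i\infty}^{c+i\infty}z^{\beta-1}e^{zt-\tau z^\beta}\,dz$; and for $0<\alpha,\beta<1$ the subordination kernel is $\psi_{\alpha,\beta}(t,\tau)=\int_0^\infty\varphi_\beta(t,\sigma)f_\alpha(\sigma,\tau)\,d\sigma$. When exactly one of the parameters equals $1$: $\psi_{\alpha,1}=f_\alpha$ and $\psi_{1,\beta}=\varphi_\beta$. *)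

(* Defs.v *)
From HB Require Import structures.
From mathcomp Require Export all_boot all_order all_algebra.
From mathcomp Require Export all_classical all_reals all_analysis.
From mathcomp Require Export complex.

Set Implicit Arguments.
Unset Strict Implicit.
Unset Printing Implicit Defensive.

Import Order.TTheory GRing.Theory Num.Theory.
Import numFieldNormedType.Exports.

Local Open Scope classical_set_scope.
Local Open Scope ring_scope.
Local Open Scope complex_scope.

Definition cmod (R : realType) (z : R[i]) : R := ComplexField.Normc.normc z.

Definition cexp (R : realType) (z : R[i]) : R[i] :=
  (expR (complex.Re z))%:C * (cos (complex.Im z) +i* sin (complex.Im z)).

(* Principal argument, in ]-pi, pi]; the value at 0 is meaningless. *)
Definition carg (R : realType) (z : R[i]) : R :=
  if 0 <= complex.Im z then acos (complex.Re z / cmod z)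
  else - acos (complex.Re z / cmod z).

Definition cln (R : realType) (z : R[i]) : R[i] := ln (cmod z) +i* carg z.

(* Principal branch of z ^ a, for z != 0. *)
Definition cpow (R : realType) (z : R[i]) (a : R) : R[i] :=
  cexp (a%:C * cln z).

Definition cintegral (R : realType) (D : set R) (F : R -> R[i]) : R[i] :=
  (\int[lebesgue_measure]_(x in D) complex.Re (F x))%R
  +i* (\int[lebesgue_measure]_(x in D) complex.Im (F x))%R.

(* (2 pi i)^-1 times the integral of G(z) dz over the upward line Re z = c,
   parametrized by z = c + i y, dz = i dy. *)
Definition bromwich (R : realType) (c : R) (G : R[i] -> R[i]) : R[i] :=
  ((2 * pi)%:C * 'i)^-1 * cintegral setT (fun y => G (c +i* y) * 'i).

Definition f_kernel (R : realType) (c alpha t tau : R) : R[i] :=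
  bromwich c (fun z => cexp (z * tau%:C - t%:C * cpow z alpha)).

Definition phi_kernel (R : realType) (c beta t tau : R) : R[i] :=
  bromwich c (fun z =>
    cpow z (beta - 1) * cexp (z * t%:C - tau%:C * cpow z beta)).

(* c and d are the abscissas of the lines used for f_alpha and phi_beta.
   The value when alpha = beta = 1 is not meaningful. *)
Definition psi_kernel (R : realType) (c d alpha beta t tau : R) : R[i] :=
  if beta == 1 then f_kernel c alpha t tau
  else if alpha == 1 then phi_kernel d beta t tau
  else cintegral `]0, +oo[
         (fun s => phi_kernel d beta t s * f_kernel c alpha s tau).

Definition sector (R : realType) (theta : R) : set R[i] :=
  [set z | z != 0 /\ `|carg z| < theta].

Definition closed_sector (R : realType) (theta : R) : set R[i] :=
  [set z | z != 0 /\ `|carg z| <= theta].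

(* Complex differentiability at every point of D, meant for open D. R[i]^o is
   R[i] as a normed space over itself. *)
Definition holomorphic_on (R : realType) (D : set R[i]) (F : R[i] -> R[i]) :=
  forall z : R[i], D z -> derivable (F : R[i]^o -> R[i]^o) z 1.

Definition bounded_on (R : realType) (D : set R[i]) (F : R[i] -> R[i]) :=
  exists M : R, forall z, D z -> cmod (F z) <= M.

Definition theta0 (R : realType) (alpha beta : R) : R :=
  Num.min ((2 - alpha - beta) * pi / (2 * beta)) (pi / 2).

(* Main.v *)
(* Write [f_alpha] and [phi_beta] as integrals over their vertical lines. Two
   integrations by parts in [z] turn the integrand of [f_alpha (s, tau)] into
   [exp (z tau) z^-2 pexp (s z^alpha)] up to constants, which converges
   absolutely. Dilating the contour of [phi_beta (t, s)] by [t^-1] turns its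
   integrand into [exp w w^-1] times a function of [s t^-beta w^beta] (up to a
   factor [s^-1]), so that [t] enters through a power only. By Fubini, the
   integral over [s] that defines [psi] becomes an explicit rational function of
   [t^beta z^alpha w^-beta], with poles at [-1] only. In all cases the kernel is
   thus [\int g(x) P(t^gamma e(x)) dx], where [e(x)] lies in a sector and [P] is
   analytic in a larger one, with [P u = O(|u| / (1 + |u|)^2)]. The integral of
   [|g(x)| |r e(x)| / (1 + |r e(x)|)^2] is bounded uniformly in [r > 0] because
   the measure [dw / w] is invariant under dilations; hence the integral is
   bounded in [t] on closed subsectors, and quadratic Taylor estimates of [P],
   with radius proportional to [|u|], integrate to its differentiability. *)
From HB Require Import structures.
Require Import Defs.
From mathcomp Require Import measurable_realfun lebesgue_integral_under ring lra.
Import Order.TTheory GRing.Theory Num.Theory.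
Import numFieldNormedType.Exports.
Set Implicit Arguments.
Unset Strict Implicit.
Unset Printing Implicit Defensive.
Local Open Scope classical_set_scope.
Local Open Scope ring_scope.
Local Open Scope complex_scope.

(** * Polar form, exponential and powers *)

Section Polar.
Context {R : realType}.
Implicit Types (z w u : R[i]) (a b r x y : R).

(** Cauchy's theorem is not invoked. The contour of [phi] is moved by differentiating in the
    logarithm of the dilation factor: the derivative of the dilated integrand is a total derivative
    along the line, so its integral vanishes. The obstacle to Fubini is absolute convergence: the
    dilated integrand of [phi] carries only [w^-1], which is not integrable on the line, and
    [exp (- s z^a)] loses its decay in [z] as [s] tends to 0. The two integrations by parts produce
    [pexp], which vanishes at 0. Its bound by [s |z|^a], combined with the factor [A exp (- s A)],
    [A = t^-b w^b], leaves after integration in [s] the orders [|w|^(-1 - b)] and [|z|^(a - 2)],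
    integrable because [b > 0] and [a < 1]. The angle [theta0] is read off the phase: [t^b]
    contributes [b theta], while [z^a] and [w^-b] contribute at most [a pi / 2] and [b pi / 2], and
    the sum must stay below [pi], the argument of the pole [-1]. When one parameter is 1, [P]
    contains [exp (- u)] instead and the limit is [pi / 2], which is the same inequality less
    [pi / 2]. *)

Lemma complexP z w :
  complex.Re z = complex.Re w -> complex.Im z = complex.Im w -> z = w.
Proof. by case: z w => [a b] [c e] /= -> ->. Qed.

Lemma cReD z w : complex.Re (z + w) = complex.Re z + complex.Re w.
Proof. by case: z w => [? ?] [? ?]. Qed.

Lemma cImD z w : complex.Im (z + w) = complex.Im z + complex.Im w.
Proof. by case: z w => [? ?] [? ?]. Qed.

Lemma cReN z : complex.Re (- z) = - complex.Re z.
Proof. by case: z => [? ?]. Qed.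

Lemma cImN z : complex.Im (- z) = - complex.Im z.
Proof. by case: z => [? ?]. Qed.

Lemma cReM z w : complex.Re (z * w) =
  complex.Re z * complex.Re w - complex.Im z * complex.Im w.
Proof. by case: z w => [? ?] [? ?]. Qed.

Lemma cImM z w : complex.Im (z * w) =
  complex.Re z * complex.Im w + complex.Im z * complex.Re w.
Proof. by case: z w => [? ?] [? ?]. Qed.

Lemma cmod_ge0 z : 0 <= cmod z.
Proof. by case: z => a b; exact: sqrtr_ge0. Qed.

Lemma cmod0 : cmod (0 : R[i]) = 0.
Proof. exact: ComplexField.Normc.normc0. Qed.

Lemma cmod1 : cmod (1 : R[i]) = 1.
Proof. exact: ComplexField.Normc.normc1. Qed.

Lemma cmodM z w : cmod (z * w) = cmod z * cmod w.
Proof. exact: ComplexField.Normc.normcM. Qed.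

Lemma cmodV z : cmod z^-1 = (cmod z)^-1.
Proof. exact: ComplexField.Normc.normcV. Qed.

Lemma cmodD z w : cmod (z + w) <= cmod z + cmod w.
Proof. exact: le_normcD. Qed.

Lemma cmodN z : cmod (- z) = cmod z.
Proof. exact: normcN. Qed.

Lemma cmodX z n : cmod (z ^+ n) = cmod z ^+ n.
Proof. by elim: n => [|n ih]; rewrite ?expr0 ?cmod1// !exprS cmodM ih. Qed.

Lemma cmod_eq0 z : (cmod z == 0) = (z == 0).
Proof.
by apply/eqP/eqP => [/ComplexField.Normc.eq0_normc//|->]; rewrite cmod0.
Qed.

Lemma cmod_gt0 z : (0 < cmod z) = (z != 0).
Proof. by rewrite lt_def cmod_ge0 andbT cmod_eq0. Qed.

Lemma lerB_cmod z w : cmod z - cmod w <= cmod (z - w).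
Proof. by rewrite lerBlDr -{1}(subrK w z) cmodD. Qed.

Lemma lerB_cmodD z w : cmod z - cmod w <= cmod (z + w).
Proof. by rewrite -(cmodN w) -{2}(opprK w) lerB_cmod. Qed.

Lemma cmodR x : cmod x%:C = `|x|.
Proof. by rewrite /cmod /= expr0n /= addr0 sqrtr_sqr. Qed.

Lemma cmodi : cmod ('i : R[i]) = 1.
Proof. by rewrite /cmod /= expr0n /= expr1n add0r sqrtr1. Qed.

Lemma sqr_cmod z : cmod z ^+ 2 = complex.Re z ^+ 2 + complex.Im z ^+ 2.
Proof. by case: z => a b /=; rewrite sqr_sqrtr// addr_ge0 ?sqr_ge0. Qed.

Lemma ler_cmodP z x : 0 <= x ->
  (cmod z <= x) = (complex.Re z ^+ 2 + complex.Im z ^+ 2 <= x ^+ 2).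
Proof. by move=> x0; rewrite -sqr_cmod ler_pXn2r// ?nnegrE ?cmod_ge0. Qed.

Lemma ge_cmodP z x : 0 <= x ->
  (x <= cmod z) = (x ^+ 2 <= complex.Re z ^+ 2 + complex.Im z ^+ 2).
Proof. by move=> x0; rewrite -sqr_cmod ler_pXn2r// ?nnegrE ?cmod_ge0. Qed.

Lemma normRe_cmod z : `|complex.Re z| <= cmod z.
Proof.
by rewrite ge_cmodP// real_normK ?num_real// lerDl sqr_ge0.
Qed.

Lemma normIm_cmod z : `|complex.Im z| <= cmod z.
Proof.
by rewrite ge_cmodP// real_normK ?num_real// lerDr sqr_ge0.
Qed.

Lemma Re_le_cmod z : complex.Re z <= cmod z.
Proof. exact: le_trans (ler_norm _) (normRe_cmod z). Qed.

Lemma cmod_le_ReIm z : cmod z <= `|complex.Re z| + `|complex.Im z|.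
Proof.
rewrite ler_cmodP ?addr_ge0// sqrrD !real_normK ?num_real//.
by rewrite -addrA lerD2l lerDr mulrn_wge0// mulr_ge0.
Qed.

Definition cis x : R[i] := cos x +i* sin x.

Lemma cmod_cis x : cmod (cis x) = 1.
Proof. by rewrite /cmod /= cos2Dsin2 sqrtr1. Qed.

Lemma cis0 : cis 0 = 1.
Proof. by rewrite /cis cos0 sin0. Qed.

Lemma cisD x y : cis (x + y) = cis x * cis y.
Proof.
apply: complexP; rewrite ?cReM ?cImM /=; first exact: cosD.
by rewrite sinD addrC.
Qed.

Lemma cexpE z : cexp z = (expR (complex.Re z))%:C * cis (complex.Im z).
Proof. by []. Qed.

Lemma cmod_cexp z : cmod (cexp z) = expR (complex.Re z).
Proof. by rewrite cexpE cmodM cmod_cis mulr1 cmodR ger0_norm ?expR_ge0. Qed.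

Lemma cexp0 : cexp (0 : R[i]) = 1.
Proof. by rewrite cexpE /= expR0 cis0 mulr1. Qed.

Lemma cexpD z w : cexp (z + w) = cexp z * cexp w.
Proof.
by rewrite !cexpE cReD cImD expRD cisD rmorphM /= -!mulrA; congr (_ * _);
  rewrite mulrCA.
Qed.

Lemma cexp_neq0 z : cexp z != 0.
Proof. by rewrite -cmod_gt0 cmod_cexp expR_gt0. Qed.

Lemma cexpN z : cexp (- z) = (cexp z)^-1.
Proof.
by apply: (mulfI (cexp_neq0 z)); rewrite -cexpD subrr cexp0 divff ?cexp_neq0.
Qed.

Lemma cexpR x : cexp x%:C = (expR x)%:C.
Proof. by rewrite cexpE /= cis0 mulr1. Qed.

(** [acos] recovers the cosine exactly but the sine only up to sign, as [|Im z| / |z|]; the case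
    distinction in [carg] restores the sign. *)
Lemma polarE z : z != 0 -> z = (cmod z)%:C * cis (carg z).
Proof.
move=> z0; have c0 : 0 < cmod z by rewrite cmod_gt0.
set v := complex.Re z / cmod z.
have v1 : -1 <= v <= 1.
  rewrite -ler_norml normrM normfV [X in _ / X]ger0_norm ?cmod_ge0//.
  by rewrite ler_pdivrMr// mul1r normRe_cmod.
have cv : cos (acos v) = v by apply: acosK; rewrite in_itv.
have sv : cmod z * sin (acos v) = `|complex.Im z|.
  rewrite sin_acos// -[X in X * _]ger0_norm ?cmod_ge0// -sqrtr_sqr -sqrtrM ?sqr_ge0//.
  rewrite mulrBr mulr1 -exprMn /v mulrCA divff ?lt0r_neq0// mulr1 sqr_cmod.
  by rewrite addrC addKr sqrtr_sqr.
have rv : cmod z * v = complex.Re z by rewrite /v mulrCA divff ?lt0r_neq0// mulr1.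
rewrite /carg -/v; case: leP => im0; apply: complexP; rewrite ?cReM ?cImM /= mul0r ?subr0 ?addr0.
- by rewrite cv rv.
- by rewrite sv ger0_norm.
- by rewrite cosN cv rv.
- by rewrite sinN mulrN sv ltr0_norm// opprK.
Qed.

Lemma carg_polar r x : 0 < r -> - pi < x <= pi -> carg (r%:C * cis x) = x.
Proof.
move=> r0 /andP[x1 x2].
have cm : cmod (r%:C * cis x) = r by rewrite cmodM cmod_cis mulr1 cmodR gtr0_norm.
rewrite /carg cm cReM cImM /= !mul0r subr0 addr0 mulrAC divff ?lt0r_neq0// mul1r.
rewrite pmulr_rge0//; have [x0|x0] := leP 0 x.
  by rewrite sin_ge0_pi ?x0// cosK// in_itv /= x0.
rewrite leNgt -oppr_gt0 -sinN sin_gt0_pi /=; last by rewrite oppr_gt0 x0 ltrNl.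
by rewrite cosKN ?opprK// (ltW x1) ltW.
Qed.

Lemma carg_itv z : z != 0 -> - pi < carg z <= pi.
Proof.
move=> z0; have c0 : 0 < cmod z by rewrite cmod_gt0.
rewrite /carg; set v := complex.Re z / cmod z.
have v1 : -1 <= v <= 1.
  rewrite -ler_norml normrM normfV [X in _ / X]ger0_norm ?cmod_ge0//.
  by rewrite ler_pdivrMr// mul1r normRe_cmod.
have := acos_ge0 v1; have := acos_lepi v1; have p0 := pi_gt0 R.
case: (leP 0 (complex.Im z)) => im0 a1 a2.
  by rewrite a1 andbT (lt_le_trans _ a2)// oppr_lt0.
(* The value [-1] would make [z] a negative real, against [Im z < 0]; so the lower half plane stays
   strictly above the angle [- pi]. *)
have vN1 : -1 < v <= 1.
  case/andP: v1 => v1 ->; rewrite andbT lt_neqAle v1 andbT; apply/eqP => v1'.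
  have : cmod z ^+ 2 = complex.Re z ^+ 2.
    have -> : complex.Re z = - cmod z.
      by rewrite -[LHS](divfK (lt0r_neq0 c0)) -/v -v1' mulN1r.
    by rewrite sqrrN.
  rewrite sqr_cmod -[RHS]addr0 => /addrI/eqP; rewrite sqrf_eq0 => /eqP i0.
  by rewrite i0 ltxx in im0.
rewrite ltrN2 acos_ltpi//=; lra.
Qed.

Lemma cexp_cln z : z != 0 -> cexp (cln z) = z.
Proof. by move=> z0; rewrite cexpE /= lnK -?polarE// posrE cmod_gt0. Qed.

Lemma cln_cexp u : - pi < complex.Im u <= pi -> cln (cexp u) = u.
Proof.
move=> h; rewrite /cln cmod_cexp expRK cexpE carg_polar ?expR_gt0//.
by case: u {h}.
Qed.

Lemma carg_Re_gt0 z : 0 < complex.Re z -> `|carg z| < pi / 2.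
Proof.
move=> z0; have zn0 : z != 0 by apply/eqP => zE; rewrite zE /= ltxx in z0.
have c0 : 0 < cmod z by rewrite cmod_gt0.
have [h1 h2] := andP (carg_itv zn0).
have e : complex.Re z = cmod z * cos (carg z).
  by rewrite {1}(polarE zn0) cReM /= mul0r subr0.
have cp : 0 < cos (carg z) by move: z0; rewrite e pmulr_rgt0.
rewrite -cos_norm in cp; rewrite ltNge; apply/negP => h.
have hn : `|carg z| <= pi by rewrite ler_norml h2 ltW.
move: cp; rewrite ltNge -(cos_pihalf R) => /negP; apply.
have p0 := pi_gt0 R.
by rewrite leNgt ltr_cos ?in_itv /= -?leNgt//; lra.
Qed.

(** Both sides have the same exponential, and the condition on the arguments keeps their sum in the
    strip where [cln] inverts [cexp]: the cut is not crossed. *)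
Lemma clnM z w : z != 0 -> w != 0 -> - pi < carg z + carg w <= pi ->
  cln (z * w) = cln z + cln w.
Proof.
move=> z0 w0 h; rewrite -{1}(cexp_cln z0) -{1}(cexp_cln w0) -cexpD cln_cexp//.
Qed.

Lemma cpowM z w a : z != 0 -> w != 0 -> - pi < carg z + carg w <= pi ->
  cpow (z * w) a = cpow z a * cpow w a.
Proof. by move=> z0 w0 h; rewrite /cpow clnM// mulrDr cexpD. Qed.

Lemma cpowD z a b : cpow z (a + b) = cpow z a * cpow z b.
Proof. by rewrite /cpow rmorphD mulrDl cexpD. Qed.

Lemma cpow1 z : z != 0 -> cpow z 1 = z.
Proof. by move=> z0; rewrite /cpow mul1r cexp_cln. Qed.

Lemma cpow_neq0 z a : cpow z a != 0.
Proof. exact: cexp_neq0. Qed.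

Lemma cpowN z a : cpow z (- a) = (cpow z a)^-1.
Proof. by rewrite /cpow rmorphN mulNr cexpN. Qed.

Lemma cpowB1 z a : z != 0 -> cpow z (a - 1) = z^-1 * cpow z a.
Proof. by move=> z0; rewrite cpowD cpowN cpow1// mulrC. Qed.

Lemma cpow_polar z a :
  cpow z a = (expR (a * ln (cmod z)))%:C * cis (a * carg z).
Proof. by rewrite /cpow cexpE cReM cImM /= !mul0r subr0 addr0. Qed.

Lemma cmod_cpow z a : z != 0 -> cmod (cpow z a) = cmod z `^ a.
Proof.
move=> z0; rewrite cpow_polar cmodM cmod_cis mulr1 cmodR ger0_norm ?expR_ge0//.
by rewrite /powR cmod_eq0 (negPf z0).
Qed.

Lemma carg_real x : 0 < x -> carg x%:C = 0.
Proof.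
move=> x0; rewrite -(mulr1 x%:C) -cis0 carg_polar// pi_ge0 andbT oppr_lt0.
exact: pi_gt0.
Qed.

Lemma cpow_real x a : 0 < x -> cpow x%:C a = (x `^ a)%:C.
Proof.
move=> x0; rewrite cpow_polar carg_real// mulr0 cis0 mulr1 cmodR gtr0_norm//.
by rewrite /powR gt_eqF.
Qed.

End Polar.

(** * Elementary inequalities for real functions *)

Section RealEstimates.
Context {R : realType}.
Implicit Types (a b x y : R).

Lemma sin_le_norm x : `|sin x| <= `|x|.
Proof.
wlog x0 : x / 0 < x => [hw|].
  case: (ltgtP x 0) => [xn|xp|->]; last 2 first.
  - exact: hw.
  - by rewrite sin0.
  by rewrite -normrN -sinN -[leRHS]normrN hw// oppr_gt0.
have dsin z : z \in `]0, x[ -> is_derive z 1 sin (cos z).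
  by move=> _; exact: is_derive_sin.
have csin : {within `[0, x], continuous (@sin R)}.
  by apply: continuous_subspaceT => z; exact: continuous_sin.
have [c _] := MVT x0 dsin csin.
rewrite sin0 !subr0 => ->; rewrite normrM ler_piMl//; exact: cos_max.
Qed.

Lemma cos_sub1_le x : `|cos x - 1| <= `|x|.
Proof.
have -> : cos x - 1 = - (2 * sin (x / 2) ^+ 2).
  have e : x = (x / 2) *+ 2 by rewrite -mulr_natr divfK// pnatr_eq0.
  by rewrite {1}e cos_mulr2n cos2sin2; ring.
rewrite normrN normrM [`|2|]ger0_norm// normrX expr2.
have h1 := sin_le_norm (x / 2); have h2 := sin_max (x / 2).
have h3 : `|x / 2| = `|x| / 2 by rewrite normrM [`|2^-1|]ger0_norm.
have := normr_ge0 (sin (x / 2)); rewrite h3 in h1; nra.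
Qed.

Lemma cos_sub1_le2 x : `|cos x - 1| <= x ^+ 2 / 2.
Proof.
have -> : cos x - 1 = - (2 * sin (x / 2) ^+ 2).
  have e : x = (x / 2) *+ 2 by rewrite -mulr_natr divfK// pnatr_eq0.
  by rewrite {1}e cos_mulr2n cos2sin2; ring.
rewrite normrN ger0_norm 1?mulr_ge0 ?sqr_ge0//.
have h1 := sin_le_norm (x / 2).
have : sin (x / 2) ^+ 2 <= (x / 2) ^+ 2.
  by rewrite -[leLHS]real_normK ?num_real// -[leRHS]real_normK ?num_real// ler_pXn2r// nnegrE.
by rewrite expr_div_n; lra.
Qed.

Lemma sin_subx_le x : `|sin x - x| <= x ^+ 2.
Proof.
wlog x0 : x / 0 < x => [hw|].
  case: (ltgtP x 0) => [xn|xp|->]; last 2 first.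
  - exact: hw.
  - by rewrite sin0 subr0 normr0 expr0n.
  by rewrite -sqrrN -normrN opprD -sinN hw// oppr_gt0.
have dg z : z \in `]0, x[ -> is_derive z 1 (fun z => sin z - z) (cos z - 1).
  by move=> _; apply: is_deriveB.
have cg : {within `[0, x], continuous (fun z => sin z - z)}.
  apply: continuous_subspaceT => z.
  by apply: cvgB; [exact: continuous_sin|exact: cvg_id].
have [c cx] := MVT x0 dg cg.
rewrite sin0 !subr0 => ->; rewrite normrM [`|x|]gtr0_norm// expr2 ler_pM2r//.
apply: le_trans (cos_sub1_le c) _; move: cx; rewrite in_itv /= => /andP[c0 cx].
by rewrite gtr0_norm// ltW.
Qed.

Lemma expR_sub1_le x : `|expR x - 1| <= `|x| * expR `|x|.
Proof.
have [x0|x0] := leP 0 x.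
  have e := expR_ge1Dx (- x); rewrite expRN in e.
  rewrite (ger0_norm x0) ger0_norm ?subr_ge0; last by rewrite -expR0 ler_expR.
  have p := expR_gt0 x.
  have : (1 - x) * expR x <= (expR x)^-1 * expR x by rewrite ler_pM2r.
  by rewrite mulVf ?gt_eqF//; lra.
have e := expR_ge1Dx x.
have e1 : expR x <= 1 by rewrite expR_le1 ltW.
have e2 : 1 <= expR (- x) by rewrite -expR0 ler_expR; lra.
rewrite (ltr0_norm x0) ler0_norm; last by lra.
have : - x * 1 <= - x * expR (- x) by rewrite ler_pM2l ?oppr_gt0.
by lra.
Qed.

Lemma expR_sub1x_le x : `|expR x - 1 - x| <= x ^+ 2 * expR `|x|.
Proof.
have e := expR_ge1Dx x; rewrite ger0_norm; last by lra.
have e2 := expR_ge1Dx (- x); rewrite expRN in e2.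
have p := expR_gt0 x.
have h : expR x - 1 - x <= x * (expR x - 1).
  have : (1 - x) * expR x <= (expR x)^-1 * expR x by rewrite ler_pM2r.
  by rewrite mulVf ?gt_eqF//; lra.
apply: (le_trans h); apply: le_trans (ler_norm _) _; rewrite normrM.
have -> : x ^+ 2 = `|x| * `|x| by rewrite -expr2 real_normK ?num_real.
by rewrite -mulrA ler_wpM2l// expR_sub1_le.
Qed.

(** The derivative [1 + tan^2] of the tangent is at least 1. This turns a bound on the quotient
    [Im / Re] into one on the argument. *)
Lemma le_tan x : 0 <= x -> x < pi / 2 -> x <= tan x.
Proof.
move=> x0 x2; have p0 := pi_gt0 R; move: x0; rewrite le_eqVlt => /predU1P[<-|x0].
  by rewrite tan0.
have cp z : 0 <= z -> z < pi / 2 -> cos z != 0.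
  by move=> z0 z1; rewrite gt_eqF// cos_gt0_pihalf//; lra.
have dt z : z \in `]0, x[ -> is_derive z 1 tan ((cos z) ^- 2).
  rewrite in_itv /= => /andP[z0 zx].
  by apply: is_derive_tan; apply: cp; lra.
have ct : {within `[0, x], continuous (@tan R)}.
  apply: derivable_within_continuous => z; rewrite in_itv /= => /andP[z0 zx].
  by apply: derivable_tan; apply: cp; lra.
have [c] := MVT x0 dt ct.
rewrite in_itv /= => /andP[c0 cx]; rewrite tan0 !subr0 => ->.
have cc : cos c != 0 by apply: cp; lra.
by rewrite cos2_tan2// ler_peMl ?(ltW x0)// lerDl sqr_ge0.
Qed.

End RealEstimates.

(** * Taylor estimates of the complex exponential and logarithm *)

Section Cexp.
Context {R : realType}.
Implicit Types (z w u h : R[i]).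

(** With [h = a + i b], the remainder splits into [(exp a - 1 - a) cis b], [cis b - 1 - i b] and
    [a (cis b - 1)], each of second order. *)
Lemma cexp_sub1x_le h :
  cmod (cexp h - 1 - h) <= 3 * cmod h ^+ 2 * expR (cmod h).
Proof.
set a := complex.Re h; set b := complex.Im h.
have -> : cexp h - 1 - h = (expR a - 1 - a)%:C * cis b
    + ((cos b - 1) +i* (sin b - b)) + a%:C * ((cos b - 1) +i* sin b).
  by case: h @a @b => a b /=; apply: complexP;
     rewrite !(cReD, cImD, cReN, cImN, cReM, cImM) /=; ring.
apply: le_trans (cmodD _ _) _; apply: le_trans (lerD (cmodD _ _) (lexx _)) _.
rewrite !cmodM cmod_cis mulr1 !cmodR.
have ha : a ^+ 2 + b ^+ 2 = cmod h ^+ 2 by rewrite sqr_cmod.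
have hE : expR `|a| <= expR (cmod h) by rewrite ler_expR normRe_cmod.
have hE1 : 1 <= expR (cmod h) by rewrite -expR0 ler_expR cmod_ge0.
have h1 := expR_sub1x_le a.
have h1' : a ^+ 2 * expR `|a| <= a ^+ 2 * expR (cmod h) by rewrite ler_wpM2l ?sqr_ge0.
have h2 : cmod ((cos b - 1) +i* (sin b - b)) <= b ^+ 2 / 2 + b ^+ 2.
  by apply: le_trans (cmod_le_ReIm _) _; rewrite lerD ?cos_sub1_le2 ?sin_subx_le.
have h3 : cmod ((cos b - 1) +i* sin b) <= 2 * `|b|.
  apply: le_trans (cmod_le_ReIm _) _ => /=.
  by have := cos_sub1_le b; have := sin_le_norm b; lra.
have h3' : `|a| * cmod ((cos b - 1) +i* sin b) <= `|a| * (2 * `|b|) by rewrite ler_wpM2l.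
have h4 : `|a| * (2 * `|b|) <= a ^+ 2 + b ^+ 2.
  rewrite -(real_normK (num_real a)) -(real_normK (num_real b)).
  by have := sqr_ge0 (`|a| - `|b|); nra.
have hb : b ^+ 2 <= cmod h ^+ 2 by rewrite -ha lerDr sqr_ge0.
have hm : cmod h ^+ 2 <= cmod h ^+ 2 * expR (cmod h) by rewrite ler_peMr ?sqr_ge0.
have hm2 : a ^+ 2 * expR (cmod h) + b ^+ 2 * expR (cmod h) = cmod h ^+ 2 * expR (cmod h).
  by rewrite -mulrDl ha.
have hb2 : b ^+ 2 <= b ^+ 2 * expR (cmod h) by rewrite ler_peMr ?sqr_ge0.
have := sqr_ge0 b; lra.
Qed.

(** The modulus contributes [2 |h|] through [ln (1 + x) <= x], and the argument [2 |h|] through its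
    tangent [Im h / (1 + Re h)]. First order suffices: [quad_cpow] recovers the second order of the
    logarithm from the exponential. *)
Lemma cln_1D_le h : cmod h <= 1 / 2 ->
  [/\ `|carg (1 + h)| < pi / 2, 1 + h != 0 & cmod (cln (1 + h)) <= 4 * cmod h].
Proof.
move=> h12; set a := complex.Re h; set b := complex.Im h.
have ha := normRe_cmod h; have hb := normIm_cmod h.
have ra : complex.Re (1 + h) = 1 + a by rewrite cReD.
have rp : 0 < 1 + a by move: ha; rewrite ler_norml -/a; lra.
have arg : `|carg (1 + h)| < pi / 2 by apply: carg_Re_gt0; rewrite ra.
have n0 : 1 + h != 0 by apply/eqP => e; move: rp; rewrite -ra e ltxx.
have c0 : 0 < cmod (1 + h) by rewrite cmod_gt0.
split=> //; apply: le_trans (cmod_le_ReIm _) _ => /=.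
have cu : cmod (1 + h) <= 1 + cmod h by rewrite -{1}cmod1 cmodD.
have cl : 1 - cmod h <= cmod (1 + h) by rewrite -{1}(@cmod1 R) lerB_cmodD.
have hl : `|ln (cmod (1 + h))| <= 2 * cmod h.
  have := cmod_ge0 h => m0; rewrite ler_norml; apply/andP; split.
    rewrite lerNl -lnV ?posrE//.
    have -> : (cmod (1 + h))^-1 = 1 + ((cmod (1 + h))^-1 - 1) by ring.
    have le2 : (cmod (1 + h))^-1 - 1 <= 2 * cmod h.
      rewrite lerBlDr -[leLHS]mul1r ler_pdivrMr//.
      have : (1 - cmod h) * (2 * cmod h + 1) <= cmod (1 + h) * (2 * cmod h + 1).
        by rewrite ler_pM2r//; lra.
      by nra.
    apply: le_trans (le_ln1Dx _) le2.
    by rewrite -subr_gt0 opprK subrK invr_gt0.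
  have -> : cmod (1 + h) = 1 + (cmod (1 + h) - 1) by ring.
  apply: le_trans (le_ln1Dx _) _; last by lra.
  by rewrite -subr_gt0 opprK subrK.
have tg : tan (carg (1 + h)) = b / (1 + a).
  have e := polarE n0.
  have e1 : 1 + a = cmod (1 + h) * cos (carg (1 + h)).
    by rewrite -ra {1}e cReM /= mul0r subr0.
  have e2 : b = cmod (1 + h) * sin (carg (1 + h)).
    have -> : b = complex.Im (1 + h) by rewrite cImD /= add0r.
    by rewrite {1}e cImM /= mul0r addr0.
  by rewrite /tan e1 {1}e2 -mulf_div divff ?gt_eqF// mul1r.
have ht : `|carg (1 + h)| <= `|tan (carg (1 + h))|.
  have [c1|c1] := leP 0 (carg (1 + h)).
    rewrite ger0_norm//; apply: le_trans _ (ler_norm _); rewrite le_tan//.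
    by rewrite ger0_norm in arg.
  rewrite ltr0_norm// -[leRHS]normrN -tanN; apply: le_trans _ (ler_norm _).
  by rewrite le_tan ?oppr_ge0 ?(ltW c1)// -ltr0_norm.
have hb2 : `|b / (1 + a)| <= 2 * cmod h.
  rewrite normrM normfV [X in _ / X]gtr0_norm// ler_pdivrMr//.
  move: ha; rewrite -/a ler_norml => /andP[ha1 ha2].
  have := cmod_ge0 h; rewrite -/b in hb; nra.
by rewrite tg in ht; lra.
Qed.

End Cexp.

(** * Quadratic Taylor estimates *)

Section Quad.
Context {R : realType}.
Implicit Types (z w u h k : R[i]) (C rho lam x : R).

(* A first-order Taylor expansion of f at u, with value f1 of the derivative,
   on the disc of radius rho; the bounds are normalized so that C has the
   dimension of f. *)
Definition quad rho C (f : R[i] -> R[i]) (f1 : R[i]) u :=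
  [/\ 0 < rho, cmod (f u) <= C, rho * cmod f1 <= C &
  forall h, cmod h <= rho ->
    cmod (f (u + h) - f u - h * f1) <= C * (cmod h / rho) ^+ 2].

(** The increment is measured in units of [rho], with [x = |h| / rho], which frees the later
    computations of divisions. *)
Lemma quadP rho C f f1 u : 0 < rho -> cmod (f u) <= C -> rho * cmod f1 <= C ->
  (forall h x, 0 <= x -> x <= 1 -> cmod h = x * rho ->
     cmod (f (u + h) - f u - h * f1) <= C * x ^+ 2) -> quad rho C f f1 u.
Proof.
move=> r0 c1 c2 H; split=> // h hr; apply: H.
- by rewrite divr_ge0 ?cmod_ge0 ?ltW.
- by rewrite ler_pdivrMr ?mul1r.
- by rewrite divfK ?gt_eqF.
Qed.

Lemma quadE rho C f f1 u h x : quad rho C f f1 u -> x <= 1 -> cmod h = x * rho ->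
  cmod (f (u + h) - f u - h * f1) <= C * x ^+ 2.
Proof.
move=> [r0 _ _ H] x1 e; have := H h.
rewrite e mulfK ?gt_eqF//; apply.
by rewrite ger_pMl.
Qed.

Lemma quad_gt0 rho C f f1 u : quad rho C f f1 u -> 0 < rho.
Proof. by case. Qed.

Lemma quad_ge0 rho C f f1 u : quad rho C f f1 u -> 0 <= C.
Proof. by move=> [_ h _ _]; apply: le_trans h; exact: cmod_ge0. Qed.

Lemma quad_cmod rho C f f1 u : quad rho C f f1 u -> cmod (f u) <= C.
Proof. by case. Qed.

Lemma quad_le rho C rho' C' f f1 u : quad rho C f f1 u ->
  0 < rho' -> rho' <= rho -> C <= C' -> quad rho' C' f f1 u.
Proof.
move=> q r0 rr CC; have [r1 c1 c2 H] := q; apply: quadP => //.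
- exact: le_trans CC.
- by apply: le_trans CC; apply: le_trans c2; rewrite ler_wpM2r// cmod_ge0.
move=> h x x0 x1 hx; apply: (@le_trans _ _ (C * x ^+ 2)); last first.
  by rewrite ler_wpM2r ?sqr_ge0.
have hr : cmod h <= rho by rewrite hx (le_trans _ rr)// ger_pMl.
apply: le_trans (H h hr) _; rewrite ler_wpM2l ?(quad_ge0 q)//.
rewrite ler_pXn2r ?nnegrE ?divr_ge0 ?cmod_ge0 ?(ltW r1)//.
by rewrite ler_pdivrMr// hx ler_wpM2l.
Qed.

Lemma quad_incr rho C f f1 u h x : quad rho C f f1 u -> 0 <= x -> x <= 1 ->
  cmod h = x * rho -> cmod (f (u + h) - f u) <= 2 * C * x.
Proof.
move=> q x0 x1 hx; have [r1 c1 c2 _] := q.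
have -> : f (u + h) - f u = (f (u + h) - f u - h * f1) + h * f1 by ring.
apply: le_trans (cmodD _ _) _.
have h1 := quadE q x1 hx; have C0 := quad_ge0 q.
have h2 : cmod (h * f1) <= C * x by rewrite cmodM hx mulrAC -mulrA mulrC ler_wpM2r// mulrC.
have h3 : C * x ^+ 2 <= C * x by rewrite ler_wpM2l// expr2 ler_piMl.
by lra.
Qed.

Lemma quad_bound rho C f f1 u h : quad rho C f f1 u -> cmod h <= rho ->
  cmod (f (u + h)) <= 3 * C.
Proof.
move=> q hr; have r0 := quad_gt0 q; have C0 := quad_ge0 q.
have x0 : 0 <= cmod h / rho by rewrite divr_ge0 ?cmod_ge0 ?(ltW r0).
have x1 : cmod h / rho <= 1 by rewrite ler_pdivrMr ?mul1r.
have e : cmod h = (cmod h / rho) * rho by rewrite divfK ?gt_eqF.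
have h1 := quad_incr q x0 x1 e; have h2 := quad_cmod q.
rewrite -(subrK (f u) (f (u + h))); apply: le_trans (cmodD _ _) _.
have h3 : 2 * C * (cmod h / rho) <= 2 * C by rewrite ler_piMr// mulr_ge0.
by lra.
Qed.

Lemma quad_fun_eq rho C f g f1 u : quad rho C f f1 u -> f =1 g ->
  quad rho C g f1 u.
Proof. by move=> q fg; have -> : g = f by apply/funext => ?; rewrite fg. Qed.

Lemma quad_cst rho C k u : 0 < rho -> cmod k <= C -> quad rho C (fun=> k) 0 u.
Proof.
move=> r0 kC; have C0 := le_trans (cmod_ge0 k) kC.
apply: quadP => //; first by rewrite cmod0 mulr0.
by move=> h x x0 x1 _; rewrite subrr mulr0 subr0 cmod0 mulr_ge0 ?sqr_ge0.
Qed.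

Lemma quad_id rho C u : 0 < rho -> rho <= C -> cmod u <= C -> quad rho C id 1 u.
Proof.
move=> r0 rC uC; have C0 := le_trans (cmod_ge0 u) uC.
apply: quadP => //; first by rewrite cmod1 mulr1.
by move=> h x x0 x1 _; rewrite /= mulr1 [u + h]addrC addrK subrr cmod0 mulr_ge0 ?sqr_ge0.
Qed.

Lemma quadD rho C C' f g f1 g1 u : quad rho C f f1 u -> quad rho C' g g1 u ->
  quad rho (C + C') (fun w => f w + g w) (f1 + g1) u.
Proof.
move=> qf qg; have [r0 f0 f2 _] := qf; have [_ g0 g2 _] := qg.
apply: quadP => //; first by apply: le_trans (cmodD _ _) _; rewrite lerD.
  apply: (@le_trans _ _ (rho * cmod f1 + rho * cmod g1)); last by rewrite lerD.
  by rewrite -mulrDr ler_wpM2l ?(ltW r0)// cmodD.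
move=> h x x0 x1 hx.
have -> : f (u + h) + g (u + h) - (f u + g u) - h * (f1 + g1) =
  (f (u + h) - f u - h * f1) + (g (u + h) - g u - h * g1) by ring.
apply: le_trans (cmodD _ _) _; rewrite mulrDl lerD//; first exact: quadE qf x1 hx.
exact: quadE qg x1 hx.
Qed.

(** The remainder is that of [f] times [g (u + h)], plus [f u] times that of [g], plus [h f1] times
    the increment of [g]; in units of [C C'] these cost 3, 1 and 2, whence 6. *)
Lemma quadM rho C C' f g f1 g1 u : quad rho C f f1 u -> quad rho C' g g1 u ->
  quad rho (6 * C * C') (fun w => f w * g w) (f1 * g u + f u * g1) u.
Proof.
move=> qf qg; have [r0 f0 f2 _] := qf; have [_ g0 g2 _] := qg.
have C0 := quad_ge0 qf; have C0' := quad_ge0 qg.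
have CC : 0 <= C * C' by rewrite mulr_ge0.
have fg0 : cmod (f u) * cmod (g u) <= C * C' by rewrite ler_pM ?cmod_ge0.
apply: quadP => //; first by rewrite cmodM; lra.
  apply: (@le_trans _ _ (rho * cmod f1 * cmod (g u) + cmod (f u) * (rho * cmod g1))).
    rewrite mulrCA -mulrA -mulrDr ler_wpM2l ?(ltW r0)//.
    by apply: le_trans (cmodD _ _) _; rewrite !cmodM.
  have : rho * cmod f1 * cmod (g u) <= C * C'.
    by rewrite ler_pM ?mulr_ge0 ?cmod_ge0 ?(ltW r0).
  have : cmod (f u) * (rho * cmod g1) <= C * C'.
    by rewrite ler_pM ?mulr_ge0 ?cmod_ge0 ?(ltW r0).
  by lra.
move=> h x x0 x1 hx.
have -> : f (u + h) * g (u + h) - f u * g u - h * (f1 * g u + f u * g1) =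
  (f (u + h) - f u - h * f1) * g (u + h) + f u * (g (u + h) - g u - h * g1)
  + h * f1 * (g (u + h) - g u) by ring.
have a1 := quadE qf x1 hx; have a2 := quadE qg x1 hx.
have a3 := quad_incr qg x0 x1 hx.
have hr : cmod h <= rho by rewrite hx ger_pMl.
have a4 := quad_bound qg hr.
have a5 : cmod (h * f1) <= C * x by rewrite cmodM hx mulrAC -mulrA mulrC ler_wpM2r// mulrC.
apply: le_trans (cmodD _ _) _; apply: le_trans (lerD (cmodD _ _) (lexx _)) _.
rewrite !cmodM -[cmod h * _]cmodM.
have b1 : cmod (f (u + h) - f u - h * f1) * cmod (g (u + h)) <= (C * x ^+ 2) * (3 * C').
  by rewrite ler_pM ?cmod_ge0.
have b2 : cmod (f u) * cmod (g (u + h) - g u - h * g1) <= C * (C' * x ^+ 2).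
  by rewrite ler_pM ?cmod_ge0.
have b3 : cmod (h * f1) * cmod (g (u + h) - g u) <= (C * x) * (2 * C' * x).
  by rewrite ler_pM ?cmod_ge0.
by lra.
Qed.

Lemma quadZ rho C k f f1 u : quad rho C f f1 u ->
  quad rho (cmod k * C) (fun w => k * f w) (k * f1) u.
Proof.
move=> qf; have [r0 f0 f2 _] := qf; apply: quadP => //.
- by rewrite cmodM ler_wpM2l ?cmod_ge0.
- by rewrite cmodM mulrCA ler_wpM2l ?cmod_ge0.
move=> h x x0 x1 hx.
have -> : k * f (u + h) - k * f u - h * (k * f1) = k * (f (u + h) - f u - h * f1) by ring.
by rewrite cmodM -mulrA ler_wpM2l ?cmod_ge0// (quadE qf x1 hx).
Qed.

(** The remainder is exactly [h^2 / ((k + u)^2 (k + u + h))], and a radius of at most half the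
    distance from [u] to the pole [- k] keeps [|k + u + h|] above half of [|k + u|]. *)
Lemma quadV rho k u : 0 < rho -> rho <= cmod (k + u) / 2 ->
  quad rho (cmod (k + u))^-1 (fun w => (k + w)^-1) (- (k + u) ^- 2) u.
Proof.
move=> r0 rk; have m0 : 0 < cmod (k + u) by lra.
have n0 : k + u != 0 by rewrite -cmod_gt0.
set m := cmod (k + u) in rk m0 *.
have mi : m * m^-1 = 1 by rewrite divff ?gt_eqF.
have mi0 : 0 < m^-1 by rewrite invr_gt0.
apply: quadP => //; first by rewrite cmodV.
  rewrite cmodN cmodV cmodX -/m -exprVn expr2 mulrA -[leRHS]mul1r.
  rewrite ler_wpM2r ?(ltW mi0)//; nra.
move=> h x x0 x1 hx.
have hm : cmod h <= m / 2 by rewrite hx; nra.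
have mh : m / 2 <= cmod (k + (u + h)).
  by rewrite addrA; apply: le_trans (lerB_cmodD _ _); rewrite -/m; lra.
have n1 : k + (u + h) != 0 by rewrite -cmod_gt0; lra.
have -> : (k + (u + h))^-1 - (k + u)^-1 - h * - (k + u) ^- 2 =
   h ^+ 2 * ((k + u) ^- 2 * (k + (u + h))^-1).
  by field; rewrite n0 n1.
rewrite cmodM cmodX cmodM cmodV cmodX cmodV -/m hx.
have i1 : (cmod (k + (u + h)))^-1 <= 2 * m^-1.
  rewrite -[leRHS]invrK lef_pV2 ?posrE ?invr_gt0 ?mulr_gt0//; last by lra.
  by rewrite invfM invrK mulrC.
rewrite -exprVn exprMn.
have i2 : rho ^+ 2 * m^-1 ^+ 2 <= 1 / 4.
  have i2' : rho * m^-1 <= 1 / 2.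
    by have := ler_wpM2r (ltW mi0) rk; rewrite mulrAC mi.
  have i20 : 0 <= rho * m^-1 by rewrite mulr_ge0 ?(ltW r0) ?(ltW mi0).
  by rewrite -exprMn expr2; nra.
apply: (@le_trans _ _ (x ^+ 2 * rho ^+ 2 * (m^-1 ^+ 2 * (2 * m^-1)))).
  apply: ler_wpM2l; first by rewrite mulr_ge0 ?sqr_ge0.
  by apply: ler_wpM2l; first exact: sqr_ge0.
have -> : x ^+ 2 * rho ^+ 2 * (m^-1 ^+ 2 * (2 * m^-1)) =
  (2 * m^-1 * x ^+ 2) * (rho ^+ 2 * m^-1 ^+ 2) by ring.
have i3 : 0 <= 2 * m^-1 * x ^+ 2 by rewrite !mulr_ge0 ?sqr_ge0 ?(ltW mi0).
apply: le_trans (ler_wpM2l i3 i2) _.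
have : 0 <= m^-1 * x ^+ 2 by rewrite !mulr_ge0 ?sqr_ge0 ?(ltW mi0).
by lra.
Qed.

(** One constant has to dominate the value, the derivative and the remainder, of degrees 0, 1 and 2
    in [|k| rho]; hence the square. The factor [expR (cmod k * rho)] is the growth of the
    exponential over the disc. *)
Lemma quad_cexp rho C k u : 0 < rho ->
  3 * (1 + cmod k * rho) ^+ 2 * expR (cmod k * rho) * expR (complex.Re (k * u)) <= C ->
  quad rho C (fun w => cexp (k * w)) (k * cexp (k * u)) u.
Proof.
move=> r0; set y := cmod k * rho; set E := expR (complex.Re (k * u)) => hC.
have y0 : 0 <= y by rewrite mulr_ge0 ?cmod_ge0 ?(ltW r0).
have E0 : 0 < E by exact: expR_gt0.
have ey : 1 <= expR y by rewrite -expR0 ler_expR.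
have c1 : (1 + y) ^+ 2 * E <= (1 + y) ^+ 2 * E * expR y.
  by rewrite ler_peMr// mulr_ge0 ?sqr_ge0 ?(ltW E0).
have c2 : (1 + y) * E <= (1 + y) ^+ 2 * E by rewrite ler_pM2r// expr2 ler_peMr; lra.
have yE : 0 <= y * E by rewrite mulr_ge0// ltW.
apply: quadP => //; first by rewrite cmod_cexp -/E; lra.
  by rewrite cmodM cmod_cexp -/E mulrA [rho * _]mulrC -/y; lra.
move=> h x x0 x1 hx.
rewrite mulrDr cexpD.
have -> : cexp (k * u) * cexp (k * h) - cexp (k * u) - h * (k * cexp (k * u)) =
  cexp (k * u) * (cexp (k * h) - 1 - k * h) by ring.
rewrite cmodM cmod_cexp -/E.
have kh : cmod (k * h) = x * y by rewrite cmodM hx /y; ring.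
have h1 := cexp_sub1x_le (k * h); rewrite kh in h1.
have e1 : expR (x * y) <= expR y by rewrite ler_expR ler_piMl.
have e2 : 3 * (x * y) ^+ 2 * expR (x * y) <= 3 * (x * y) ^+ 2 * expR y.
  by rewrite ler_wpM2l// mulr_ge0 ?sqr_ge0.
have e3 : E * cmod (cexp (k * h) - 1 - k * h) <= E * (3 * (x * y) ^+ 2 * expR y).
  by rewrite ler_wpM2l ?(ltW E0)//; lra.
apply: (le_trans e3); apply: le_trans (ler_wpM2r (sqr_ge0 x) hC).
have -> : E * (3 * (x * y) ^+ 2 * expR y) = (3 * y ^+ 2 * expR y * E) * x ^+ 2 by ring.
apply: ler_wpM2r; first exact: sqr_ge0.
apply: ler_wpM2r; first exact: ltW.
apply: ler_wpM2r; first exact: expR_ge0.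
by rewrite !expr2; nra.
Qed.

(** On the disc shrunk by [lam], the increment of [f] is at most [2 C lam <= rho'] and so stays in
    the disc of [g]. The bound [C'] is counted twice: for the remainder of [g], and for [g1] times
    the remainder of [f]. *)
Lemma quad_comp rho C f f1 u rho' C' g g1 lam :
  quad rho C f f1 u -> quad rho' C' g g1 (f u) ->
  0 < lam -> lam <= 1 -> 2 * C * lam <= rho' ->
  quad (lam * rho) (2 * C') (fun w => g (f w)) (f1 * g1) u.
Proof.
move=> qf qg l0 l1 lr; have [r0 f0 f2 _] := qf; have [r0' g0 g2 _] := qg.
have C0 := quad_ge0 qf; have C0' := quad_ge0 qg.
have g10 := cmod_ge0 g1; have f10 := cmod_ge0 f1.
have gl : C * lam * cmod g1 <= C' / 2.
  have : (C * lam) * cmod g1 <= (rho' / 2) * cmod g1 by rewrite ler_wpM2r//; lra.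
  by lra.
apply: quadP; first by rewrite mulr_gt0.
- by lra.
- rewrite cmodM.
  have : lam * (rho * cmod f1) * cmod g1 <= lam * C * cmod g1.
    by rewrite ler_wpM2r// ler_wpM2l// ltW.
  have -> : lam * rho * (cmod f1 * cmod g1) = lam * (rho * cmod f1) * cmod g1 by ring.
  by lra.
move=> h x x0 x1 hx.
have hx' : cmod h = (x * lam) * rho by rewrite hx mulrA.
have xl0 : 0 <= x * lam by rewrite mulr_ge0// ltW.
have xl1 : x * lam <= 1 by nra.
set kk := f (u + h) - f u.
have ek : f (u + h) = f u + kk by rewrite /kk; ring.
have k1 : cmod kk <= 2 * C * (x * lam) := quad_incr qf xl0 xl1 hx'.
have k2 : cmod (kk - h * f1) <= C * (x * lam) ^+ 2 := quadE qf xl1 hx'.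
rewrite ek.
have -> : g (f u + kk) - g (f u) - h * (f1 * g1) =
  (g (f u + kk) - g (f u) - kk * g1) + (kk - h * f1) * g1 by ring.
apply: le_trans (cmodD _ _) _.
have kr : cmod kk <= x * rho' by apply: (le_trans k1); nra.
have [_ _ _ G] := qg.
have kr' : cmod kk <= rho' by apply: (le_trans kr); rewrite ger_pMl.
have {}G := G kk kr'.
have G2 : C' * (cmod kk / rho') ^+ 2 <= C' * x ^+ 2.
  rewrite ler_wpM2l// ler_pXn2r ?nnegrE ?divr_ge0 ?cmod_ge0 ?(ltW r0')//.
  by rewrite ler_pdivrMr.
have G3 : cmod ((kk - h * f1) * g1) <= C' * x ^+ 2.
  rewrite cmodM; apply: le_trans (ler_wpM2r g10 k2) _.
  have -> : C * (x * lam) ^+ 2 * cmod g1 = (C * lam * cmod g1) * (lam * x ^+ 2) by ring.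
  have x2 : 0 <= x ^+ 2 := sqr_ge0 x.
  have lx : 0 <= lam * x ^+ 2 by rewrite mulr_ge0// ltW.
  apply: le_trans (ler_wpM2r lx gl) _.
  have : C' * (lam * x ^+ 2) <= C' * x ^+ 2 by rewrite ler_wpM2l// ler_piMl.
  have : 0 <= C' * (lam * x ^+ 2) by rewrite mulr_ge0.
  by lra.
by lra.
Qed.

(** Origin of 72: for [|a| <= 2] and [|h| = x |u| / 2], the logarithm of [1 + h / u] is at most
    [2 x], so the exponential of [a] times it has remainder [3 (4 x)^2 expR 4], and the remainder of
    the logarithm adds [2 * 3 (2 x)^2 expR 4]. *)
Definition Kpow : R := 72 * expR 4.

(** [(u + h)^a = u^a exp (a v)] with [v = log (1 + h / u)]; the branches agree because both
    arguments are below [pi / 2] in modulus. The quadratic bound on [v - h / u] comes from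
    [exp v = 1 + h / u], read as the Taylor estimate of [cexp] at [v]. *)
Lemma quad_cpow (a : R) u : `|a| <= 2 -> 0 < complex.Re u ->
  quad (cmod u / 2) (Kpow * cmod (cpow u a)) (fun w => cpow w a)
    (a%:C * u^-1 * cpow u a) u.
Proof.
move=> a2 u0; have n0 : u != 0 by apply/eqP => e; rewrite e ltxx in u0.
have m0 : 0 < cmod u by rewrite cmod_gt0.
have P0 : 0 <= cmod (cpow u a) := cmod_ge0 _.
have K1 : 1 <= Kpow by rewrite /Kpow; have := expR_ge1Dx (4 : R); lra.
have KP : cmod (cpow u a) <= Kpow * cmod (cpow u a) by rewrite ler_peMl.
apply: quadP => //; first by rewrite divr_gt0.
  rewrite cmodM [cmod (_%:C * _)]cmodM cmodR cmodV.
  have -> : cmod u / 2 * (`|a| * (cmod u)^-1 * cmod (cpow u a)) =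
     (cmod u * (cmod u)^-1) * (`|a| / 2 * cmod (cpow u a)) by ring.
  rewrite divff ?gt_eqF// mul1r; apply: le_trans KP.
  by rewrite ler_piMl//; lra.
move=> h x x0 x1 hx.
pose s := h / u.
have us : u + h = u * (1 + s) by rewrite /s mulrDr mulr1 mulrCA divff// mulr1.
have sx : cmod s = x / 2.
  by rewrite cmodM cmodV hx; field; rewrite gt_eqF.
have s2 : cmod s <= 1 / 2 by rewrite sx; lra.
have [c1 c2 c3] := cln_1D_le s2.
have cu := carg_Re_gt0 u0.
set v := cln (1 + s) in c3.
have pv : cpow (u + h) a = cpow u a * cexp (a%:C * v).
  rewrite us cpowM//.
  by move: cu c1; rewrite !ltr_norml => /andP[? ?] /andP[? ?]; apply/andP; split; lra.
have ev : cexp v = 1 + s := cexp_cln c2.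
rewrite pv.
have -> : cpow u a * cexp (a%:C * v) - cpow u a - h * (a%:C * u^-1 * cpow u a) =
   cpow u a * ((cexp (a%:C * v) - 1 - a%:C * v) + a%:C * (v - s)).
  by rewrite /s; ring.
rewrite cmodM mulrAC mulrC ler_wpM2r//.
apply: le_trans (cmodD _ _) _; rewrite cmodM cmodR.
have v2 : cmod v <= 2 * x by lra.
have E1 : cmod (v - s) <= 3 * (2 * x) ^+ 2 * expR 4.
  have -> : v - s = - (cexp v - 1 - v) by rewrite ev; ring.
  rewrite cmodN; apply: le_trans (cexp_sub1x_le _) _.
  apply: ler_pM; [by rewrite mulr_ge0 ?sqr_ge0|exact: expR_ge0| |by rewrite ler_expR; lra].
  by rewrite ler_wpM2l// ler_pXn2r ?nnegrE ?cmod_ge0 ?mulr_ge0.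
have av : cmod (a%:C * v) <= 4 * x.
  by rewrite cmodM cmodR; have := cmod_ge0 v; have := normr_ge0 a; nra.
have E2 : cmod (cexp (a%:C * v) - 1 - a%:C * v) <= 3 * (4 * x) ^+ 2 * expR 4.
  apply: le_trans (cexp_sub1x_le _) _.
  apply: ler_pM; [by rewrite mulr_ge0 ?sqr_ge0|exact: expR_ge0| |by rewrite ler_expR; lra].
  by rewrite ler_wpM2l// ler_pXn2r ?nnegrE ?cmod_ge0 ?mulr_ge0.
have E3 : `|a| * cmod (v - s) <= 2 * (3 * (2 * x) ^+ 2 * expR 4).
  by rewrite ler_pM ?cmod_ge0.
by rewrite /Kpow; lra.
Qed.

Lemma quad_derivable rho C (F : R[i] -> R[i]) f1 u : quad rho C F f1 u ->
  derivable (F : R[i]^o -> R[i]^o) u 1.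
Proof.
move=> q; have [r0 _ _ H] := q; have C0 := quad_ge0 q.
apply/cvg_ex; exists f1; apply/cvgrPdist_le => /= e e0.
(* In the order of [R[i]], a positive element is real. *)
have [e1 e2] : e = (complex.Re e)%:C /\ 0 < complex.Re e.
  move: e0; rewrite ltcE /= => /andP[/eqP ei er]; split=> //.
  by apply: complexP => //=; rewrite ei.
set e' := complex.Re e in e1 e2.
(* The remainder divided by [h] is at most [C |h| / rho^2]; the added 1 avoids a division by 0. *)
pose d := Num.min rho (e' * rho ^+ 2 / (C + 1)).
have d0 : 0 < d.
  by rewrite lt_min r0 /= divr_gt0 ?mulr_gt0 ?exprn_gt0//; lra.
have dC : 0 < d%:C :> R[i] by rewrite ltcR.
near=> h.
have hn0 : h != 0 by near: h; exact: (@nbhs_dnbhs_neq (R[i]^o) 0).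
have hd : `|h| < d%:C by near: h; exact: (@dnbhs0_lt R[i] R[i]^o _ dC).
have hd' : cmod h < d by move: hd; rewrite -[`|h|]/((cmod h)%:C) ltcR.
have h1 : cmod h <= rho by apply: ltW (lt_le_trans hd' _); rewrite ge_min lexx.
have h2 : cmod h <= e' * rho ^+ 2 / (C + 1).
  by apply: ltW (lt_le_trans hd' _); rewrite ge_min lexx orbT.
have m0 : 0 < cmod h by rewrite cmod_gt0.
have -> : f1 - h^-1 *: (F (h *: (1 : R[i]^o) + u) - F u) =
  - (h^-1 * (F (u + h) - F u - h * f1)).
  rewrite -[h *: (1 : R[i]^o)]/(h * 1) -[h^-1 *: _]/(h^-1 * _) mulr1 [h + u]addrC.
  by field.
rewrite e1 -[X in X <= _]/((cmod _)%:C) lecR cmodN cmodM cmodV.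
rewrite mulrC ler_pdivrMr//; apply: le_trans (H _ h1) _.
have rr : 0 < rho ^+ 2 by rewrite exprn_gt0.
have C1 : 0 < C + 1 by lra.
have h3 : C * cmod h <= e' * rho ^+ 2.
  by move: h2; rewrite ler_pdivlMr//; lra.
rewrite expr_div_n mulrA ler_pdivrMr//.
by have := ler_wpM2r (ltW m0) h3; rewrite expr2; lra.
Unshelve. all: by end_near. Qed.

Lemma is_derive_taylor (g : R -> R) x (l r M : R) : 0 < r ->
  (forall h : R, `|h| <= r -> `|g (x + h) - g x - h * l| <= M * h ^+ 2) ->
  is_derive x 1 g l.
Proof.
move=> r0 H; have M0 : 0 <= M.
  have := H r; rewrite gtr0_norm// => /(_ (lexx _)) h.
  have := le_trans (normr_ge0 _) h; rewrite pmulr_lge0// exprn_gt0//.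
suff cv : h^-1 *: (g (h *: 1 + x) - g x) @[h --> 0^'] --> l.
  by apply: DeriveDef; [apply/cvg_ex; exists l|exact: cvg_lim].
apply/cvgrPdist_le => /= e e0.
pose d := Num.min r (e / (M + 1)).
have d0 : 0 < d by rewrite lt_min r0 /= divr_gt0//; lra.
near=> h.
have hn0 : h != 0 by near: h; exact: nbhs_dnbhs_neq.
have hd : `|h| < d by near: h; exact: dnbhs0_lt.
have h1 : `|h| <= r by apply: ltW (lt_le_trans hd _); rewrite ge_min lexx.
have h2 : `|h| <= e / (M + 1) by apply: ltW (lt_le_trans hd _); rewrite ge_min lexx orbT.
have m0 : 0 < `|h| by rewrite normr_gt0.
have -> : l - h^-1 *: (g (h *: 1 + x) - g x) = - (h^-1 * (g (x + h) - g x - h * l)).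
  rewrite -[h *: 1]/(h * 1) -[h^-1 *: _]/(h^-1 * _) mulr1 [h + x]addrC.
  by field.
rewrite normrN normrM normfV mulrC ler_pdivrMr//; apply: le_trans (H _ h1) _.
have -> : h ^+ 2 = `|h| * `|h| by rewrite -expr2 real_normK ?num_real.
rewrite mulrA ler_pM2r//; have M1 : 0 < M + 1 by lra.
by move: h2; rewrite ler_pdivlMr//; lra.
Unshelve. all: by end_near. Qed.

Section Line.
Variables (v : R[i]) (c : R[i]) (F : R[i] -> R[i]) (f1 : R[i]) (x rho C : R).
Hypothesis q : quad rho C F f1 (c + x%:C * v).

(** The path [x |-> c + x v] carries the complex estimate to a real variable, where the fundamental
    theorem of calculus applies to real and imaginary parts. The radius is divided by [1 + |v|] to
    allow [v = 0]. *)
Lemma quad_taylor_line : exists r M : R, 0 < r /\ forall h : R, `|h| <= r ->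
  cmod (F (c + (x + h)%:C * v) - F (c + x%:C * v) - h%:C * (v * f1)) <= M * h ^+ 2.
Proof.
have [r0 _ _ H] := q; have v0 := cmod_ge0 v.
exists (rho / (1 + cmod v)), (C * (cmod v / rho) ^+ 2); split.
  by rewrite divr_gt0//; lra.
move=> h; rewrite ler_pdivlMr; last by lra.
move=> hr; have hv : cmod (h%:C * v) <= rho.
  rewrite cmodM cmodR; apply: le_trans hr; rewrite ler_wpM2l//; lra.
rewrite rmorphD mulrDl addrA [_ * (v * _)]mulrA; apply: le_trans (H _ hv) _.
rewrite cmodM cmodR -[h ^+ 2]real_normK ?num_real//.
by rewrite [leLHS](_ : _ = C * (cmod v / rho) ^+ 2 * `|h| ^+ 2)//; ring.
Qed.

Lemma quad_is_derive_Re :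
  is_derive x 1 (fun y : R => complex.Re (F (c + y%:C * v))) (complex.Re (v * f1)).
Proof.
have [r [M [r0 H]]] := quad_taylor_line.
apply: (is_derive_taylor r0 (M := M)) => h hr; apply: le_trans (H h hr).
apply: le_trans (normRe_cmod _); rewrite !(cReD, cReN) [complex.Re (h%:C * _)]cReM.
by rewrite /= mul0r subr0.
Qed.

Lemma quad_is_derive_Im :
  is_derive x 1 (fun y : R => complex.Im (F (c + y%:C * v))) (complex.Im (v * f1)).
Proof.
have [r [M [r0 H]]] := quad_taylor_line.
apply: (is_derive_taylor r0 (M := M)) => h hr; apply: le_trans (H h hr).
apply: le_trans (normIm_cmod _); rewrite !(cImD, cImN) [complex.Im (h%:C * _)]cImM.
by rewrite /= mul0r addr0.
Qed.

End Line.

End Quad.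

(** * Sectors and sectorial functions *)

Section Sectors.
Context {R : realType}.
Implicit Types (u w z : R[i]) (a b r x eta : R).

(* Sectors of arbitrary opening, not tied to the principal argument: unlike
   [closed_sector], they are stable under multiplication. *)
Definition insec eta u := exists r b, [/\ 0 < r, `|b| <= eta & u = r%:C * cis b].

Lemma insec_neq0 eta u : insec eta u -> u != 0.
Proof.
move=> [r [b [r0 _ ->]]]; rewrite -cmod_gt0 cmodM cmod_cis mulr1 cmodR.
by rewrite normr_gt0 gt_eqF.
Qed.

Lemma insec_ge0 eta u : insec eta u -> 0 <= eta.
Proof. by move=> [r [b [r0 be _]]]; exact: le_trans be. Qed.

Lemma insecM a b u w : insec a u -> insec b w -> insec (a + b) (u * w).
Proof.
move=> [r [x [r0 xa ->]]] [r' [x' [r0' xb ->]]]; exists (r * r'), (x + x').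
split; first exact: mulr_gt0.
  by apply: le_trans (ler_normD _ _) _; exact: lerD.
by rewrite cisD rmorphM /=; ring.
Qed.

Lemma insec_real x : 0 < x -> insec 0 x%:C.
Proof. by move=> x0; exists x, 0; rewrite normr0 cis0 mulr1. Qed.

Lemma insec_cpow z a eta : `|carg z| <= eta -> insec (`|a| * eta) (cpow z a).
Proof.
move=> h; exists (expR (a * ln (cmod z))), (a * carg z); split.
- exact: expR_gt0.
- by rewrite normrM ler_wpM2l.
- exact: cpow_polar.
Qed.

Lemma insec_cpow_Re_gt0 z a : 0 < complex.Re z -> insec (`|a| * (pi / 2)) (cpow z a).
Proof. by move=> z0; apply: insec_cpow; rewrite ltW// carg_Re_gt0. Qed.

Lemma cos_norm_ge x eta : `|x| <= eta -> eta <= pi -> cos eta <= cos x.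
Proof.
move=> h1 h2; rewrite -[cos x]cos_norm leNgt ltr_cos ?in_itv /= -?leNgt ?normr_ge0//.
  by rewrite (le_trans _ h1).
exact: le_trans h1 h2.
Qed.

Lemma insec_Re_ge eta u : insec eta u -> eta <= pi ->
  cos eta * cmod u <= complex.Re u.
Proof.
move=> [r [x [r0 xe ->]]] ep.
rewrite cmodM cmod_cis mulr1 cmodR gtr0_norm// cReM /= mul0r subr0 mulrC ler_pM2l//.
exact: cos_norm_ge.
Qed.

(** With [c = cos eta] and [m = |u|], [|1 + u|^2 >= 1 + 2 c m + m^2], which exceeds
    [(1 + c) / 2 * (1 + m)^2] by [(1 - c) / 2 * (1 - m)^2]; and [(1 + c) / 2], being at most 1,
    dominates its own square. The constant is positive for [eta < pi]: only the direction of the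
    pole [-1] is lost. *)
Lemma insec_1D_ge eta u : insec eta u -> eta <= pi ->
  (1 + cos eta) / 2 * (1 + cmod u) <= cmod (1 + u).
Proof.
move=> us ep; have e0 := insec_ge0 us.
have := insec_Re_ge us ep; set m := cmod u => h.
have m0 : 0 <= m := cmod_ge0 u.
have c1 := cos_le1 eta; have c2 := cos_geN1 eta.
set c := cos eta in h c1 c2 *.
rewrite ge_cmodP; last by rewrite mulr_ge0//; lra.
rewrite cReD cImD /= add0r.
have -> : (1 + complex.Re u) ^+ 2 + complex.Im u ^+ 2 = 1 + 2 * complex.Re u + m ^+ 2.
  by rewrite sqr_cmod; ring.
rewrite exprMn; have h1 : ((1 + c) / 2) ^+ 2 <= (1 + c) / 2.
  by rewrite expr2 ler_piMl//; lra.
have h2 := ler_wpM2r (sqr_ge0 (1 + m)) h1; apply: (le_trans h2).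
have : (1 + c) / 2 * (1 + m) ^+ 2 <= 1 + 2 * (c * m) + m ^+ 2.
  have h3 : 0 <= (1 - c) * (1 - m) ^+ 2 by rewrite mulr_ge0 ?sqr_ge0//; lra.
  by move: h3; rewrite !expr2; lra.
by lra.
Qed.

(* The bound shared by all the integrands: it controls both the behaviour at 0
   and at infinity, and its integral against dr / r is scale invariant. *)
Definition bump r := r / (1 + r) ^+ 2.

Lemma bump_ge0 r : 0 <= r -> 0 <= bump r.
Proof. by move=> r0; rewrite /bump divr_ge0// sqr_ge0. Qed.

Lemma bump_le1 r : 0 <= r -> bump r <= 1.
Proof.
move=> r0; rewrite /bump ler_pdivrMr ?exprn_gt0//; last by lra.
by rewrite expr2; nra.
Qed.

Lemma bump_le r : 0 <= r -> bump r <= r.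
Proof.
move=> r0; rewrite /bump ler_pdivrMr ?exprn_gt0//; last by lra.
by rewrite ler_peMr// expr2; nra.
Qed.

(** This symmetry between 0 and infinity lets [bump_line] treat powers of either sign. *)
Lemma bumpV r : 0 < r -> bump r^-1 = bump r.
Proof. by move=> r0; rewrite /bump; field; rewrite !gt_eqF//; lra. Qed.

(** The constants may degenerate as [eta] approaches [omega], but the derivative [P1] is the same
    for all [eta]. The radius is proportional to [|u|]: at [u = s e(x)] it becomes, in the variable
    [s], a radius [dlt |s|] independent of [x], as [quad_cint] requires. *)
Definition sectorial (omega : R) (P : R[i] -> R[i]) :=
  exists P1 : R[i] -> R[i], forall eta, eta < omega -> exists C dlt,
    0 < dlt /\ forall u, insec eta u ->
      quad (dlt * cmod u) (C * bump (cmod u)) P (P1 u) u.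

Lemma sectorialD omega P Q : sectorial omega P -> sectorial omega Q ->
  sectorial omega (fun u => P u + Q u).
Proof.
move=> [P1 HP] [Q1 HQ]; exists (fun u => P1 u + Q1 u) => eta h.
have [C [d [d0 q]]] := HP _ h; have [C' [d' [d0' q']]] := HQ _ h.
have m0 : 0 < Num.min d d' by rewrite lt_min d0.
exists (C + C'), (Num.min d d'); split=> // u us.
have u0 : 0 < cmod u by rewrite cmod_gt0 (insec_neq0 us).
rewrite mulrDl; apply: quadD.
- by apply: quad_le (q u us) _ _ _ => //; rewrite ?mulr_gt0 ?ler_pM2r ?ge_min ?lexx.
- apply: quad_le (q' u us) _ _ _ => //; first by rewrite ?mulr_gt0.
  by rewrite ler_pM2r// ge_min lexx orbT.
Qed.

Lemma sectorialZ omega P (k : R[i]) : sectorial omega P ->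
  sectorial omega (fun u => k * P u).
Proof.
move=> [P1 HP]; exists (fun u => k * P1 u) => eta h.
have [C [d [d0 q]]] := HP _ h.
exists (cmod k * C), d; split=> // u us; rewrite -mulrA; apply: quadZ; exact: q.
Qed.

(** A single term of the exponential series at [1 + x], that of degree 5. In [quad_cexp_decay], 2 of
    these powers are lost to [quad_cexp] and 3 give the decay. *)
Lemma expR_pow5 x : 0 <= x -> (1 + x) ^+ 5 <= 120 * expR 1 * expR x.
Proof.
move=> x0; have := @expR_ge1Dxn R (1 + x) 4 ; rewrite expRD => /(_ _) h.
have {h} : 1 + (1 + x) ^+ 5 / 5`!%:R <= expR 1 * expR x by apply: h; lra.
have -> : (5`!)%:R = 120 :> R by rewrite !factS fact0 !natrM; ring.
by lra.
Qed.

(** On the sector [exp (- tau u)] is at most [exp (- tau cos(eta) |u|)], and a radius of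
    [cos(eta) / 2 * |u|] gives back no more than half of that exponent. Cubic decay leaves a
    multiple of [bump] after multiplication by [u] or by [u^2]. *)
Lemma quad_cexp_decay (tau : R) eta : 0 < tau -> 0 <= eta -> eta < pi / 2 ->
  exists C dlt, [/\ 0 < C, 0 < dlt, dlt <= 1 & forall u, insec eta u ->
    quad (dlt * cmod u) (C / (1 + cmod u) ^+ 3) (fun w => cexp ((- tau)%:C * w))
      ((- tau)%:C * cexp ((- tau)%:C * u)) u].
Proof.
move=> t0 e0 ep; have p0 := pi_gt0 R.
have c0 : 0 < cos eta by rewrite cos_gt0_pihalf//; lra.
have c1 := cos_le1 eta; set c := cos eta in c0 c1.
pose M := 1 + 2 / (tau * c).
have tc : 0 < tau * c by rewrite mulr_gt0.
have M0 : 0 < M by rewrite /M ltr_pwDl// divr_ge0// ltW.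
pose K := 3 * (M ^+ 3 * (120 * expR 1)).
have K0 : 0 < K by rewrite /K !mulr_gt0 ?exprn_gt0 ?expR_gt0.
exists K, (c / 2); split=> //; [by lra|by lra|].
move=> u us; set r := cmod u; have r0 : 0 < r by rewrite cmod_gt0 (insec_neq0 us).
apply: quad_cexp; first by rewrite mulr_gt0//; lra.
rewrite cmodR normrN gtr0_norm//.
pose x := tau * c * r / 2.
have xE : tau * (c / 2 * r) = x by rewrite /x; ring.
have x0 : 0 < x by rewrite /x divr_gt0// mulr_gt0.
rewrite xE -mulrA -expRD.
have ex : expR (x + complex.Re ((- tau)%:C * u)) <= expR (- x).
  rewrite ler_expR cReM /= mul0r subr0.
  have h : c * r <= complex.Re u by apply: insec_Re_ge us _; lra.
  have : tau * (c * r) <= tau * complex.Re u by rewrite ler_pM2l.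
  by rewrite /x; lra.
apply: (@le_trans _ _ (3 * (1 + x) ^+ 2 * expR (- x))).
  by rewrite ler_wpM2l// mulr_ge0 ?sqr_ge0.
rewrite ler_pdivlMr; last by rewrite exprn_gt0//; lra.
have rM : 1 + r <= M * (1 + x).
  have -> : r = 2 / (tau * c) * x by rewrite /x; field; rewrite !gt_eqF.
  have y0 : 0 < 2 / (tau * c) by rewrite divr_gt0.
  by rewrite /M; lra.
have rM3 : (1 + r) ^+ 3 <= M ^+ 3 * (1 + x) ^+ 3.
  by rewrite -exprMn lerXn2r ?nnegrE ?mulr_ge0//; lra.
have x5 := expR_pow5 (ltW x0).
have eN : expR (- x) * expR x = 1 by rewrite -expRD addNr expR0.
have en := expR_gt0 (- x).
apply: (@le_trans _ _ (3 * (1 + x) ^+ 2 * expR (- x) * (M ^+ 3 * (1 + x) ^+ 3))).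
  by rewrite ler_wpM2l// mulr_ge0 ?(ltW en)// mulr_ge0 ?sqr_ge0.
have -> : 3 * (1 + x) ^+ 2 * expR (- x) * (M ^+ 3 * (1 + x) ^+ 3) =
   (3 * M ^+ 3 * expR (- x)) * (1 + x) ^+ 5 by ring.
have h0 : 0 <= 3 * M ^+ 3 * expR (- x).
  by rewrite !mulr_ge0 ?exprn_ge0 ?(ltW en) ?(ltW M0).
apply: le_trans (ler_wpM2l h0 x5) _.
have -> : 3 * M ^+ 3 * expR (- x) * (120 * expR 1 * expR x) =
  K * (expR (- x) * expR x) by rewrite /K; ring.
by rewrite eN mulr1.
Qed.

Lemma quad_id_sec dlt eta u : 0 < dlt -> dlt <= 1 -> insec eta u ->
  quad (dlt * cmod u) (cmod u) id 1 u.
Proof.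
move=> d0 d1 us; have u0 : 0 < cmod u by rewrite cmod_gt0 (insec_neq0 us).
by apply: quad_id => //; rewrite ?mulr_gt0// ger_pMl.
Qed.

Lemma sectorial_mulexp (tau : R) : 0 < tau ->
  sectorial (pi / 2) (fun u => u * cexp ((- tau)%:C * u)).
Proof.
move=> t0; exists (fun u => 1 * cexp ((- tau)%:C * u) +
  u * ((- tau)%:C * cexp ((- tau)%:C * u))) => eta ep.
(* For [eta < 0] the sector is empty and any constants do. *)
have [e0|e0] := ltP eta 0.
  by exists 1, 1; split=> // u /insec_ge0; rewrite leNgt e0.
have [C [d [C0 d0 d1 H]]] := quad_cexp_decay t0 e0 ep.
exists (6 * C), d; split=> // u us.
have u0 : 0 < cmod u by rewrite cmod_gt0 (insec_neq0 us).
have := quadM (quad_id_sec d0 d1 us) (H u us) => /quad_le; apply => //.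
  by rewrite mulr_gt0.
rewrite /bump; set r := cmod u in u0 *.
have -> : 6 * r * (C / (1 + r) ^+ 3) = (6 * C * (r / (1 + r) ^+ 2)) / (1 + r).
  by field; rewrite gt_eqF//; lra.
rewrite ler_pdivrMr; last by lra.
rewrite ler_peMr//; last by lra.
apply: mulr_ge0; [by rewrite ?mulr_ge0 ?exprn_ge0 ?(ltW C0)|exact: bump_ge0 (ltW u0)].
Qed.

Lemma sectorial_sqrexp (tau : R) : 0 < tau ->
  sectorial (pi / 2) (fun u => u * (u * cexp ((- tau)%:C * u))).
Proof.
move=> t0; exists (fun u => 1 * (u * cexp ((- tau)%:C * u)) +
  u * (1 * cexp ((- tau)%:C * u) +
  u * ((- tau)%:C * cexp ((- tau)%:C * u)))) => eta ep.
have [e0|e0] := ltP eta 0.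
  by exists 1, 1; split=> // u /insec_ge0; rewrite leNgt e0.
have [C [d [C0 d0 d1 H]]] := quad_cexp_decay t0 e0 ep.
exists (36 * C), d; split=> // u us.
have u0 : 0 < cmod u by rewrite cmod_gt0 (insec_neq0 us).
have qi := quad_id_sec d0 d1 us.
have := quadM qi (quadM qi (H u us)) => /quad_le; apply => //.
  by rewrite mulr_gt0.
rewrite /bump; set r := cmod u in u0 *.
have -> : 6 * r * (6 * r * (C / (1 + r) ^+ 3)) =
  (36 * C * (r / (1 + r) ^+ 2)) * (r / (1 + r)).
  by field; rewrite gt_eqF//; lra.
rewrite ler_piMr//; last by rewrite ler_pdivrMr; lra.
apply: mulr_ge0; [by rewrite ?mulr_ge0 ?exprn_ge0 ?(ltW C0)|exact: bump_ge0 (ltW u0)].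
Qed.

(** [insec_1D_ge] gives [|1 + u| >= k (1 + |u|)], so a radius of [k / 2 * |u|] is at most half the
    distance to the pole, as [quadV] demands. *)
Lemma quad_inv_decay eta : 0 <= eta -> eta < pi ->
  exists C dlt, [/\ 0 < C, 0 < dlt, dlt <= 1 & forall u, insec eta u ->
    quad (dlt * cmod u) (C / (1 + cmod u)) (fun w => (1 + w)^-1)
      (- (1 + u) ^- 2) u].
Proof.
move=> e0 ep; pose k := (1 + cos eta) / 2.
have k0 : 0 < k.
  rewrite /k divr_gt0//; have : cos pi < cos eta.
    by rewrite ltr_cos ?in_itv /= ?e0 ?(ltW ep)// pi_ge0 lexx.
  by rewrite cospi; lra.
have k1 : k <= 1 by rewrite /k; have := cos_le1 eta; lra.
exists k^-1, (k / 2); split; [by rewrite invr_gt0|by lra|by lra|move=> u us].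
have h := insec_1D_ge us (ltW ep); rewrite -/k in h.
have u0 : 0 < cmod u by rewrite cmod_gt0 (insec_neq0 us).
have m0 : 0 < cmod (1 + u) by apply: lt_le_trans h; rewrite mulr_gt0//; lra.
have r0 : 0 < k / 2 * cmod u by rewrite mulr_gt0//; lra.
have rk : k / 2 * cmod u <= cmod (1 + u) / 2 by lra.
apply: quad_le (quadV r0 rk) _ _ _ => //.
rewrite -invfM lef_pV2 ?posrE// mulr_gt0//; lra.
Qed.

Lemma sectorial_ratio2 : sectorial pi (fun u => u * ((1 + u)^-1 * (1 + u)^-1)).
Proof.
exists (fun u => 1 * ((1 + u)^-1 * (1 + u)^-1) +
  u * (- (1 + u) ^- 2 * (1 + u)^-1 + (1 + u)^-1 * - (1 + u) ^- 2)) => eta ep.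
have [e0|e0] := ltP eta 0.
  by exists 1, 1; split=> // u /insec_ge0; rewrite leNgt e0.
have [C [d [C0 d0 d1 H]]] := quad_inv_decay e0 ep.
exists (36 * C ^+ 2), d; split=> // u us.
have u0 : 0 < cmod u by rewrite cmod_gt0 (insec_neq0 us).
have qi := quad_id_sec d0 d1 us.
have := quadM qi (quadM (H u us) (H u us)) => /quad_le; apply => //.
  by rewrite mulr_gt0.
rewrite /bump; set r := cmod u in u0 *.
rewrite [leLHS](_ : _ = 36 * C ^+ 2 * (r / (1 + r) ^+ 2))//.
by field; rewrite gt_eqF//; lra.
Qed.

Lemma sectorial_ratio3 :
  sectorial pi (fun u => u * (u * ((1 + u)^-1 * ((1 + u)^-1 * (1 + u)^-1)))).
Proof.
exists (fun u => 1 * (u * ((1 + u)^-1 * ((1 + u)^-1 * (1 + u)^-1))) +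
  u * (1 * ((1 + u)^-1 * ((1 + u)^-1 * (1 + u)^-1)) +
  u * (- (1 + u) ^- 2 * ((1 + u)^-1 * (1 + u)^-1) +
    (1 + u)^-1 * (- (1 + u) ^- 2 * (1 + u)^-1 + (1 + u)^-1 * - (1 + u) ^- 2)))).
move=> eta ep; have [e0|e0] := ltP eta 0.
  by exists 1, 1; split=> // u /insec_ge0; rewrite leNgt e0.
have [C [d [C0 d0 d1 H]]] := quad_inv_decay e0 ep.
exists (6 ^+ 4 * C ^+ 3), d; split=> // u us.
have u0 : 0 < cmod u by rewrite cmod_gt0 (insec_neq0 us).
have qi := quad_id_sec d0 d1 us; have Hu := H u us.
have := quadM qi (quadM qi (quadM Hu (quadM Hu Hu))) => /quad_le; apply => //.
  by rewrite mulr_gt0.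
rewrite /bump; set r := cmod u in u0 *.
rewrite [leLHS](_ : _ = (6 ^+ 4 * C ^+ 3 * (r / (1 + r) ^+ 2)) * (r / (1 + r)));
  last by field; rewrite gt_eqF//; lra.
rewrite ler_piMr//; last by rewrite ler_pdivrMr; lra.
apply: mulr_ge0; [by rewrite ?mulr_ge0 ?exprn_ge0 ?(ltW C0)|exact: bump_ge0 (ltW u0)].
Qed.

End Sectors.

(** * Complex-valued integrals *)

Section Cmeasurable.
Context d (T : measurableType d) {R : realType}.
Implicit Types (F G : T -> R[i]) (f : T -> R).

Definition cmeasurable F := measurable_fun setT (fun x => complex.Re (F x)) /\
  measurable_fun setT (fun x => complex.Im (F x)).

Lemma cmeasurable_cst k : cmeasurable (fun=> k).
Proof. by split; exact: measurable_cst. Qed.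

Lemma cmeasurable_real f : measurable_fun setT f -> cmeasurable (fun x => (f x)%:C).
Proof. by move=> mf; split=> //=; exact: measurable_cst. Qed.

Lemma cmeasurableD F G : cmeasurable F -> cmeasurable G ->
  cmeasurable (fun x => F x + G x).
Proof.
move=> [f1 f2] [g1 g2]; split.
  by under eq_fun do rewrite cReD; exact: measurable_funD.
by under eq_fun do rewrite cImD; exact: measurable_funD.
Qed.

Lemma cmeasurableM F G : cmeasurable F -> cmeasurable G ->
  cmeasurable (fun x => F x * G x).
Proof.
move=> [f1 f2] [g1 g2]; split.
  under eq_fun do rewrite cReM.
  by apply: measurable_funB; exact: measurable_funM.
under eq_fun do rewrite cImM.
by apply: measurable_funD; exact: measurable_funM.
Qed.

Lemma cmeasurableN F : cmeasurable F -> cmeasurable (fun x => - F x).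
Proof.
move=> mF; under eq_fun do rewrite -mulN1r.
by apply: cmeasurableM => //; exact: cmeasurable_cst.
Qed.

Lemma cmeasurableB F G : cmeasurable F -> cmeasurable G ->
  cmeasurable (fun x => F x - G x).
Proof. by move=> mF mG; apply: cmeasurableD => //; exact: cmeasurableN. Qed.

Lemma cmeasurable_cexp F : cmeasurable F -> cmeasurable (fun x => cexp (F x)).
Proof.
move=> [f1 f2]; apply: cmeasurableM.
  by apply: cmeasurable_real; exact: measurableT_comp (@measurable_expR R) f1.
have mc : measurable_fun setT (@cos R).
  by apply: continuous_measurable_fun; exact: continuous_cos.
have ms : measurable_fun setT (@sin R).
  by apply: continuous_measurable_fun; exact: continuous_sin.
by split; [exact: measurableT_comp mc f2|exact: measurableT_comp ms f2].
Qed.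

Lemma cmeasurableV F : cmeasurable F -> cmeasurable (fun x => (F x)^-1).
Proof.
move=> [f1 f2].
have mn : measurable_fun setT
    (fun x => (complex.Re (F x) ^+ 2 + complex.Im (F x) ^+ 2)^-1).
  (* On nonnegative reals the inverse is [powR] with exponent -1, also at 0, where both are 0 by
     convention. *)
  under eq_fun do rewrite -powR_inv1 ?addr_ge0 ?sqr_ge0//.
  apply: (measurableT_comp (@measurable_powR R (-1))).
  by apply: measurable_funD; exact: measurable_funX.
split.
  rewrite [X in measurable_fun _ X](_ : _ = (fun x => complex.Re (F x) *
    (complex.Re (F x) ^+ 2 + complex.Im (F x) ^+ 2)^-1)).
    exact: measurable_funM.
  by apply/funext => x; case: (F x).
rewrite [X in measurable_fun _ X](_ : _ = (fun x => - (complex.Im (F x) *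
    (complex.Re (F x) ^+ 2 + complex.Im (F x) ^+ 2)^-1))).
  by apply: measurable_funN; exact: measurable_funM.
by apply/funext => x; case: (F x).
Qed.

Lemma measurable_cmod F : cmeasurable F -> measurable_fun setT (fun x => cmod (F x)).
Proof.
move=> [f1 f2].
have ms : measurable_fun setT (@Num.sqrt R).
  by apply: continuous_measurable_fun; exact: sqrt_continuous.
rewrite [X in measurable_fun _ X](_ : _ = (fun x => Num.sqrt
  (complex.Re (F x) ^+ 2 + complex.Im (F x) ^+ 2))); last first.
  by apply/funext => x; case: (F x).
apply: (measurableT_comp ms).
by apply: measurable_funD; exact: measurable_funX.
Qed.

(** Meant for derivatives, which are limits of difference quotients; the rate may depend on [x],
    since pointwise convergence is enough. *)
Lemma cmeasurable_lim (F_ : nat -> T -> R[i]) F (C : T -> R) :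
  (forall n, cmeasurable (F_ n)) ->
  (forall n x, cmod (F_ n x - F x) <= C x / n.+1%:R) -> cmeasurable F.
Proof.
move=> mF H.
have cv (g : R[i] -> R) : (forall a b, `|g a - g b| <= cmod (a - b)) ->
    forall x, g (F_ n x) @[n --> \oo] --> g (F x).
  move=> lg x; apply/cvgrPdist_le => e e0.
  have C0 : 0 <= C x by have := le_trans (cmod_ge0 _) (H 0%N x); rewrite divr1.
  near=> n; rewrite distrC; apply: le_trans (lg _ _) _; apply: le_trans (H n x) _.
  rewrite ler_pdivrMr// -ler_pdivrMl// mulrC.
  have h : C x / e <= n%:R by near: n; exact: nbhs_infty_ger.
  by apply: (le_trans h); rewrite ler_nat.
have lRe (a b : R[i]) : `|complex.Re a - complex.Re b| <= cmod (a - b).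
  by rewrite -cReN -cReD normRe_cmod.
have lIm (a b : R[i]) : `|complex.Im a - complex.Im b| <= cmod (a - b).
  by rewrite -cImN -cImD normIm_cmod.
split.
  apply: (measurable_fun_cvg (h := fun n x => complex.Re (F_ n x))) => //.
    by move=> n; case: (mF n).
  by move=> x _; exact: (cv _ lRe).
apply: (measurable_fun_cvg (h := fun n x => complex.Im (F_ n x))) => //.
  by move=> n; case: (mF n).
by move=> x _; exact: (cv _ lIm).
Unshelve. all: by end_near. Qed.

End Cmeasurable.

Lemma cmeasurable_comp d d' (T : measurableType d) (T' : measurableType d')
  (R : realType) (F : T' -> R[i]) (p : T -> T') : cmeasurable F ->
  measurable_fun setT p -> cmeasurable (fun x => F (p x)).
Proof.
by move=> [f1 f2] mp; split; [exact: measurableT_comp f1 mp|exact: measurableT_comp f2 mp].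
Qed.

Section Cint.
Context d (T : measurableType d) {R : realType} (mu : {measure set T -> \bar R}).
Implicit Types (F G : T -> R[i]) (g : T -> R).

Definition cint F : R[i] :=
  (\int[mu]_x complex.Re (F x))%R +i* (\int[mu]_x complex.Im (F x))%R.

Definition cintegrable F := mu.-integrable setT (fun x => (complex.Re (F x))%:E) /\
  mu.-integrable setT (fun x => (complex.Im (F x))%:E).

Lemma eq_cint F G : F =1 G -> cint F = cint G.
Proof. by move=> FG; have -> : F = G by apply/funext. Qed.

Lemma integrable_dom (f g : T -> R) : measurable_fun setT f ->
  mu.-integrable setT (EFin \o g) -> (forall x, `|f x| <= g x) ->
  mu.-integrable setT (EFin \o f).
Proof.
move=> mf ig fg; apply: le_integrable ig => //; first exact/measurable_EFinP.
move=> x _ /=; rewrite lee_fin; apply: le_trans (fg x) _; exact: ler_norm.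
Qed.

Lemma cintegrable_dom F g : cmeasurable F -> mu.-integrable setT (EFin \o g) ->
  (forall x, cmod (F x) <= g x) -> cintegrable F.
Proof.
move=> [f1 f2] ig Fg; split; apply: (@integrable_dom _ g) => // x.
- exact: le_trans (normRe_cmod _) _.
- exact: le_trans (normIm_cmod _) _.
Qed.

Lemma cintegrableD F G : cintegrable F -> cintegrable G ->
  cintegrable (fun x => F x + G x).
Proof.
move=> [f1 f2] [g1 g2]; split.
  rewrite (_ : (fun x => _) = (fun x => (complex.Re (F x))%:E) \+
    (fun x => (complex.Re (G x))%:E))%E; first exact: integrableD.
  by apply/funext => x; rewrite cReD EFinD.
rewrite (_ : (fun x => _) = (fun x => (complex.Im (F x))%:E) \+
  (fun x => (complex.Im (G x))%:E))%E; first exact: integrableD.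
by apply/funext => x; rewrite cImD EFinD.
Qed.

Lemma cintD F G : cintegrable F -> cintegrable G ->
  cint (fun x => F x + G x) = cint F + cint G.
Proof.
move=> [f1 f2] [g1 g2]; apply: complexP; rewrite ?cReD ?cImD /= -RintegralD//.
  by apply: eq_Rintegral => x _; rewrite cReD.
by apply: eq_Rintegral => x _; rewrite cImD.
Qed.

Lemma integrable_scale (a : R) (f : T -> R) : mu.-integrable setT (fun x => (f x)%:E) ->
  mu.-integrable setT (fun x => (a * f x)%:E).
Proof.
by move=> fi; under eq_fun do rewrite EFinM; exact: integrableZl.
Qed.

Lemma cintegrableZ k F : cintegrable F -> cintegrable (fun x => k * F x).
Proof.
move=> [f1 f2]; split.
  rewrite (_ : (fun x => _) = (fun x => (complex.Re k * complex.Re (F x))%:E) \+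
    (fun x => (- complex.Im k * complex.Im (F x))%:E))%E.
    by apply: integrableD => //; exact: integrable_scale.
  by apply/funext => x; rewrite cReM -EFinD mulNr.
rewrite (_ : (fun x => _) = (fun x => (complex.Re k * complex.Im (F x))%:E) \+
  (fun x => (complex.Im k * complex.Re (F x))%:E))%E.
  by apply: integrableD => //; exact: integrable_scale.
by apply/funext => x; rewrite cImM -EFinD.
Qed.

Lemma cintZ k F : cintegrable F -> cint (fun x => k * F x) = k * cint F.
Proof.
move=> [f1 f2]; apply: complexP; rewrite ?cReM ?cImM /= -!RintegralZl//.
  rewrite -RintegralB//; try exact: integrable_scale.
  by apply: eq_Rintegral => x _; rewrite cReM.
rewrite -RintegralD//; try exact: integrable_scale.
by apply: eq_Rintegral => x _; rewrite cImM.
Qed.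

Lemma cintegrableB F G : cintegrable F -> cintegrable G ->
  cintegrable (fun x => F x - G x).
Proof.
move=> iF iG; rewrite (_ : (fun x => _) = (fun x => F x + -1 * G x)).
  by apply: cintegrableD => //; exact: cintegrableZ.
by apply/funext => x; rewrite mulN1r.
Qed.

Lemma cintB F G : cintegrable F -> cintegrable G ->
  cint (fun x => F x - G x) = cint F - cint G.
Proof.
move=> iF iG; rewrite (@eq_cint _ (fun x => F x + -1 * G x)).
  by rewrite cintD// ?cintZ ?mulN1r//; exact: cintegrableZ.
by move=> x; rewrite mulN1r.
Qed.

Lemma cmod_cint_le F g : cintegrable F -> mu.-integrable setT (EFin \o g) ->
  (forall x, cmod (F x) <= g x) -> cmod (cint F) <= 2 * (\int[mu]_x g x)%R.
Proof.
move=> [f1 f2] ig Fg; apply: le_trans (cmod_le_ReIm _) _ => /=.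
have h1 : `|(\int[mu]_x complex.Re (F x))%R| <= (\int[mu]_x g x)%R.
  apply: le_trans (le_normr_Rintegral _ _) _ => //.
  apply: le_Rintegral => //; first exact: integrable_norm.
  by move=> x _; exact: le_trans (normRe_cmod _) _.
have h2 : `|(\int[mu]_x complex.Im (F x))%R| <= (\int[mu]_x g x)%R.
  apply: le_trans (le_normr_Rintegral _ _) _ => //.
  apply: le_Rintegral => //; first exact: integrable_norm.
  by move=> x _; exact: le_trans (normIm_cmod _) _.
by lra.
Qed.

(** No limit is exchanged with an integral: the pointwise remainder, [C x] times a square free of
    [x], is integrated as it stands. This is why the radius is common to all [x]. The factor 2 comes
    from bounding real and imaginary parts separately. *)
Lemma quad_cint (K : T -> R[i] -> R[i]) (K1 : T -> R[i]) (C : T -> R) rho (u : R[i]) :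
  (forall w, cmod (w - u) <= rho -> cmeasurable (fun x => K x w)) ->
  0 < rho -> mu.-integrable setT (EFin \o C) ->
  (forall x, quad rho (C x) (K x) (K1 x) u) ->
  quad rho (2 * (\int[mu]_x C x)%R) (fun w => cint (fun x => K x w)) (cint K1) u.
Proof.
move=> mK r0 iC q.
have mKu : cmeasurable (fun x => K x u) by apply: mK; rewrite subrr cmod0 ltW.
have mKh h : cmod h <= rho -> cmeasurable (fun x => K x (u + h)).
  by move=> hr; apply: mK; rewrite addrC addKr.
have C0 x : 0 <= C x := quad_ge0 (q x).
(* [K1] is the limit of the difference quotients with steps [rho / n.+1], which stay within the
   disc. *)
have mK1 : cmeasurable K1.
  pose h n : R[i] := (rho / n.+1%:R)%:C.
  have hE n : cmod (h n) = n.+1%:R^-1 * rho.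
    by rewrite cmodR ger0_norm ?divr_ge0 ?(ltW r0)// mulrC.
  have nV n : n.+1%:R^-1 <= 1 :> R by rewrite invf_le1// ler1n.
  have hr n : cmod (h n) <= rho by rewrite hE ger_pMl.
  have h0 n : h n != 0.
    by rewrite -cmod_gt0 hE mulr_gt0.
  apply: (@cmeasurable_lim _ _ _ (fun n x => (h n)^-1 * (K x (u + h n) - K x u)) _
    (fun x => C x / rho)).
    move=> n; apply: cmeasurableM; first exact: cmeasurable_cst.
    by apply: cmeasurableB => //; exact: mKh.
  move=> n x.
  have -> : (h n)^-1 * (K x (u + h n) - K x u) - K1 x =
    (h n)^-1 * (K x (u + h n) - K x u - h n * K1 x).
    by rewrite [RHS]mulrBr mulKf.
  rewrite cmodM cmodV mulrC ler_pdivrMr ?cmod_gt0//.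
  apply: le_trans (quadE (q x) (nV n) (hE n)) _.
  rewrite hE [leRHS](_ : _ = C x * n.+1%:R^-1 ^+ 2)//.
  have : (n.+1%:R : R) != 0 by rewrite pnatr_eq0.
  by move: (n.+1%:R : R) => k k0; field; rewrite k0 gt_eqF.
have iK h : cmod h <= rho -> cintegrable (fun x => K x (u + h)).
  move=> hr; apply: (@cintegrable_dom _ (fun x => 3 * C x)).
  - exact: mKh.
  - exact: integrable_scale.
  - by move=> x; exact: quad_bound (q x) hr.
have iKu : cintegrable (fun x => K x u).
  by apply: (@cintegrable_dom _ C) => // x; exact: quad_cmod (q x).
have K1C x : cmod (K1 x) <= rho^-1 * C x.
  by case: (q x) => _ _ c2 _; rewrite mulrC ler_pdivlMr// mulrC.
have iK1 : cintegrable K1.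
  by apply: (@cintegrable_dom _ (fun x => rho^-1 * C x)) => //; exact: integrable_scale.
apply: quadP => //.
- by apply: cmod_cint_le => // x; exact: quad_cmod (q x).
- have := cmod_cint_le iK1 (integrable_scale rho^-1 iC) K1C.
  by rewrite RintegralZl// mulrCA ler_pdivlMl.
move=> h x x0 x1 hx.
have hr : cmod h <= rho by rewrite hx ger_pMl.
rewrite -cintZ// -cintB//; last exact: iK.
rewrite -cintB//; [|exact: cintegrableB (iK _ hr) _|exact: cintegrableZ].
have D y : cmod (K y (u + h) - K y u - h * K1 y) <= x ^+ 2 * C y.
  by rewrite [leRHS]mulrC; exact: quadE (q y) x1 hx.
have iD : cintegrable (fun y => K y (u + h) - K y u - h * K1 y).
  by apply: cintegrableB; [exact: cintegrableB (iK _ hr) _|exact: cintegrableZ].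
apply: le_trans (cmod_cint_le iD (integrable_scale (x ^+ 2) iC) D) _.
by rewrite RintegralZl// mulrCA mulrC.
Qed.

End Cint.

Lemma cintegralE (R : realType) (D : set R) (F : R -> R[i]) :
  cintegral D F = cint lebesgue_measure (fun s => if s \in D then F s else 0).
Proof.
rewrite /cintegral /cint Rintegral_mkcond [in X in _ +i* X]Rintegral_mkcond.
by congr (_ +i* _); apply: eq_Rintegral => s _; rewrite patchE; case: ifP.
Qed.

Section ProductIntegral.
Context d1 d2 (T1 : measurableType d1) (T2 : measurableType d2) {R : realType}.
Variables (m1 : {sigma_finite_measure set T1 -> \bar R})
  (m2 : {sigma_finite_measure set T2 -> \bar R}).

(** With every section integrable the inner integrals are finite everywhere, so [fine] can be moved
    inside the outer integral. *)
Lemma Rintegral_prod12 (f : T1 * T2 -> R) :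
  (m1 \x m2)%E.-integrable setT (fun p => (f p)%:E) ->
  (forall x, m2.-integrable setT (fun y => (f (x, y))%:E)) ->
  (\int[(m1 \x m2)%E]_p f p)%R = (\int[m1]_x \int[m2]_y f (x, y))%R.
Proof.
move=> fi fx; rewrite /Rintegral -integral12_prod_meas1//; congr fine.
by apply: eq_integral => x _; rewrite fineK//; exact: integrable_fin_num.
Qed.

Lemma Rintegral_prod21 (f : T1 * T2 -> R) :
  (m1 \x m2)%E.-integrable setT (fun p => (f p)%:E) ->
  (forall y, m1.-integrable setT (fun x => (f (x, y))%:E)) ->
  (\int[(m1 \x m2)%E]_p f p)%R = (\int[m2]_y \int[m1]_x f (x, y))%R.
Proof.
move=> fi fx; rewrite /Rintegral -integral21_prod_meas1//; congr fine.
by apply: eq_integral => x _; rewrite fineK//; exact: integrable_fin_num.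
Qed.

Lemma cint_prod12 (F : T1 * T2 -> R[i]) : cintegrable (m1 \x m2)%E F ->
  (forall x, cintegrable m2 (fun y => F (x, y))) ->
  cint (m1 \x m2)%E F = cint m1 (fun x => cint m2 (fun y => F (x, y))).
Proof.
move=> [f1 f2] fx; apply: complexP => /=.
  by apply: Rintegral_prod12 => // x; case: (fx x).
by apply: Rintegral_prod12 => // x; case: (fx x).
Qed.

Lemma cint_prod21 (F : T1 * T2 -> R[i]) : cintegrable (m1 \x m2)%E F ->
  (forall y, cintegrable m1 (fun x => F (x, y))) ->
  cint (m1 \x m2)%E F = cint m2 (fun y => cint m1 (fun x => F (x, y))).
Proof.
move=> [f1 f2] fx; apply: complexP => /=.
  by apply: Rintegral_prod21 => // x; case: (fx x).
by apply: Rintegral_prod21 => // x; case: (fx x).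
Qed.

Lemma integrable_tonelli21 (D : T1 * T2 -> R) (H : T2 -> R) :
  measurable_fun setT D -> (forall p, 0 <= D p) ->
  m2.-integrable setT (EFin \o H) ->
  (forall y, \int[m1]_x (D (x, y))%:E <= (H y)%:E)%E ->
  (m1 \x m2)%E.-integrable setT (EFin \o D) /\
  (\int[(m1 \x m2)%E]_p D p)%R <= (\int[m2]_y H y)%R.
Proof.
move=> mD D0 iH DH.
have mD' : measurable_fun setT (EFin \o D) by exact/measurable_EFinP.
have D0' p : (0 <= (EFin \o D) p)%E by rewrite /= lee_fin.
have le1 : (\int[(m1 \x m2)%E]_p (EFin \o D) p <= \int[m2]_y (H y)%:E)%E.
  rewrite fubini_tonelli2//; apply: ge0_le_integral => //.
  - by move=> y _; apply: integral_ge0 => x _; rewrite lee_fin.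
  - exact: measurable_fun_fubini_tonelli_G.
  - exact: measurable_int iH.
  - by move=> y _; exact: DH.
have Hfin : (\int[m2]_y (H y)%:E < +oo)%E.
  by have := integrable_fin_num measurableT iH; rewrite fin_numE ltey => /andP[].
have iD : (m1 \x m2)%E.-integrable setT (EFin \o D).
  apply/integrableP; split=> //; apply: le_lt_trans Hfin; apply: le_trans le1.
  by apply: ge0_le_integral => //; [exact: measurableT_comp|move=> p _; rewrite gee0_abs].
split=> //; apply: fine_le => //; exact: integrable_fin_num.
Qed.

End ProductIntegral.

(** * The fundamental theorem of calculus on the line and the half line *)

Section FTC.
Context {R : realType}.
Local Notation mu := (@lebesgue_measure R).
Implicit Types (f F : R -> R) (a b : R).

Lemma cvg_Rintegral_setI (D : set R) (D_ : nat -> set R) f :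
  measurable D -> (forall n, measurable (D_ n)) -> (forall n, D_ n `<=` D) ->
  (forall x, D x -> \forall n \near \oo, D_ n x) -> mu.-integrable D (EFin \o f) ->
  (\int[mu]_(x in D_ n) f x)%R @[n --> \oo] --> (\int[mu]_(x in D) f x)%R.
Proof.
move=> mD mDn sD nD fi; have mf := measurable_int _ fi.
have -> : (fun n => \int[mu]_(x in D_ n) f x)%R =
    (fun n => \int[mu]_(x in D) (f \_ (D_ n)) x)%R.
  apply/funext => n; rewrite -Rintegral_mkcondr; congr Rintegral.
  by apply/esym/setIidPr; exact: sD.
apply: fine_cvg; rewrite fineK; last exact: integrable_fin_num.
apply: (@dominated_cvg _ _ _ mu D mD (fun n x => ((f \_ (D_ n)) x)%:E) _
  (fun x => `|f x|%:E)).
- move=> n; apply/measurable_EFinP/measurable_restrict => //; first exact: mDn.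
  apply/measurable_EFinP; apply: measurable_funS mf => //; exact: subIsetl.
- move=> x Dx; apply/fine_cvgP; split; first exact: nearW.
  have [N _ HN] := nD x Dx; apply: cvg_near_cst; exists N => // n Nn /=.
  by rewrite patchE mem_set//; exact: HN.
- by move=> x Dx.
- by apply: integrable_norm.
- by move=> n x Dx; rewrite patchE /= lee_fin; case: ifP => // _; rewrite normr0.
Qed.

Lemma Rintegral_FTC f F a b : a < b -> (forall x : R, is_derive x 1 F (f x)) ->
  continuous f -> (\int[mu]_(x in `[a, b]) f x)%R = F b - F a.
Proof.
move=> ab dF cf; have cF : continuous F.
  move=> x; apply: differentiable_continuous; apply/derivable1_diffP.
  by case: (dF x).
rewrite /Rintegral (@continuous_FTC2 _ f F)//.
- exact: continuous_subspaceT.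
- split.
  + by move=> x _; case: (dF x).
  + by apply: cvg_at_right_filter; exact: cF.
  + by apply: cvg_at_left_filter; exact: cF.
- by move=> x _; rewrite derive1E; case: (dF x).
Qed.

(** The bound makes [F] decay like [1 / |x|], so the boundary terms on [[- n - 1, n + 1]] are at
    most [2 C / (n + 1)]; dominated convergence identifies the limit of the truncated integrals. *)
Lemma Rintegral_FTC_line f F C : (forall x : R, is_derive x 1 F (f x)) ->
  continuous f -> mu.-integrable setT (EFin \o f) ->
  (forall x, `|F x| * `|x| <= C) -> (\int[mu]_x f x)%R = 0.
Proof.
move=> dF cf fi FC.
pose D_ n := `[(- n.+1%:R : R), n.+1%:R]%classic.
have cv : (\int[mu]_(x in D_ n) f x)%R @[n --> \oo] --> (\int[mu]_x f x)%R.
  apply: cvg_Rintegral_setI => //; first by move=> n; exact: measurable_itv.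
  move=> x _; near=> n; rewrite /D_ /= in_itv /= -ler_norml.
  have : `|x| <= n%:R by near: n; exact: nbhs_infty_ger.
  by move=> h; rewrite (le_trans h)// ler_nat.
apply: (cvg_unique (@norm_hausdorff _ _) cv).
have -> : (fun n => \int[mu]_(x in D_ n) f x)%R =
    (fun n => F n.+1%:R - F (- n.+1%:R)).
  by apply/funext => n; rewrite (Rintegral_FTC (F := F))//; have : 0 < n.+1%:R :> R by []; lra.
have C0 : 0 <= C by apply: le_trans (FC 0); rewrite normr0 mulr0.
apply/cvgrPdist_le => e e0; near=> n; rewrite sub0r normrN.
have n0 : 0 < n.+1%:R :> R by [].
have h1 : `|F n.+1%:R| <= C / n.+1%:R.
  by rewrite ler_pdivlMr//; have := FC n.+1%:R; rewrite normr_nat.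
have h2 : `|F (- n.+1%:R)| <= C / n.+1%:R.
  by rewrite ler_pdivlMr//; have := FC (- n.+1%:R); rewrite normrN normr_nat.
apply: le_trans (ler_normB _ _) _; apply: le_trans (lerD h1 h2) _.
have : 2 * C / e <= n%:R by near: n; exact: nbhs_infty_ger.
move=> h; have : 2 * C / e <= n.+1%:R by rewrite (le_trans h)// ler_nat.
rewrite ler_pdivrMr// => {}h; rewrite -mulrDl ler_pdivrMr//; lra.
Unshelve. all: by end_near. Qed.

Lemma Rintegral_FTC_halfline f F C : (forall x : R, is_derive x 1 F (f x)) ->
  continuous f -> mu.-integrable `]0, +oo[ (EFin \o f) ->
  (forall x, 0 <= x -> `|F x| * x <= C) ->
  (\int[mu]_(x in `]0, +oo[) f x)%R = - F 0.
Proof.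
move=> dF cf fi FC.
pose D_ n := `]0 : R, n.+1%:R]%classic.
have cv : (\int[mu]_(x in D_ n) f x)%R @[n --> \oo] --> (\int[mu]_(x in `]0%R, +oo[) f x)%R.
  apply: cvg_Rintegral_setI => //; first by move=> n; exact: measurable_itv.
    by move=> n x; rewrite /D_ /= !in_itv /= => /andP[-> _].
  move=> x /=; rewrite in_itv /= andbT => x0; near=> n; rewrite /D_ /= in_itv /= x0 /=.
  have h : x <= n%:R by near: n; exact: nbhs_infty_ger.
  by rewrite (le_trans h)// ler_nat.
apply: (cvg_unique (@norm_hausdorff _ _) cv).
have -> : (fun n => \int[mu]_(x in D_ n) f x)%R = (fun n => F n.+1%:R - F 0).
  apply/funext => n; rewrite /D_ Rintegral_itv_obnd_cbnd ?(Rintegral_FTC (F := F))//.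
  by apply: integrableS fi => // x; rewrite /= !in_itv /= => /andP[-> _].
have C0 : 0 <= C by apply: le_trans (FC 0 _); rewrite ?mulr0.
apply/cvgrPdist_le => e e0; near=> n.
rewrite opprB addrA [- F 0 + _]addrC subrr sub0r normrN.
have n0 : 0 < n.+1%:R :> R by [].
have h1 : `|F n.+1%:R| <= C / n.+1%:R.
  by rewrite ler_pdivlMr//; exact: FC.
apply: (le_trans h1).
have : C / e <= n%:R by near: n; exact: nbhs_infty_ger.
move=> h; have : C / e <= n.+1%:R by rewrite (le_trans h)// ler_nat.
by rewrite ler_pdivrMr// => {}h; rewrite ler_pdivrMr//; lra.
Unshelve. all: by end_near. Qed.

Definition cderive (F : R -> R[i]) (F1 : R -> R[i]) := forall x : R,
  is_derive x 1 (fun y => complex.Re (F y)) (complex.Re (F1 x)) /\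
  is_derive x 1 (fun y => complex.Im (F y)) (complex.Im (F1 x)).

Definition ccontinuous (F : R -> R[i]) :=
  continuous (fun y => complex.Re (F y)) /\ continuous (fun y => complex.Im (F y)).

Lemma cint_FTC_line (F F1 : R -> R[i]) C : cderive F F1 -> ccontinuous F1 ->
  cintegrable mu F1 -> (forall x, cmod (F x) * `|x| <= C) -> cint mu F1 = 0.
Proof.
move=> dF [c1 c2] [i1 i2] FC; apply: complexP => /=.
- apply: (Rintegral_FTC_line (F := fun y => complex.Re (F y)) (C := C)) => // x.
    by case: (dF x).
  by apply: le_trans (FC x); rewrite ler_wpM2r// normRe_cmod.
- apply: (Rintegral_FTC_line (F := fun y => complex.Im (F y)) (C := C)) => // x.
    by case: (dF x).
  by apply: le_trans (FC x); rewrite ler_wpM2r// normIm_cmod.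
Qed.

Lemma cint_FTC_halfline (F F1 : R -> R[i]) C : cderive F F1 -> ccontinuous F1 ->
  cintegrable mu (fun s => if s \in `]0%R, +oo[%classic then F1 s else 0) ->
  (forall x, 0 <= x -> cmod (F x) * x <= C) -> cintegral `]0, +oo[ F1 = - F 0.
Proof.
move=> dF [c1 c2] [i1 i2] FC.
have r1 : mu.-integrable `]0, +oo[ (fun s => (complex.Re (F1 s))%:E).
  apply/(integrable_mkcond _ _) => //; apply: eq_integrable i1 => // s _.
  by rewrite patchE; case: ifP.
have r2 : mu.-integrable `]0, +oo[ (fun s => (complex.Im (F1 s))%:E).
  apply/(integrable_mkcond _ _) => //; apply: eq_integrable i2 => // s _.
  by rewrite patchE; case: ifP.
apply: complexP; rewrite ?cReN ?cImN /=.
- apply: (Rintegral_FTC_halfline (F := fun y => complex.Re (F y)) (C := C)) => // x.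
    by case: (dF x).
  by move=> x0; apply: le_trans (FC x x0); rewrite ler_wpM2r// normRe_cmod.
- apply: (Rintegral_FTC_halfline (F := fun y => complex.Im (F y)) (C := C)) => // x.
    by case: (dF x).
  by move=> x0; apply: le_trans (FC x x0); rewrite ler_wpM2r// normIm_cmod.
Qed.

End FTC.

(** * The scale-invariant integral of [bump] *)

Section BumpIntegral.
Context {R : realType}.
Local Notation mu := (@lebesgue_measure R).
Implicit Types (b rho y : R).

Lemma is_derive_powR1D b y : -1 < y ->
  is_derive y 1 (fun y => (1 + y) `^ b) (b * (1 + y) `^ (b - 1)).
Proof.
move=> y1; have p : 0 < 1 + y by lra.
have d1 : is_derive y (1 : R) (fun y => 1 + y) 1.
  apply: (is_derive_taylor (r := 1) (M := 0)) => // k _.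
  by rewrite mul0r (_ : _ - _ = 0) ?normr0//; ring.
have := is_derive1_comp (is_derive1_powR b p) d1.
by rewrite mulr1.
Qed.

(** In the variable [r = rho (1 + y)^b] one has [dy / (1 + y) = dr / (b r)], and
    [bump r / r = (1 + r)^-2] has the primitive [- (1 + r)^-1]. *)
Lemma is_derive_bump_prim b rho y : 0 < b -> 0 < rho -> 0 <= y ->
  is_derive y 1 (fun y => - (b * (1 + rho * (1 + y) `^ b))^-1)
    ((1 + y)^-1 * bump (rho * (1 + y) `^ b)).
Proof.
move=> b0 r0 y0; have dp : is_derive y (1 : R) (fun y => (1 + y) `^ b) (b * (1 + y) `^ (b - 1)).
  by apply: is_derive_powR1D; lra.
have p : 0 < 1 + y by lra.
have P0 : 0 < (1 + y) `^ b by rewrite powR_gt0.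
have rP : 0 < rho * (1 + y) `^ b by rewrite mulr_gt0.
have dD : is_derive y (1 : R) (fun y => b * (1 + rho * (1 + y) `^ b))
    (b * (rho * (b * (1 + y) `^ (b - 1)))).
  apply: is_derive_eq; rewrite /GRing.scale /=; ring.
have n0 : b * (1 + rho * (1 + y) `^ b) != 0 by rewrite gt_eqF// mulr_gt0//; lra.
have dV := is_deriveV (f := fun y => b * (1 + rho * (1 + y) `^ b)) n0 dD.
apply: is_derive_eq; rewrite /GRing.scale /=.
rewrite powRB; last by rewrite (gt_eqF p) implybT.
rewrite powRr1 ?(ltW p)// /bump; field.
by rewrite (gt_eqF b0) (gt_eqF p) /=; lra.
Qed.

Lemma powR1D_continuous b : continuous (fun y => (1 + `|y|) `^ b).
Proof.
move=> y; have p : 0 < 1 + `|y| by have := normr_ge0 y; lra.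
have c1 : {for y, continuous (fun y : R => 1 + `|y|)}.
  by apply: cvgD; [exact: cvg_cst|exact: norm_continuous].
have c2 : {for (1 + `|y|), continuous (@powR R ^~ b)}.
  apply: differentiable_continuous; apply/derivable1_diffP.
  by case: (is_derive1_powR b p).
exact: (continuous_comp c1 c2).
Qed.

Lemma bump_line_continuous b rho : 0 < rho ->
  continuous (fun y => (1 + `|y|)^-1 * bump (rho * (1 + `|y|) `^ b)).
Proof.
move=> r0 y; have p : 0 < 1 + `|y| by have := normr_ge0 y; lra.
have P0 : 0 < (1 + `|y|) `^ b by rewrite powR_gt0.
have rP : 0 < rho * (1 + `|y|) `^ b by rewrite mulr_gt0.
have c1 : {for y, continuous (fun y : R => 1 + `|y|)}.
  by apply: cvgD; [exact: cvg_cst|exact: norm_continuous].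
have c2 : {for y, continuous (fun y => rho * (1 + `|y|) `^ b)}.
  by apply: cvgM; [exact: cvg_cst|exact: powR1D_continuous].
have c3 : {for y, continuous (fun y => 1 + rho * (1 + `|y|) `^ b)}.
  by apply: cvgD; [exact: cvg_cst|exact: c2].
apply: cvgM; first by apply: cvgV => //; rewrite gt_eqF.
apply: cvgM => //; apply: cvgV; first by rewrite expf_neq0// gt_eqF//; lra.
by rewrite /=; apply: cvgM.
Qed.

Lemma bump_prim_cvg b rho : 0 < b -> 0 < rho ->
  (fun y : R => - (b * (1 + rho * (1 + y) `^ b))^-1) y @[y --> +oo] --> (0 : R).
Proof.
move=> b0 r0; apply/cvgrPdist_le => e e0.
(* Chosen so that [K^b] is the inverse of [b rho e]: from [K] on, [b rho (1 + y)^b] exceeds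
   [1 / e]. *)
pose K := (b * rho * e)^-1 `^ b^-1.
near=> y; rewrite sub0r opprK.
have yK : K <= y by near: y; apply: nbhs_pinfty_ge; rewrite num_real.
have y0 : 0 <= y by near: y; apply: nbhs_pinfty_ge; rewrite num_real.
have bre : 0 < b * rho * e by rewrite !mulr_gt0.
have h : (b * rho * e)^-1 <= (1 + y) `^ b.
  have -> : (b * rho * e)^-1 = K `^ b.
    by rewrite /K -powRrM mulVf ?gt_eqF// powRr1// invr_ge0 ltW.
  by apply: ge0_ler_powR; rewrite ?nnegrE ?powR_ge0 ?(ltW b0)//; lra.
have P0 : 0 <= (1 + y) `^ b by rewrite powR_ge0.
have rP : 0 <= rho * (1 + y) `^ b by rewrite mulr_ge0// ltW.
have D0 : 0 < b * (1 + rho * (1 + y) `^ b) by rewrite mulr_gt0//; lra.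
rewrite ger0_norm; last by rewrite invr_ge0 ltW.
rewrite -[e]invrK lef_pV2 ?posrE ?invr_gt0//.
have br : 0 < b * rho by rewrite mulr_gt0.
apply: (@le_trans _ _ (b * rho * (1 + y) `^ b)); last by lra.
have := ler_wpM2l (ltW br) h; apply: le_trans.
by rewrite invfM mulrA divff ?gt_eqF// mul1r.
Unshelve. all: by end_near. Qed.

(** The scale invariance of [dr / r] in quantitative form: the primitive at 0 has modulus
    [1 / (b (1 + rho)) <= 1 / b] whatever [rho], and evenness doubles it. *)
Lemma bump_integrable b rho : 0 < b -> 0 < rho ->
  let f y := (1 + `|y|)^-1 * bump (rho * (1 + `|y|) `^ b) in
  mu.-integrable setT (EFin \o f) /\ (\int[mu]_y f y)%R <= 2 / b.
Proof.
move=> b0 r0 f.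
have f0 y : 0 <= f y.
  rewrite /f mulr_ge0 ?bump_ge0 ?invr_ge0 ?addr_ge0// mulr_ge0 ?powR_ge0//.
  exact: ltW.
have cf : continuous f by exact: bump_line_continuous.
have half : (\int[mu]_(y in `[0%R, +oo[) (f y)%:E <= (b^-1)%:E)%E.
  pose F y := - (b * (1 + rho * (1 + y) `^ b))^-1.
  have dF y : 0 <= y -> is_derive y (1 : R) F (f y).
    by move=> y0; rewrite /f ger0_norm//; exact: is_derive_bump_prim.
  rewrite (@ge0_continuous_FTC2y _ f F 0 0)//.
  - rewrite add0e -EFinN lee_fin /F opprK addr0 powR1 mulr1.
    by rewrite lef_pV2 ?posrE ?mulr_gt0 ?ler_peMr//; lra.
  - exact: continuous_subspaceT.
  - exact: bump_prim_cvg.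
  - by move=> y y0; case: (dF y (ltW y0)).
  - apply: cvg_at_right_filter; apply: differentiable_continuous.
    by apply/derivable1_diffP; case: (dF 0 (lexx _)).
  - move=> y; rewrite in_itv /= andbT => y0; rewrite derive1E.
    by case: (dF y (ltW y0)).
have full : (\int[mu]_y (f y)%:E <= (2 / b)%:E)%E.
  rewrite ge0_symfun_integralT//; last by move=> y; rewrite /f /= normrN.
  rewrite EFinM; apply: lee_wpmul2l; first by rewrite lee_fin.
  rewrite [X in (\int[mu]_(x in X) _)%E](_ : _ = `[0%R, +oo[%classic)//.
  by apply/seteqP; split => x; rewrite /= in_itv /= andbT.
have mf : measurable_fun setT (EFin \o f).
  by apply/measurable_EFinP; exact: continuous_measurable_fun.
have fi : mu.-integrable setT (EFin \o f).
  apply/integrableP; split=> //.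
  apply: le_lt_trans (ltry (2 / b)); apply: le_trans full.
  by under eq_integral do rewrite /= ger0_norm//.
split=> //; rewrite -lee_fin /Rintegral fineK//; exact: integrable_fin_num.
Qed.

End BumpIntegral.

(** * Analytic extension of transforms *)

Section Transform.
Context d (T : measurableType d) {R : realType} (mu : {measure set T -> \bar R}).
Implicit Types (g e : T -> R[i]) (P : R[i] -> R[i]).

Lemma quad_dilate (rho C : R) (f : R[i] -> R[i]) (f1 s k : R[i]) : k != 0 ->
  quad (rho * cmod k) C f f1 (s * k) ->
  quad rho C (fun w => f (w * k)) (k * f1) s.
Proof.
move=> k0 q; have [r0 c0 c1 _] := q.
have kp : 0 < cmod k by rewrite cmod_gt0.
have rp : 0 < rho by move: r0; rewrite pmulr_lgt0.
apply: quadP => //; first by rewrite cmodM mulrA.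
move=> h x x0 x1 hx; rewrite mulrDl mulrA.
by apply: quadE q x1 _; rewrite cmodM hx mulrA.
Qed.

Definition bump_bounded g e := exists M : R, forall rho : R, 0 < rho ->
  mu.-integrable setT (fun x => (cmod (g x) * bump (rho * cmod (e x)))%:E) /\
  (\int[mu]_x (cmod (g x) * bump (rho * cmod (e x))))%R <= M.

Variables (g e : T -> R[i]) (P : R[i] -> R[i]) (omega eta0 : R).
Hypotheses (sP : sectorial omega P) (se : forall x, insec eta0 (e x)).
Hypotheses (mg : cmeasurable g) (mP : forall w, cmeasurable (fun x => P (w * e x))).
Hypothesis (bb : bump_bounded g e).

Let Psi s := cint mu (fun x => g x * P (s * e x)).

(** The estimate of [P] at [s e(x)], read in [s], has radius [dlt |s|] and a bound proportional to
    [|g(x)| bump (|s| |e(x)|)]; [bump_bounded] at [rho = |s|] integrates the latter to at most [M].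
    Hence one constant [C] for the whole sector of [s]. *)
Lemma quad_transform eta : eta + eta0 < omega -> exists C dlt : R, 0 < dlt /\
  forall s, insec eta s -> exists s1, quad (dlt * cmod s) C Psi s1 s.
Proof.
move=> h; have [P1 HP] := sP; have [C0 [dlt [d0 q]]] := HP _ h.
have [M HM] := bb.
exists (2 * (`|C0| * M)), dlt; split=> // s ss.
have s0 : 0 < cmod s by rewrite cmod_gt0 (insec_neq0 ss).
have [iM leM] := HM _ s0.
pose D x := C0 * (cmod (g x) * bump (cmod s * cmod (e x))).
have iD : mu.-integrable setT (EFin \o D) by exact: integrable_scale.
have qx x : quad (dlt * cmod s) (D x) (fun w => g x * P (w * e x))
    (g x * (e x * P1 (s * e x))) s.
  have -> : D x = cmod (g x) * (C0 * bump (cmod (s * e x))).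
    by rewrite /D cmodM mulrCA.
  apply: quadZ; apply: quad_dilate; first exact: insec_neq0 (se x).
  by rewrite -mulrA -cmodM; apply: q; exact: insecM.
exists (cint mu (fun x => g x * (e x * P1 (s * e x)))).
have := quad_cint _ _ iD qx => /(_ _ _)/quad_le; apply => //.
- by move=> w _; apply: cmeasurableM => //; exact: mP.
- by rewrite mulr_gt0.
- by rewrite mulr_gt0.
- rewrite ler_pM2l// RintegralZl//; apply: (@le_trans _ _ (`|C0| *
    (\int[mu]_x (cmod (g x) * bump (cmod s * cmod (e x))))%R)).
    rewrite ler_wpM2r ?ler_norm//; apply: Rintegral_ge0 => x _.
    by rewrite mulr_ge0 ?bump_ge0 ?mulr_ge0 ?cmod_ge0.
  by rewrite ler_wpM2l.
Qed.

Lemma Re_gt0_sector (z : R[i]) : z != 0 -> `|carg z| < pi / 2 -> 0 < complex.Re z.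
Proof.
move=> z0 h; rewrite (polarE z0) cReM /= mul0r subr0 mulr_gt0 ?cmod_gt0//.
by rewrite cos_gt0_pihalf// -ltr_norml.
Qed.

(** The power multiplies arguments by [|a|], and the result plus [eta0] must stay below [omega];
    [pi / 2] bounds the opening because [quad_cpow] is stated in the right half plane. Boundedness
    is the bound on values in [quad_transform], uniform in [s]. *)
Lemma transform_extension (a theta0 : R) : a != 0 -> `|a| <= 2 ->
  theta0 <= pi / 2 -> `|a| * theta0 + eta0 <= omega ->
  holomorphic_on (sector theta0) (fun t => Psi (cpow t a)) /\
  forall theta, theta < theta0 ->
    bounded_on (closed_sector theta) (fun t => Psi (cpow t a)).
Proof.
move=> a0 a2 t2 hO; have an0 : 0 < `|a| by rewrite normr_gt0.
have lt_om x : x < theta0 -> `|a| * x + eta0 < omega.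
  by move=> h; apply: lt_le_trans hO; rewrite ltrD2r ltr_pM2l.
split.
  move=> t [t0 ht]; have tp : 0 < complex.Re t.
    by apply: Re_gt0_sector => //; exact: lt_le_trans ht t2.
  have [C [dlt [d0 H]]] := quad_transform (lt_om _ ht).
  have ss : insec (`|a| * `|carg t|) (cpow t a) by exact: insec_cpow.
  have [s1 q] := H _ ss.
  set s := cpow t a in ss q.
  have s0 : 0 < cmod s by rewrite cmod_gt0 (insec_neq0 ss).
  have K0 : 0 < Kpow :> R by rewrite /Kpow mulr_gt0 ?expR_gt0.
  (* On its own disc the power has increments up to [2 Kpow |s|]; the shrinking fits them into the
     radius [dlt |s|] of the transform. *)
  pose lam := Num.min 1 (dlt / (2 * Kpow)) : R.
  have l0 : 0 < lam by rewrite lt_min ltr01 divr_gt0// mulr_gt0.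
  have l1 : lam <= 1 by rewrite ge_min lexx.
  have lE : 2 * (Kpow * cmod s) * lam <= dlt * cmod s.
    have : lam <= dlt / (2 * Kpow) by rewrite ge_min lexx orbT.
    rewrite ler_pdivlMr ?mulr_gt0// => hl.
    have := ler_wpM2r (ltW s0) hl; lra.
  exact: quad_derivable (quad_comp (quad_cpow a2 tp) q l0 l1 lE).
move=> theta ht; have [C [dlt [d0 H]]] := quad_transform (lt_om _ ht).
exists C => t [t0 h]; have [s1 q] := H _ (insec_cpow a h).
exact: quad_cmod q.
Qed.

End Transform.

(** * Estimates along a vertical line *)

Section Line.
Context {R : realType}.
Local Notation mu := (@lebesgue_measure R).
Implicit Types (b rho y r : R).

(** One factor [K] is lost in the numerator and two in the squared denominator. *)
Lemma bump_compare (K r r' : R) : 1 <= K -> 0 <= r -> 0 <= r' ->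
  r <= K * r' -> r' <= K * r -> bump r <= K ^+ 3 * bump r'.
Proof.
move=> K1 r0 r0' h1 h2; rewrite /bump mulrA ler_pdivrMr ?exprn_gt0//; last by lra.
rewrite mulrAC ler_pdivlMr ?exprn_gt0//; last by lra.
have h3 : 1 + r' <= K * (1 + r) by nra.
have h4 : (1 + r') ^+ 2 <= (K * (1 + r)) ^+ 2.
  by apply: lerXn2r => //; rewrite ?nnegrE; [lra|apply: mulr_ge0; lra].
apply: (@le_trans _ _ (K * r' * (K * (1 + r)) ^+ 2)).
  by apply: ler_pM => //; exact: sqr_ge0.
by rewrite [leLHS](_ : _ = K ^+ 3 * r' * (1 + r) ^+ 2)//; ring.
Qed.

Variable c : R.
Hypothesis c0 : 0 < c.

Lemma lineE y : c +i* y = c%:C + y%:C * 'i.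
Proof. by apply: complexP; rewrite ?cReD ?cImD ?cReM ?cImM /=; ring. Qed.

Definition lineK : R := 2 * (1 + c + c^-1).

Lemma lineK_ge1 : 1 <= lineK.
Proof.
have c0' := c0; have ci : 0 < c^-1 by rewrite invr_gt0.
by rewrite /lineK; lra.
Qed.

Lemma cmod_line_le y : cmod (c +i* y) <= lineK * (1 + `|y|).
Proof.
apply: le_trans (cmod_le_ReIm _) _ => /=; rewrite gtr0_norm// /lineK.
have c0' := c0; have ci : 0 < c^-1 by rewrite invr_gt0.
have := normr_ge0 y; nra.
Qed.

Lemma cmod_line_ge y : 1 + `|y| <= lineK * cmod (c +i* y).
Proof.
have h1 : c <= cmod (c +i* y) := Re_le_cmod (c +i* y).
have h2 : `|y| <= cmod (c +i* y) := normIm_cmod (c +i* y).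
set m := cmod _ in h1 h2 *.
have c0' := c0; have ci : 0 < c^-1 by rewrite invr_gt0.
have : c^-1 * c <= c^-1 * m by rewrite ler_pM2l.
rewrite mulVf ?gt_eqF// /lineK => h3.
have m0 : 0 <= m := cmod_ge0 _.
have cm : 0 <= c * m by rewrite mulr_ge0// ltW.
by lra.
Qed.

Lemma cmod_line_gt0 y : 0 < cmod (c +i* y).
Proof. by apply: lt_le_trans c0 _; exact: Re_le_cmod (c +i* y). Qed.

Lemma line_neq0 y : c +i* y != 0.
Proof. by rewrite -cmod_gt0 cmod_line_gt0. Qed.

Lemma line_ccontinuous (F : R[i] -> R[i]) :
  (forall y, exists rho C f1, quad rho C F f1 (c +i* y)) ->
  ccontinuous (fun y => F (c +i* y)).
Proof.
move=> H.
have E : (fun y => F (c +i* y)) = (fun y => F (c%:C + y%:C * 'i)).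
  by apply/funext => y; rewrite lineE.
rewrite E; split=> y; have [rho [C [f1 q]]] := H y; rewrite lineE in q.
  apply: differentiable_continuous; apply/derivable1_diffP.
  by case: (quad_is_derive_Re q).
apply: differentiable_continuous; apply/derivable1_diffP.
by case: (quad_is_derive_Im q).
Qed.

Lemma ccontinuous_cmeasurable (F : R -> R[i]) : ccontinuous F -> cmeasurable F.
Proof. by move=> [c1 c2]; split; exact: continuous_measurable_fun. Qed.

Lemma cmeasurable_cpow_line (a : R) : `|a| <= 2 -> cmeasurable (fun y => cpow (c +i* y) a).
Proof.
move=> a2; apply: ccontinuous_cmeasurable.
apply: (@line_ccontinuous (fun z => cpow z a)) => y.
by eexists; eexists; eexists; apply: quad_cpow.
Qed.

Lemma cmeasurable_line : cmeasurable (fun y => c +i* y).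
Proof. by split => /=; [exact: measurable_cst|exact: measurable_id]. Qed.

(** [bump_integrable] is carried from [1 + |y|] to [|c + i y|], the two being comparable, with a
    bound still uniform in [rho]. A negative exponent reduces to a positive one by [bumpV], with
    [rho] replaced by its inverse. *)
Lemma bump_line b : b != 0 -> exists M : R, forall rho, 0 < rho ->
  mu.-integrable setT
    (fun y => ((cmod (c +i* y))^-1 * bump (rho * cmod (c +i* y) `^ b))%:E) /\
  (\int[mu]_y ((cmod (c +i* y))^-1 * bump (rho * cmod (c +i* y) `^ b)))%R <= M.
Proof.
wlog bp : b / 0 < b => [hw b0|_].
  have [bp|bn|be] := ltgtP b 0; last by rewrite be eqxx in b0.
    have [||M HM] := hw (- b); rewrite ?oppr_gt0 ?oppr_eq0//.
    exists M => rho r0; have ri : 0 < rho^-1 by rewrite invr_gt0.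
    have [i1 i2] := HM _ ri.
    have E y : (cmod (c +i* y))^-1 * bump (rho * cmod (c +i* y) `^ b) =
        (cmod (c +i* y))^-1 * bump (rho^-1 * cmod (c +i* y) `^ (- b)).
      congr (_ * _); rewrite -bumpV; last first.
        by rewrite mulr_gt0// powR_gt0// cmod_line_gt0.
      by rewrite invfM powRN.
    split; first by under eq_fun do rewrite E.
    by under eq_Rintegral do rewrite E.
  exact: hw.
have [k [k1 [hk1 hk2]]] : exists k, 1 <= k /\
    ((forall y, cmod (c +i* y) <= k * (1 + `|y|)) /\
     (forall y, 1 + `|y| <= k * cmod (c +i* y))).
  exists lineK; split; first exact: lineK_ge1.
  by split=> y; [exact: cmod_line_le|exact: cmod_line_ge].
have k0 : 0 < k by lra.
pose L := k `^ b.
have L1 : 1 <= L.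
  apply: (@le_trans _ _ (1 `^ b)); first by rewrite powR1.
  by apply: ge0_ler_powR; rewrite ?nnegrE ?(ltW bp) ?(ltW k0).
exists (k * L ^+ 3 * (2 / b)) => rho r0.
have [fi fl] := bump_integrable bp r0.
pose f y := (1 + `|y|)^-1 * bump (rho * (1 + `|y|) `^ b).
have le y : (cmod (c +i* y))^-1 * bump (rho * cmod (c +i* y) `^ b) <=
    k * L ^+ 3 * f y.
  set m := cmod _; set v := 1 + `|y|.
  have m0 : 0 < m by exact: cmod_line_gt0.
  have v0 : 0 < v by rewrite /v; have := normr_ge0 y; lra.
  have h1 : m <= k * v := hk1 y.
  have h2 : v <= k * m := hk2 y.
  have p1 : m `^ b <= L * v `^ b.
    rewrite /L -powRM ?(ltW k0) ?(ltW v0)//.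
    by apply: ge0_ler_powR; rewrite ?nnegrE ?mulr_ge0 ?(ltW bp) ?(ltW k0) ?(ltW v0) ?(ltW m0).
  have p2 : v `^ b <= L * m `^ b.
    rewrite /L -powRM ?(ltW k0) ?(ltW m0)//.
    by apply: ge0_ler_powR; rewrite ?nnegrE ?mulr_ge0 ?(ltW bp) ?(ltW k0) ?(ltW v0) ?(ltW m0).
  have b1 : bump (rho * m `^ b) <= L ^+ 3 * bump (rho * v `^ b).
    apply: bump_compare => //; rewrite ?mulr_ge0 ?powR_ge0 ?(ltW r0)//.
      by rewrite mulrCA ler_pM2l.
    by rewrite mulrCA ler_pM2l.
  have m1 : m^-1 <= k * v^-1.
    rewrite -[leRHS]invrK lef_pV2 ?posrE ?invr_gt0 ?mulr_gt0 ?invr_gt0//.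
    by rewrite invfM invrK mulrC ler_pdivrMr// mulrC.
  rewrite /f -/v [leRHS](_ : _ = (k * v^-1) * (L ^+ 3 * bump (rho * v `^ b))); last by ring.
  by apply: ler_pM; rewrite ?invr_ge0 ?bump_ge0 ?mulr_ge0 ?powR_ge0 ?(ltW r0) ?(ltW m0).
have mm : measurable_fun setT (fun y => cmod (c +i* y)).
  by apply: measurable_cmod; exact: cmeasurable_line.
have ig : mu.-integrable setT
    (fun y => ((cmod (c +i* y))^-1 * bump (rho * cmod (c +i* y) `^ b))%:E).
  apply: (@integrable_dom _ _ _ mu
    (fun y => (cmod (c +i* y))^-1 * bump (rho * cmod (c +i* y) `^ b))
    (fun y => k * L ^+ 3 * f y)).
  - have mV (h : R -> R) : measurable_fun setT h -> (forall y, 0 <= h y) ->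
        measurable_fun setT (fun y => (h y)^-1).
      move=> mh h0; under eq_fun do rewrite -powR_inv1//.
      exact: (measurableT_comp (@measurable_powR R (-1)) mh).
    have mp : measurable_fun setT (fun y => rho * cmod (c +i* y) `^ b).
      apply: measurable_funM; first exact: measurable_cst.
      exact: (measurableT_comp (@measurable_powR R b) mm).
    apply: measurable_funM; first by apply: mV => // y; exact: cmod_ge0.
    apply: measurable_funM => //; apply: mV => [|y]; last exact: sqr_ge0.
    by apply: measurable_funX; apply: measurable_funD => //; exact: measurable_cst.
  - exact: integrable_scale.
  - move=> y; rewrite ger0_norm//.
    by rewrite mulr_ge0 ?invr_ge0 ?cmod_ge0 ?bump_ge0 ?mulr_ge0 ?powR_ge0 ?(ltW r0).
split=> //.
apply: (@le_trans _ _ (\int[mu]_y (k * L ^+ 3 * f y))%R).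
  by apply: le_Rintegral => //; exact: integrable_scale.
rewrite RintegralZl//; apply: ler_wpM2l => //.
by rewrite mulr_ge0 ?exprn_ge0//; lra.
Qed.

End Line.

(** * Complex derivatives without constants *)

Section Cdiff.
Context {R : realType}.
Implicit Types (u z : R[i]).

(** For the primitives and identities in which only the value of the derivative matters. *)
Definition cdiff (f : R[i] -> R[i]) (f1 u : R[i]) :=
  exists rho C : R, quad rho C f f1 u.

Lemma cdiff_deriv_eq f (f1 f2 u : R[i]) : cdiff f f1 u -> f1 = f2 -> cdiff f f2 u.
Proof. by move=> h <-. Qed.

Lemma cdiff_cst k u : cdiff (fun=> k) 0 u.
Proof. by exists 1, (cmod k); exact: quad_cst. Qed.

Lemma cdiff_id u : cdiff id 1 u.
Proof.
exists 1, (1 + cmod u); apply: quad_id => //; first by rewrite lerDl cmod_ge0.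
by rewrite lerDr.
Qed.

Lemma quad_min f g (f1 g1 u : R[i]) : cdiff f f1 u -> cdiff g g1 u ->
  exists rho C C' : R, quad rho C f f1 u /\ quad rho C' g g1 u.
Proof.
move=> [r [C q]] [r' [C' q']]; have r0 := quad_gt0 q; have r0' := quad_gt0 q'.
have m0 : 0 < Num.min r r' by rewrite lt_min r0.
exists (Num.min r r'), C, C'; split.
  by apply: quad_le q m0 _ _ => //; rewrite ge_min lexx.
by apply: quad_le q' m0 _ _ => //; rewrite ge_min lexx orbT.
Qed.

Lemma cdiffD f g (f1 g1 u : R[i]) : cdiff f f1 u -> cdiff g g1 u ->
  cdiff (fun w => f w + g w) (f1 + g1) u.
Proof.
move=> hf hg; have [r [C [C' [qf qg]]]] := quad_min hf hg.
by exists r, (C + C'); exact: quadD.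
Qed.

Lemma cdiffM f g (f1 g1 u : R[i]) : cdiff f f1 u -> cdiff g g1 u ->
  cdiff (fun w => f w * g w) (f1 * g u + f u * g1) u.
Proof.
move=> hf hg; have [r [C [C' [qf qg]]]] := quad_min hf hg.
by exists r, (6 * C * C'); exact: quadM.
Qed.

Lemma cdiffZ k f (f1 u : R[i]) : cdiff f f1 u -> cdiff (fun w => k * f w) (k * f1) u.
Proof. by move=> [r [C q]]; exists r, (cmod k * C); exact: quadZ. Qed.

Lemma cdiffV u : u != 0 -> cdiff (fun w => w^-1) (- u ^- 2) u.
Proof.
move=> u0; have m0 : 0 < cmod u by rewrite cmod_gt0.
have := @quadV R (cmod u / 2) 0 u; rewrite add0r => /(_ _ (lexx _)) q.
exists (cmod u / 2), (cmod u)^-1.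
apply: (quad_fun_eq (q _)) => [|w]; last by rewrite add0r.
by rewrite divr_gt0.
Qed.

Lemma cdiff_cexp k u : cdiff (fun w => cexp (k * w)) (k * cexp (k * u)) u.
Proof. by exists 1; eexists; apply: quad_cexp. Qed.

Lemma cdiff_cpow (a : R) u : `|a| <= 2 -> 0 < complex.Re u ->
  cdiff (fun w => cpow w a) (a%:C * u^-1 * cpow u a) u.
Proof. by move=> a2 u0; eexists; eexists; exact: quad_cpow. Qed.

Lemma cdiff_comp f g (f1 g1 u : R[i]) : cdiff f f1 u -> cdiff g g1 (f u) ->
  cdiff (fun w => g (f w)) (f1 * g1) u.
Proof.
move=> [r [C q]] [r' [C' q']]; have r0' := quad_gt0 q'; have C0 := quad_ge0 q.
pose lam := Num.min 1 (r' / (2 * C + 1)).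
have l0 : 0 < lam by rewrite lt_min ltr01 divr_gt0//; lra.
have l1 : lam <= 1 by rewrite ge_min lexx.
have l2 : 2 * C * lam <= r'.
  have : lam <= r' / (2 * C + 1) by rewrite ge_min lexx orbT.
  by rewrite ler_pdivlMr; lra.
by eexists; eexists; exact: quad_comp q q' l0 l1 l2.
Qed.

Lemma cdiff_cexpf f (f1 u : R[i]) : cdiff f f1 u ->
  cdiff (fun w => cexp (f w)) (f1 * cexp (f u)) u.
Proof.
move=> hf; have he : cdiff (@cexp R) (cexp (f u)) (f u).
  have [r [C q]] := cdiff_cexp 1 (f u); rewrite !mul1r in q.
  by exists r, C; apply: (quad_fun_eq q) => w; rewrite mul1r.
exact: cdiff_comp hf he.
Qed.

Lemma cderive_line (c : R) (F : R[i] -> R[i]) (F1 : R[i] -> R[i]) :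
  (forall y : R, cdiff F (F1 (c +i* y)) (c +i* y)) ->
  cderive (fun y => F (c +i* y)) (fun y => 'i * F1 (c +i* y)).
Proof.
move=> H y; have [rho [C q]] := H y; rewrite [X in quad _ _ _ _ X]lineE in q.
split.
  rewrite (_ : (fun y => _) = (fun y => complex.Re (F (c%:C + y%:C * 'i)))).
    exact: quad_is_derive_Re q.
  by apply/funext => x; rewrite lineE.
rewrite (_ : (fun y => _) = (fun y => complex.Im (F (c%:C + y%:C * 'i)))).
  exact: quad_is_derive_Im q.
by apply/funext => x; rewrite lineE.
Qed.

Lemma cderive_real (F : R[i] -> R[i]) (F1 : R[i] -> R[i]) :
  (forall y : R, cdiff F (F1 y%:C) y%:C) ->
  cderive (fun y => F y%:C) (fun y => F1 y%:C).
Proof.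
move=> H y; have [rho [C q]] := H y.
have E (x : R) : x%:C = 0 + x%:C * 1 :> R[i] by rewrite add0r mulr1.
rewrite [X in quad _ _ _ _ X]E in q.
have := quad_is_derive_Re q; have := quad_is_derive_Im q; rewrite mul1r => h1 h2.
split.
  by rewrite (_ : (fun y => _) = (fun y => complex.Re (F (0 + y%:C * 1))))//;
    apply/funext => x; rewrite -E.
by rewrite (_ : (fun y => _) = (fun y => complex.Im (F (0 + y%:C * 1))))//;
  apply/funext => x; rewrite -E.
Qed.

Lemma ccontinuous_line (c : R) (F : R[i] -> R[i]) :
  (forall y : R, exists f1, cdiff F f1 (c +i* y)) ->
  ccontinuous (fun y => F (c +i* y)).
Proof.
move=> H; apply: line_ccontinuous => y.
by have [f1 [rho [C q]]] := H y; exists rho, C, f1.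
Qed.

Lemma ccontinuous_iM (F : R -> R[i]) : ccontinuous F -> ccontinuous (fun y => 'i * F y).
Proof.
move=> [c1 c2]; split.
  have -> : (fun y => complex.Re ('i * F y)) = (fun y => - complex.Im (F y)).
    by apply/funext => y; rewrite cReM /=; ring.
  by move=> y; apply: cvgN; exact: c2.
have -> : (fun y => complex.Im ('i * F y)) = (fun y => complex.Re (F y)).
  by apply/funext => y; rewrite cImM /=; ring.
exact: c1.
Qed.

Lemma cderive_ccontinuous (F F1 : R -> R[i]) : cderive F F1 -> ccontinuous F.
Proof.
move=> H; split=> y; have [[d1 _] [d2 _]] := H y;
  by apply: differentiable_continuous; apply/derivable1_diffP.
Qed.

End Cdiff.

Lemma cReZ (R : realType) (x : R) z : complex.Re (x%:C * z) = x * complex.Re z.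
Proof. by rewrite cReM /= mul0r subr0. Qed.

(** * Decay in the right half plane *)

Section Decay.
Context {R : realType}.
Local Notation mu := (@lebesgue_measure R).
Implicit Types (x : R).

(** The constant is [p^p]: it results from [ln (x / p) <= x / p], multiplied by [p]. *)
Lemma powR_le_expR (p : R) : 0 < p -> exists C : R, 0 < C /\
  forall x, 0 < x -> x `^ p <= C * expR x.
Proof.
move=> p0; exists (expR (p * ln p)); split; first exact: expR_gt0.
move=> x x0; rewrite -expRD /powR gt_eqF// ler_expR.
have xp : 0 < x / p by rewrite divr_gt0.
have : ln x = ln p + ln (x / p) by rewrite -lnM ?posrE// mulrCA divff ?mulr1// gt_eqF.
move=> ->; rewrite mulrDr lerD2l.
have h : ln (x / p) <= x / p by apply/ltW/ln_sublinear.
have := ler_wpM2l (ltW p0) h.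
by rewrite mulrCA divff ?mulr1// gt_eqF.
Qed.

Lemma cpow_Re_ge (b : R) (z : R[i]) : 0 < b -> b < 1 -> 0 < complex.Re z ->
  cos (b * (pi / 2)) * cmod z `^ b <= complex.Re (cpow z b).
Proof.
move=> b0 b1 z0; have n0 : z != 0 by apply/eqP => e; rewrite e ltxx in z0.
have := insec_Re_ge (insec_cpow_Re_gt0 b z0); rewrite gtr0_norm// cmod_cpow//.
by apply; have := pi_gt0 R; nra.
Qed.

Lemma cos_bpi_gt0 (b : R) : 0 < b -> b < 1 -> 0 < cos (b * (pi / 2)).
Proof. by move=> b0 b1; have p0 := pi_gt0 R; apply: cos_gt0_pihalf; apply/andP; split; nra. Qed.

Lemma cexp_cpow_le (b s : R) (z : R[i]) : 0 < b -> b < 1 -> 0 <= s -> 0 < complex.Re z ->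
  cmod (cexp (- (s%:C * cpow z b))) <= expR (- (s * cos (b * (pi / 2)) * cmod z `^ b)).
Proof.
move=> b0 b1 s0 z0; rewrite cmod_cexp ler_expR cReN cReZ lerN2 -mulrA.
by rewrite ler_wpM2l// cpow_Re_ge.
Qed.

(** In the right half plane [Re z^b >= cos (b pi / 2) |z|^b], with a positive cosine as [b < 1]; the
    resulting [exp (- k |z|^b)] beats every power, by [powR_le_expR] with exponent [q / b]. One
    constant serves all [s >= s0]. *)
Lemma cexp_cpow_decay (b s0 q : R) : 0 < b -> b < 1 -> 0 < s0 -> 0 < q ->
  exists C : R, 0 < C /\ forall s z, s0 <= s -> 0 < complex.Re z ->
    cmod (cexp (- (s%:C * cpow z b))) <= C * cmod z `^ (- q).
Proof.
move=> b0 b1 s00 q0; pose k := s0 * cos (b * (pi / 2)).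
have k0 : 0 < k by rewrite mulr_gt0// cos_bpi_gt0.
have qb0 : 0 < q / b by rewrite divr_gt0.
have [C [C0 HC]] := powR_le_expR qb0.
exists (C / k `^ (q / b)); split; first by rewrite divr_gt0// powR_gt0.
move=> s z ss z0; have n0 : z != 0 by apply/eqP => e; rewrite e ltxx in z0.
have m0 : 0 < cmod z by rewrite cmod_gt0.
have P0 : 0 < cmod z `^ b by rewrite powR_gt0.
apply: le_trans (cexp_cpow_le b0 b1 _ z0) _; first by lra.
apply: (@le_trans _ _ (expR (- (k * cmod z `^ b)))).
  rewrite ler_expR lerN2 ler_pM2r// /k ler_pM2r//; exact: cos_bpi_gt0.
have x0 : 0 < k * cmod z `^ b by rewrite mulr_gt0.
have := HC _ x0; rewrite powRM ?(ltW k0) ?(ltW P0)// -powRrM mulrCA divff ?gt_eqF// mulr1.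
move=> h; rewrite powRN expRN -mulrA -invfM.
have kq : 0 < k `^ (q / b) * cmod z `^ q by rewrite mulr_gt0 ?powR_gt0.
rewrite -[leLHS]mul1r ler_pdivrMr ?expR_gt0// mulrAC ler_pdivlMr// mul1r.
exact: h.
Qed.

(** For [|z| >= c], a multiple of [bump (|z|^b)] dominates [|z|^-b], so the case [rho = 1] of
    [bump_line] already contains this. *)
Lemma line_pow_integrable (c b : R) : 0 < c -> 0 < b ->
  mu.-integrable setT (EFin \o (fun y => cmod (c +i* y) `^ (- 1 - b))).
Proof.
move=> c0 b0; have bn : b != 0 by rewrite gt_eqF.
have [M HM] := bump_line c0 bn; have [iM _] := HM 1 ltr01.
pose r0 := c `^ b; have r00 : 0 < r0 by rewrite powR_gt0.
pose K := (1 + r0^-1) ^+ 2.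
apply: (@integrable_dom _ _ _ mu _ (fun y => K * ((cmod (c +i* y))^-1 *
  bump (1 * cmod (c +i* y) `^ b)))).
- apply: (measurableT_comp (@measurable_powR R _)).
  by apply: measurable_cmod; exact: cmeasurable_line.
- exact: integrable_scale.
move=> y; have m0 := cmod_line_gt0 c0 y; set m := cmod _ in m0 *.
have cm : c <= m := Re_le_cmod (c +i* y).
rewrite ger0_norm ?powR_ge0// mul1r powRB; last by rewrite (gt_eqF m0) implybT.
rewrite powR_inv1 ?(ltW m0)// mulrCA ler_pM2l ?invr_gt0//.
set r := m `^ b; have rr : r0 <= r.
  by apply: ge0_ler_powR; rewrite ?nnegrE ?(ltW b0) ?(ltW c0) ?(ltW m0).
have rp : 0 < r by exact: lt_le_trans rr.
rewrite /bump mulrA ler_pdivlMr ?exprn_gt0//; last by lra.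
rewrite -[leLHS]mul1r mulrC mulrA.
have h : (1 + r) <= (1 + r0^-1) * r.
  rewrite mulrDl mul1r addrC lerD2l// mulrC ler_pdivlMr// mul1r//.
have h2 : (1 + r) ^+ 2 <= ((1 + r0^-1) * r) ^+ 2.
  apply: lerXn2r => //; rewrite nnegrE; first by lra.
  by rewrite mulr_ge0 ?(ltW rp)// addr_ge0// invr_ge0 ltW.
have := ler_wpM2r (ltW (_ : 0 < r^-1)) h2; rewrite invr_gt0 => /(_ rp).
rewrite exprMn [r ^+ 2]expr2 -!mulrA divff ?gt_eqF// mulr1 => h3.
by move: h3; rewrite /K; lra.
Qed.

End Decay.

(** * The kernel f *)

Section Pexp.
Context {R : realType}.
Local Notation mu := (@lebesgue_measure R).
Implicit Types (u z : R[i]).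

(* [z ^+ 2] times the second derivative of [exp (- t z ^ a)], as a function of
   [u = t z ^ a]. *)
Definition pexp (a : R) u : R[i] :=
  a%:C * (1 - a%:C) * (u * cexp ((-1)%:C * u)) +
  a%:C ^+ 2 * (u * (u * cexp ((-1)%:C * u))).

Lemma sectorial_pexp a : sectorial (pi / 2) (pexp a).
Proof.
apply: sectorialD; apply: sectorialZ.
  by apply: sectorial_mulexp; rewrite ltr01.
by apply: sectorial_sqrexp; rewrite ltr01.
Qed.

Lemma cmeasurable_pexp d (T : measurableType d) (a : R) (F : T -> R[i]) :
  cmeasurable F -> cmeasurable (fun x => pexp a (F x)).
Proof.
move=> mF.
have me : cmeasurable (fun x => cexp ((-1)%:C * F x)).
  by apply/cmeasurable_cexp/cmeasurableM => //; exact: cmeasurable_cst.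
apply: cmeasurableD; (apply: cmeasurableM; first exact: cmeasurable_cst).
  exact: cmeasurableM.
by apply: cmeasurableM => //; exact: cmeasurableM.
Qed.

Lemma sectorial_cpow_bound (P : R[i] -> R[i]) (omega b : R) :
  sectorial omega P -> `|b| * (pi / 2) < omega ->
  exists C : R, 0 < C /\ forall s z, 0 < s -> 0 < complex.Re z ->
    cmod (P (s%:C * cpow z b)) <= C * bump (s * cmod z `^ b).
Proof.
move=> [P1 HP] hb; have [C [dlt [d0 q]]] := HP _ hb.
exists (`|C| + 1); split; first by rewrite ltr_wpDl.
move=> s z s0 z0; have n0 : z != 0 by apply/eqP => e; rewrite e ltxx in z0.
have ss : insec (`|b| * (pi / 2)) (s%:C * cpow z b).
  by rewrite -[X in insec X _]add0r; apply: insecM (insec_real s0) (insec_cpow_Re_gt0 b z0).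
have := quad_cmod (q _ ss).
rewrite cmodM cmodR gtr0_norm// cmod_cpow// => h; apply: (le_trans h).
apply: ler_wpM2r; first by rewrite bump_ge0// mulr_ge0 ?powR_ge0 ?(ltW s0).
by apply: le_trans (ler_norm C) _; rewrite lerDl.
Qed.

Lemma powR_N2 (x : R) : 0 <= x -> x `^ (- 1 - 1) = x^-1 * x^-1.
Proof.
move=> x0; have -> : - 1 - 1 = - (2%:R) :> R by ring.
by rewrite powR_invn// expr2 invfM.
Qed.

Variables (c a t tau : R).
Hypotheses (c0 : 0 < c) (a0 : 0 < a) (a1 : a < 1) (t0 : 0 < t) (tau0 : 0 < tau).

Let E z := cexp ((- t)%:C * cpow z a).
Let U z := t%:C * cpow z a.
(** The boundary term of the two integrations by parts, [exp (tau z) (E / tau - E' / tau^2)] with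
    [E' = - a z^-1 U E]. Its derivative is [exp (tau z) (E - E'' / tau^2)], that is [L1]. *)
Let L z := cexp (tau%:C * z) *
  (tau%:C^-1 * E z + a%:C * tau%:C ^- 2 * (z^-1 * (U z * E z))).
Let L1 z := cexp (tau%:C * z) * (E z - tau%:C ^- 2 * (z^-1 * z^-1) * pexp a (U z)).

Let a2 : `|a| <= 2.
Proof. by rewrite gtr0_norm//; have := a1; lra. Qed.

Let cdiff_E z : 0 < complex.Re z -> cdiff E ((- t)%:C * (a%:C * z^-1 * cpow z a) * E z) z.
Proof. by move=> z0; apply: cdiff_cexpf; apply: cdiffZ; exact: cdiff_cpow. Qed.

Let cdiff_U z : 0 < complex.Re z -> cdiff U (t%:C * (a%:C * z^-1 * cpow z a)) z.
Proof. by move=> z0; apply: cdiffZ; exact: cdiff_cpow. Qed.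

Let EU z : cexp ((-1)%:C * U z) = E z.
Proof. by rewrite /U /E mulrA -rmorphM mulN1r. Qed.

Let tauC : tau%:C != 0 :> R[i].
Proof. by rewrite -cmod_eq0 cmodR normr_eq0 gt_eqF. Qed.

Let Re_neq0 z : 0 < complex.Re z -> z != 0.
Proof. by move=> z0; apply/eqP => e; rewrite e ltxx in z0. Qed.

Let cdiff_L z : 0 < complex.Re z -> cdiff L (L1 z) z.
Proof.
move=> z0; have n0 := Re_neq0 z0.
have h := cdiffM (cdiff_cexp tau%:C z) (cdiffD (cdiffZ tau%:C^-1 (cdiff_E z0))
  (cdiffZ (a%:C * tau%:C ^- 2) (cdiffM (cdiffV n0) (cdiffM (cdiff_U z0) (cdiff_E z0))))).
apply: (cdiff_deriv_eq h); rewrite /L1 /pexp EU /U.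
have -> : (- t)%:C = - t%:C :> R[i] by rewrite rmorphN.
move: (E z) (cpow z a) (cexp _) => e X Y.
by field; rewrite n0 tauC.
Qed.

Let cdiff_L1 z : 0 < complex.Re z -> exists f1, cdiff L1 f1 z.
Proof.
move=> z0; have n0 := Re_neq0 z0.
have EE : L1 = fun z => cexp (tau%:C * z) * (E z + - tau%:C ^- 2 * ((z^-1 * z^-1) *
   (a%:C * (1 - a%:C) * (U z * E z) + a%:C ^+ 2 * (U z * (U z * E z))))).
  by apply/funext => w; rewrite /L1 /pexp EU mulNr -!mulrA.
rewrite EE; eexists; apply: cdiffM; first exact: cdiff_cexp.
apply: cdiffD; first exact: cdiff_E.
apply: cdiffZ; apply: cdiffM.
  by apply: cdiffM; exact: cdiffV.
apply: cdiffD; apply: cdiffZ; first by apply: cdiffM; [exact: cdiff_U|exact: cdiff_E].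
apply: cdiffM; first exact: cdiff_U.
by apply: cdiffM; [exact: cdiff_U|exact: cdiff_E].
Qed.

Let Re_line y : 0 < complex.Re (c +i* y) := c0.

Let mE : cmeasurable (fun y => E (c +i* y)).
Proof.
by apply/cmeasurable_cexp/cmeasurableM; [exact: cmeasurable_cst|exact: cmeasurable_cpow_line].
Qed.

Let mU : cmeasurable (fun y => U (c +i* y)).
Proof.
by apply: cmeasurableM; [exact: cmeasurable_cst|exact: cmeasurable_cpow_line].
Qed.

Let mexp : cmeasurable (fun y => cexp (tau%:C * (c +i* y))).
Proof.
by apply/cmeasurable_cexp/cmeasurableM; [exact: cmeasurable_cst|exact: cmeasurable_line].
Qed.

Let cmod_exp y : cmod (cexp (tau%:C * (c +i* y))) = expR (tau * c).
Proof. by rewrite cmod_cexp cReZ. Qed.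

Let E_decay : exists C : R, 0 < C /\ forall y,
  cmod (E (c +i* y)) <= C * cmod (c +i* y) `^ (- 1 - 1).
Proof.
have [C [C0 H]] := cexp_cpow_decay a0 a1 t0 (ltr0n _ 2 : 0 < 2%:R :> R).
exists C; split=> // y; have := H t _ (lexx t) (Re_line y).
have -> : - 1 - 1 = - (2%:R) :> R by ring.
by rewrite /E rmorphN mulNr.
Qed.

Let pexp_bound : exists C : R, 0 < C /\ forall y, cmod (pexp a (U (c +i* y))) <= C.
Proof.
have ab : `|a| * (pi / 2) < pi / 2.
  by rewrite gtr0_norm//; have := pi_gt0 R; have := a1; nra.
have [C [C0 H]] := sectorial_cpow_bound (sectorial_pexp a) ab.
exists C; split=> // y; apply: le_trans (H t _ t0 (Re_line y)) _.
by rewrite ler_piMr ?(ltW C0)// bump_le1// mulr_ge0 ?powR_ge0 ?(ltW t0).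
Qed.

Let U_bound : exists C : R, 0 < C /\ forall y, cmod (U (c +i* y) * E (c +i* y)) <= C.
Proof.
have ab : `|a| * (pi / 2) < pi / 2.
  by rewrite gtr0_norm//; have := pi_gt0 R; have := a1; nra.
have [C [C0 H]] := sectorial_cpow_bound (sectorial_mulexp (ltr01 : 0 < 1 :> R)) ab.
exists C; split=> // y; have := H t _ t0 (Re_line y); rewrite -/(U _) EU => h.
apply: (le_trans h).
by rewrite ler_piMr ?(ltW C0)// bump_le1// mulr_ge0 ?powR_ge0 ?(ltW t0).
Qed.

Let iE : cintegrable mu (fun y => cexp (tau%:C * (c +i* y)) * E (c +i* y)).
Proof.
have [C [C0 H]] := E_decay.
apply: (@cintegrable_dom _ _ _ mu _ (fun y => expR (tau * c) * C * cmod (c +i* y) `^ (- 1 - 1))).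
- exact: cmeasurableM.
- by apply: integrable_scale; apply: line_pow_integrable.
- by move=> y; rewrite cmodM cmod_exp -[leRHS]mulrA ler_wpM2l ?expR_ge0.
Qed.

Let iP : cintegrable mu (fun y => cexp (tau%:C * (c +i* y)) *
  (tau%:C ^- 2 * ((c +i* y)^-1 * (c +i* y)^-1) * pexp a (U (c +i* y)))).
Proof.
have [C [C0 H]] := pexp_bound.
have mV : cmeasurable (fun y => (c +i* y)^-1) by apply: cmeasurableV; exact: cmeasurable_line.
apply: (@cintegrable_dom _ _ _ mu _ (fun y =>
  expR (tau * c) * (tau ^- 2 * C) * cmod (c +i* y) `^ (- 1 - 1))).
- apply: cmeasurableM => //; apply: cmeasurableM; last exact: cmeasurable_pexp.
  by apply: cmeasurableM; [exact: cmeasurable_cst|exact: cmeasurableM].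
- by apply: integrable_scale; apply: line_pow_integrable.
- move=> y; rewrite cmodM cmod_exp -[leRHS]mulrA ler_wpM2l ?expR_ge0//.
  rewrite powR_N2 ?cmod_ge0// cmodM cmodM cmodV cmodX cmodR gtr0_norm//.
  rewrite [cmod (_^-1 * _)]cmodM !cmodV [leRHS]mulrAC; apply: ler_wpM2l; last exact: H.
  apply: mulr_ge0; first by rewrite invr_ge0 exprn_ge0// ltW.
  by rewrite mulr_ge0// invr_ge0 cmod_ge0.
Qed.

(** [L] decays like [1 / |z|] on the line: [E] does so with a power to spare, and the bounded [U E]
    comes with a factor [z^-1]. No boundary term survives at infinity. *)
Let int_L1 : cint mu (fun y => 'i * L1 (c +i* y)) = 0.
Proof.
have EE : (fun y => L1 (c +i* y)) = (fun y => cexp (tau%:C * (c +i* y)) * E (c +i* y) -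
  cexp (tau%:C * (c +i* y)) *
  (tau%:C ^- 2 * ((c +i* y)^-1 * (c +i* y)^-1) * pexp a (U (c +i* y)))).
  by apply/funext => y; rewrite /L1 mulrBr.
have [C1 [C10 H1]] := E_decay; have [C2 [C20 H2]] := U_bound.
apply: (@cint_FTC_line _ (fun y => L (c +i* y)) _
  (expR (tau * c) * (tau^-1 * (C1 * c^-1) + a * tau ^- 2 * C2))).
- by apply: cderive_line => y; exact: cdiff_L.
- by apply: ccontinuous_iM; apply: ccontinuous_line => y; exact: cdiff_L1.
- by apply: cintegrableZ; rewrite EE; exact: cintegrableB.
move=> y; rewrite /L cmodM cmod_exp -[leLHS]mulrA ler_wpM2l ?expR_ge0//.
set z := c +i* y; have m0 : 0 < cmod z := cmod_line_gt0 c0 y.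
have ym : `|y| <= cmod z := normIm_cmod z.
have cm : c <= cmod z := Re_le_cmod z.
have ti : 0 < tau^-1 by rewrite invr_gt0.
apply: (@le_trans _ _ (cmod (tau%:C^-1 * E z +
    a%:C * tau%:C ^- 2 * (z^-1 * (U z * E z))) * cmod z)).
  by rewrite ler_wpM2l ?cmod_ge0.
apply: le_trans (ler_wpM2r (ltW m0) (cmodD _ _)) _; rewrite mulrDl lerD//.
  rewrite cmodM cmodV cmodR gtr0_norm// -[leLHS]mulrA ler_pM2l//.
  apply: le_trans (ler_wpM2r (ltW m0) (H1 y)) _; rewrite -/z -mulrA ler_pM2l//.
  rewrite powR_N2 ?cmod_ge0// -mulrA mulVf ?gt_eqF// mulr1 lef_pV2 ?posrE//.
rewrite cmodM [cmod (a%:C * _)]cmodM cmodV cmodX !cmodR !gtr0_norm// -[leLHS]mulrA ler_wpM2l//.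
  by rewrite mulr_ge0 ?(ltW a0)// invr_ge0 exprn_ge0// ltW.
rewrite [cmod (z^-1 * _)]cmodM cmodV mulrAC mulVf ?gt_eqF// mul1r; exact: H2.
Qed.

(** The density [tau^-2 exp (tau z) z^-2 dz], where ['i] comes from [dz = i dy]. Unlike its
    counterpart [gp] for [phi], it is absolutely integrable. *)
Definition gf (y : R) : R[i] :=
  cexp (tau%:C * (c +i* y)) * (tau%:C ^- 2 * ((c +i* y)^-1 * (c +i* y)^-1)) * 'i.

Lemma cmeasurable_gf : cmeasurable gf.
Proof.
have mV : cmeasurable (fun y => (c +i* y)^-1) by apply: cmeasurableV; exact: cmeasurable_line.
apply: cmeasurableM; last exact: cmeasurable_cst.
apply: cmeasurableM; first exact: mexp.
by apply: cmeasurableM; [exact: cmeasurable_cst|exact: cmeasurableM].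
Qed.

Lemma cmod_gf (y : R) : cmod (gf y) = expR (tau * c) * tau ^- 2 * cmod (c +i* y) `^ (-1 - 1).
Proof.
rewrite /gf cmodM cmodi mulr1 cmodM cmod_exp -mulrA; congr (_ * _).
rewrite powR_N2 ?cmod_ge0// cmodM cmodV cmodX cmodR gtr0_norm//; congr (_ * _).
by rewrite cmodM !cmodV.
Qed.

(* Two integrations by parts in z. *)
Lemma f_kernel_pexp : f_kernel c a t tau =
  ((2 * pi)%:C * 'i)^-1 * cint mu (fun y => gf y * pexp a (t%:C * cpow (c +i* y) a)).
Proof.
have EE : (fun y => L1 (c +i* y)) = (fun y => cexp (tau%:C * (c +i* y)) * E (c +i* y) -
  cexp (tau%:C * (c +i* y)) *
  (tau%:C ^- 2 * ((c +i* y)^-1 * (c +i* y)^-1) * pexp a (U (c +i* y)))).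
  by apply/funext => y; rewrite /L1 mulrBr.
rewrite /f_kernel /bromwich; congr (_ * _).
have h := int_L1; rewrite cintZ in h; last by rewrite EE; exact: cintegrableB.
rewrite EE cintB// in h; move/eqP: h.
rewrite mulrBr subr_eq0 -!cintZ// => /eqP h.
rewrite -[LHS]/(cint mu _).
transitivity (cint mu (fun y => 'i * (cexp (tau%:C * (c +i* y)) * E (c +i* y)))).
  apply: eq_cint => y; rewrite mulrC; congr (_ * _).
  by rewrite cexpD mulrC [_ * tau%:C]mulrC /E rmorphN mulNr mulrC.
rewrite h; apply: eq_cint => y; rewrite /gf /U; ring.
Qed.

End Pexp.

(** * The kernel phi *)

Section DerivUnder.
Context {R : realType}.
Local Notation mu := (@lebesgue_measure R).

Lemma is_derive_Rintegral (f f1 : R -> R -> R) (a : R) (G : R -> R) :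
  (forall x, `|x - a| < 1 -> mu.-integrable setT (EFin \o f x)) ->
  (forall x y, `|x - a| < 1 -> is_derive x 1 (f ^~ y) (f1 x y)) ->
  mu.-integrable setT (EFin \o G) ->
  (forall x y, `|x - a| < 1 -> `|f1 x y| <= G y) ->
  is_derive a 1 (fun x => \int[mu]_y f x y)%R (\int[mu]_y f1 a y)%R.
Proof.
move=> fi df iG fG.
have aI : `]a - 1, a + 1[%classic a by rewrite /= in_itv /=; apply/andP; split; lra.
have xI x : `]a - 1, a + 1[%classic x -> `|x - a| < 1.
  by rewrite /= in_itv /= => /andP[? ?]; rewrite ltr_norml; apply/andP; split; lra.
have pE x y : `]a - 1, a + 1[%classic x -> partial1of2 f x y = f1 x y.
  by move=> /xI xa; rewrite partial1of2E; case: (df x y xa).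
have H1 x : `]a - 1, a + 1[%classic x -> mu.-integrable setT (EFin \o f x).
  by move=> /xI; exact: fi.
have H2 x y : `]a - 1, a + 1[%classic x -> setT y -> derivable (f ^~ y) x 1.
  by move=> /xI xa _; case: (df x y xa).
have G0 y : 0 <= G y.
  by apply: le_trans (fG a y _); rewrite ?subrr ?normr0 ?normr_ge0.
have H3 x y : `]a - 1, a + 1[%classic x -> setT y -> `|partial1of2 f x y| <= G y.
  by move=> xa _; rewrite pE//; apply: fG; exact: xI.
apply: DeriveDef.
  exact: (derivable_under_integral measurableT aI H1 H2 G0 iG H3).
rewrite -derive1E (differentiation_under_integral measurableT aI H1 H2 G0 iG H3).
by apply: eq_Rintegral => y _; rewrite pE.
Qed.

End DerivUnder.

Section Phi.
Context {R : realType}.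
Local Notation mu := (@lebesgue_measure R).
Implicit Types (k z w : R[i]) (x y : R).
Variables (d b t s : R).
Hypotheses (d0 : 0 < d) (b0 : 0 < b) (b1 : b < 1) (t0 : 0 < t) (s0 : 0 < s).

(* The integrand after the dilation [w -> exp k * w] of the contour; [k] is
   complex only in order to differentiate with the calculus of [cdiff]. *)
Let N k w := cexp (b%:C * k) * (cpow w (b - 1) *
  cexp (t%:C * w * cexp (1 * k) + (- s)%:C * cpow w b * cexp (b%:C * k))).
(** Both the derivative of [N] in [k] and the derivative of [w N] in [w]: as [N k w dw] is the
    pullback of one fixed form under [z = exp k * w], moving [k] changes it by an exact form. *)
Let D k w := (b%:C + t%:C * w * cexp (1 * k) +
  b%:C * ((- s)%:C * cpow w b * cexp (b%:C * k))) * N k w.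

Let Re_neq0 z : 0 < complex.Re z -> z != 0.
Proof. by move=> z0; apply/eqP => e; rewrite e ltxx in z0. Qed.

Let b2 : `|b| <= 2.
Proof. by rewrite gtr0_norm//; have := b1; lra. Qed.

Let b2' : `|b - 1| <= 2.
Proof. by have h1 := b1; have h0 := b0; rewrite ler_norml; apply/andP; split; lra. Qed.

Let cdiff_k k w : cdiff (N ^~ w) (D k w) k.
Proof.
have h := cdiffM (cdiff_cexp b%:C k) (cdiffM (cdiff_cst (cpow w (b - 1)) k)
  (cdiff_cexpf (cdiffD (cdiffZ (t%:C * w) (cdiff_cexp 1 k))
    (cdiffZ ((- s)%:C * cpow w b) (cdiff_cexp b%:C k))))).
by apply: (cdiff_deriv_eq h); rewrite /D /N; ring.
Qed.

Let cdiff_N k w : 0 < complex.Re w -> exists2 f1, cdiff (N k) f1 w &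
  N k w + w * f1 = D k w.
Proof.
move=> w0; have n0 := Re_neq0 w0.
have h := cdiffZ (cexp (b%:C * k)) (cdiffM (cdiff_cpow b2' w0)
  (cdiff_cexpf (cdiffD
    (cdiffM (cdiffZ t%:C (cdiff_id w)) (cdiff_cst (cexp (1 * k)) w))
    (cdiffM (cdiffZ (- s)%:C (cdiff_cpow b2 w0)) (cdiff_cst (cexp (b%:C * k)) w))))).
eexists; first exact: h.
rewrite /D /N [(b - 1)%:C]rmorphB rmorph1 /=.
move: (cpow w b) (cpow w (b - 1)) (cexp (1 * k)) (cexp (b%:C * k)) => X Y e1 e2.
by move: (cexp _) => e3; field.
Qed.

Let cdiff_w k w : 0 < complex.Re w -> cdiff (fun w => w * N k w) (D k w) w.
Proof.
move=> w0; have [f1 h e] := cdiff_N k w0.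
by apply: (cdiff_deriv_eq (cdiffM (cdiff_id w) h)); rewrite -e mul1r.
Qed.

Let cdiff_D k w : 0 < complex.Re w -> exists f1, cdiff (D k) f1 w.
Proof.
move=> w0; have [f1 h _] := cdiff_N k w0; eexists; apply: cdiffM; last exact: h.
apply: cdiffD; first apply: cdiffD; first exact: cdiff_cst.
  by apply: cdiffM; [apply: cdiffZ; exact: cdiff_id|exact: cdiff_cst].
apply: cdiffZ; apply: cdiffM; last exact: cdiff_cst.
by apply: cdiffZ; exact: cdiff_cpow.
Qed.

Let Re_line y : 0 < complex.Re (d +i* y) := d0.

Let mN k : cmeasurable (fun y => N k (d +i* y)).
Proof.
apply: ccontinuous_cmeasurable; apply: ccontinuous_line => y.
by have [f1 h _] := cdiff_N k (Re_line y); exists f1.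
Qed.

Let mD k : cmeasurable (fun y => D k (d +i* y)).
Proof.
apply: ccontinuous_cmeasurable; apply: ccontinuous_line => y; exact: cdiff_D.
Qed.

(** Uniformity near [x0] prepares the dominating function for differentiation under the integral
    sign; the factor [|w|] is kept for the boundary terms of [w N] and for [D_decay]. *)
Let N_decay x0 : exists C : R, 0 < C /\ forall x y, `|x - x0| < 1 ->
  cmod (N x%:C (d +i* y)) * cmod (d +i* y) <= C * cmod (d +i* y) `^ (- 1 - 1).
Proof.
have s00 : 0 < s * expR (b * (x0 - 1)) by rewrite mulr_gt0 ?expR_gt0.
(* With decay of order [2 + b], the product [|w|^(b - 1) |w|^-(2 + b) |w|] is [|w|^-2]. *)
have q0 : 0 < 2 + b by have := b0; lra.
have [C [C0 HC]] := cexp_cpow_decay b0 b1 s00 q0.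
pose M := expR (b * (x0 + 1)) * expR (t * d * expR (x0 + 1)).
have M0 : 0 < M by rewrite mulr_gt0 ?expR_gt0.
exists (M * C); split; first by rewrite mulr_gt0.
move=> x y; rewrite ltr_norml => /andP[xl xu].
set w := d +i* y; have w0 := Re_line y; rewrite -/w in w0.
have n0 := Re_neq0 w0; have m0 : 0 < cmod w by rewrite cmod_gt0.
have e1 : expR (b * x) <= expR (b * (x0 + 1)).
  by rewrite ler_expR ler_pM2l//; lra.
have e2 : expR (t * d * expR x) <= expR (t * d * expR (x0 + 1)).
  by rewrite ler_expR ler_pM2l ?mulr_gt0// ler_expR; lra.
have sx : s * expR (b * (x0 - 1)) <= s * expR (b * x).
  by rewrite ler_pM2l// ler_expR ler_pM2l//; lra.
have h := HC _ _ sx w0.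
have -> : N x%:C w = cexp (b%:C * x%:C) * (cpow w (b - 1) *
    (cexp (t%:C * w * cexp (1 * x%:C)) *
     cexp (- ((s * expR (b * x))%:C * cpow w b)))).
  rewrite /N -cexpD; congr (_ * (_ * cexp (_ + _))).
  by rewrite -[b%:C * x%:C]rmorphM cexpR rmorphN rmorphM /=; ring.
rewrite cmodM [cmod (cpow w (b - 1) * _)]cmodM [cmod (cexp _ * _)]cmodM.
have -> : cmod (cexp (b%:C * x%:C)) = expR (b * x) by rewrite cmod_cexp cReZ.
have -> : cmod (cexp (t%:C * w * cexp (1 * x%:C))) = expR (t * d * expR x).
  rewrite cmod_cexp mul1r cexpR [_ * w * _]mulrC cReZ cReZ; congr expR.
  by rewrite /w /=; ring.
rewrite cmod_cpow//; set m := cmod w in m0 h *.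
have P0 : 0 < m `^ (b - 1) by rewrite powR_gt0.
have mE : m `^ (b - 1) * m `^ (- (2 + b)) * m = m `^ (- 1 - 1).
  have nz (p q : R) : (p + q == 0) ==> (m != 0) by rewrite (gt_eqF m0) implybT.
  rewrite -powRD// -{2}(powRr1 (ltW m0)) -powRD//; congr (_ `^ _); ring.
rewrite -mE.
have h1 : expR (b * x) * (m `^ (b - 1) * (expR (t * d * expR x) *
    cmod (cexp (- ((s * expR (b * x))%:C * cpow w b))))) <=
  expR (b * (x0 + 1)) * (m `^ (b - 1) * (expR (t * d * expR (x0 + 1)) *
    (C * m `^ (- (2 + b))))).
  apply: ler_pM => //; rewrite ?expR_ge0//.
    by rewrite !mulr_ge0 ?expR_ge0 ?cmod_ge0 ?(ltW P0).
  apply: ler_wpM2l; first exact: ltW.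
  by apply: ler_pM; rewrite ?expR_ge0 ?cmod_ge0.
apply: le_trans (ler_wpM2r (ltW m0) h1) _.
by rewrite /M le_eqVlt; apply/orP; left; apply/eqP; ring.
Qed.

(** The factor in front of [N] in [D] is [O(|w|)], since [|w| >= d] and [b < 1]; it consumes the
    spare [|w|] of [N_decay]. *)
Let D_decay x0 : exists C : R, 0 < C /\ forall x y, `|x - x0| < 1 ->
  cmod (D x%:C (d +i* y)) <= C * cmod (d +i* y) `^ (- 1 - 1).
Proof.
have [C [C0 HC]] := N_decay x0.
pose M := b / d + t * expR (x0 + 1) + b * (s * expR (b * (x0 + 1)) * (1 + d^-1)).
have di : 0 < d^-1 by rewrite invr_gt0.
have M0 : 0 < M.
  rewrite /M !addr_gt0//; first by rewrite mulr_gt0.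
    by rewrite mulr_gt0 ?expR_gt0.
  by rewrite !mulr_gt0 ?expR_gt0// addr_gt0.
exists (M * C); split; first by rewrite mulr_gt0.
move=> x y xx; have h := HC x y xx.
move: xx; rewrite ltr_norml => /andP[xl xu].
set w := d +i* y in h *; have w0 := Re_line y; rewrite -/w in w0.
have n0 := Re_neq0 w0; have m0 : 0 < cmod w by rewrite cmod_gt0.
have dm : d <= cmod w := Re_le_cmod w.
rewrite /D cmodM.
have e1 : expR x <= expR (x0 + 1) by rewrite ler_expR; lra.
have e2 : expR (b * x) <= expR (b * (x0 + 1)) by rewrite ler_expR ler_pM2l//; lra.
have mb : cmod w `^ b <= (1 + d^-1) * cmod w.
  have [m1|m1] := leP 1 (cmod w).
    apply: (@le_trans _ _ (cmod w)); last by rewrite ler_peMl ?(ltW m0)//; lra.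
    rewrite -[leRHS]powRr1 ?(ltW m0)//; apply: ler_powR => //; exact: ltW.
  apply: (@le_trans _ _ 1).
    apply: (@le_trans _ _ (1 `^ b)); last by rewrite powR1.
    apply: ge0_ler_powR; rewrite ?nnegrE ?(ltW b0) ?(ltW m0)//.
    exact: ltW.
  have : 1 <= d^-1 * cmod w by rewrite mulrC ler_pdivlMr// mul1r.
  by rewrite mulrDl mul1r; lra.
have hM : cmod (b%:C + t%:C * w * cexp (1 * x%:C) +
    b%:C * ((- s)%:C * cpow w b * cexp (b%:C * x%:C))) <= M * cmod w.
  apply: le_trans (cmodD _ _) _; apply: le_trans (lerD (cmodD _ _) (lexx _)) _.
  rewrite /M !mulrDl; apply: lerD; first apply: lerD.
  - by rewrite cmodR gtr0_norm// -mulrA ler_peMr ?(ltW b0)// mulrC ler_pdivlMr// mul1r.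
  - rewrite cmodM [cmod (_ * w)]cmodM cmodR gtr0_norm// mul1r cmod_cexp /=.
    rewrite mulrAC ler_pM2r// ler_pM2l//.
  - rewrite cmodM cmodR gtr0_norm// -[leRHS]mulrA ler_pM2l//.
    rewrite cmodM [cmod ((- s)%:C * _)]cmodM cmodR normrN gtr0_norm// cmod_cpow// cmod_cexp cReZ /=.
    rewrite mulrAC -[leRHS]mulrA; apply: ler_pM => //;
      rewrite ?mulr_ge0 ?expR_ge0 ?powR_ge0 ?(ltW s0)//.
    by rewrite ler_pM2l.
apply: le_trans (ler_wpM2r (cmod_ge0 _) hM) _.
rewrite -!mulrA ler_pM2l// mulrC; exact: h.
Qed.

Let ipow : mu.-integrable setT (EFin \o (fun y => cmod (d +i* y) `^ (- 1 - 1))).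
Proof. by apply: line_pow_integrable. Qed.

Let N_dom x0 : exists C : R, 0 < C /\ forall x y, `|x - x0| < 1 ->
  cmod (N x%:C (d +i* y)) <= C * cmod (d +i* y) `^ (- 1 - 1).
Proof.
have [C [C0 HC]] := N_decay x0; exists (d^-1 * C); split.
  by rewrite mulr_gt0 ?invr_gt0.
move=> x y xx; rewrite -mulrA -ler_pdivrMl ?invr_gt0// invrK mulrC.
apply: le_trans (HC x y xx); apply: ler_wpM2l; first exact: cmod_ge0.
exact: Re_le_cmod (d +i* y).
Qed.

Let xx0 (x : R) : `|x - x| < 1.
Proof. by rewrite subrr normr0. Qed.

Let iN (x : R) : cintegrable mu (fun y => N x%:C (d +i* y)).
Proof.
have [C [C0 HC]] := N_dom x.
apply: (@cintegrable_dom _ _ _ mu _ (fun y => C * cmod (d +i* y) `^ (- 1 - 1))).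
- exact: mN.
- exact: (integrable_scale C ipow).
- by move=> y; apply: HC; exact: xx0.
Qed.

Let iD (x : R) : cintegrable mu (fun y => D x%:C (d +i* y)).
Proof.
have [C [C0 HC]] := D_decay x.
apply: (@cintegrable_dom _ _ _ mu _ (fun y => C * cmod (d +i* y) `^ (- 1 - 1))).
- exact: mD.
- exact: (integrable_scale C ipow).
- by move=> y; apply: HC; exact: xx0.
Qed.

Let int_D (x : R) : cint mu (fun y => D x%:C (d +i* y)) = 0.
Proof.
have [C [C0 HC]] := N_decay x.
have : cint mu (fun y => 'i * D x%:C (d +i* y)) = 0.
  apply: (@cint_FTC_line _ (fun y => (d +i* y) * N x%:C (d +i* y)) _ (C * d^-1)).
  - apply: (@cderive_line _ d (fun w => w * N x%:C w) (D x%:C)) => y.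
    exact: cdiff_w.
  - by apply: ccontinuous_iM; apply: ccontinuous_line => y; exact: cdiff_D.
  - exact: cintegrableZ.
  move=> y; rewrite cmodM [cmod (d +i* y) * _]mulrC.
  have m0 := cmod_line_gt0 d0 y; have h := HC x y (xx0 x).
  have ym : `|y| <= cmod (d +i* y) := normIm_cmod (d +i* y).
  have dm : d <= cmod (d +i* y) := Re_le_cmod (d +i* y).
  apply: le_trans (ler_pM _ _ h ym) _; rewrite ?mulr_ge0 ?cmod_ge0//.
  rewrite powR_N2 ?cmod_ge0// -!mulrA mulVf ?gt_eqF// mulr1 ler_pM2l//.
  by rewrite lef_pV2 ?posrE.
rewrite cintZ// => /eqP; rewrite mulf_eq0 => /orP[|/eqP//].
by rewrite -cmod_eq0 cmodi oner_eq0.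
Qed.

(** The substitute for Cauchy's theorem: the derivative in the dilation parameter is the integral of
    [D], which vanishes by [int_D]. *)
Let int_N_cst (x x' : R) : cint mu (fun y => N x%:C (d +i* y)) =
  cint mu (fun y => N x'%:C (d +i* y)).
Proof.
have der (x0 : R) x1 y : cderive (fun x : R => N x%:C (d +i* y)) (fun x : R => D x%:C (d +i* y)).
  by apply: (@cderive_real _ (N ^~ (d +i* y)) (D ^~ (d +i* y))) => k; exact: cdiff_k.
apply: complexP => /=.
- apply: (is_derive_0_is_cst (f := fun x : R => (\int[mu]_y complex.Re (N x%:C (d +i* y)))%R)) => a.
  have [C [C0 HC]] := D_decay a.
  have -> : 0 = (\int[mu]_y complex.Re (D a%:C (d +i* y)))%R.
    by have := congr1 (@complex.Re R) (int_D a).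
  apply: (is_derive_Rintegral (f := fun x y => complex.Re (N x%:C (d +i* y)))
    (f1 := fun x y => complex.Re (D x%:C (d +i* y)))
    (G := fun y => C * cmod (d +i* y) `^ (- 1 - 1))).
  + by move=> u _; case: (iN u).
  + by move=> u y _; case: (der 0 0 y u).
  + exact: (integrable_scale C ipow).
  + by move=> u y ua; apply: le_trans (normRe_cmod _) _; exact: HC.
- apply: (is_derive_0_is_cst (f := fun x : R => (\int[mu]_y complex.Im (N x%:C (d +i* y)))%R)) => a.
  have [C [C0 HC]] := D_decay a.
  have -> : 0 = (\int[mu]_y complex.Im (D a%:C (d +i* y)))%R.
    by have := congr1 (@complex.Im R) (int_D a).
  apply: (is_derive_Rintegral (f := fun x y => complex.Im (N x%:C (d +i* y)))
    (f1 := fun x y => complex.Im (D x%:C (d +i* y)))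
    (G := fun y => C * cmod (d +i* y) `^ (- 1 - 1))).
  + by move=> u _; case: (iN u).
  + by move=> u y _; case: (der 0 0 y u).
  + exact: (integrable_scale C ipow).
  + by move=> u y ua; apply: le_trans (normIm_cmod _) _; exact: HC.
Qed.

Definition gp (y : R) : R[i] := cexp (d +i* y) * (d +i* y)^-1 * 'i.

Lemma cmeasurable_gp : cmeasurable gp.
Proof.
apply: cmeasurableM; last exact: cmeasurable_cst.
apply: cmeasurableM; first by apply/cmeasurable_cexp/cmeasurable_line.
by apply/cmeasurableV/cmeasurable_line.
Qed.

Lemma cmod_gp y : cmod (gp y) = expR d * (cmod (d +i* y))^-1.
Proof. by rewrite /gp cmodM cmodi mulr1 cmodM cmod_cexp cmodV. Qed.

(* The dilation and the shift of the contour are performed at once. *)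
Lemma phi_kernel_dilated : phi_kernel d b t s =
  ((2 * pi)%:C * 'i)^-1 * cint mu (fun y => gp y *
    (((t `^ (- b))%:C * cpow (d +i* y) b) *
     cexp ((- s)%:C * ((t `^ (- b))%:C * cpow (d +i* y) b)))).
Proof.
rewrite /phi_kernel /bromwich; congr (_ * _).
rewrite -[LHS]/(cint mu _).
transitivity (cint mu (fun y => 'i * N 0%:C (d +i* y))).
  apply: eq_cint => y; rewrite mulrC /N; congr (_ * _).
  rewrite !mulr0 !cexp0 mul1r !mulr1; congr (_ * cexp _).
  by rewrite mulrC rmorphN mulNr.
(* At [k = - ln t] one has [t exp k = 1]: the exponential becomes [exp w], and [t] survives only in
   [t^-b]. *)
rewrite cintZ// (int_N_cst 0 (- ln t)) -cintZ//; apply: eq_cint => y.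
rewrite /N mul1r cexpR -[b%:C * _]rmorphM cexpR expRN lnK ?posrE//.
have -> : expR (b * - ln t) = t `^ (- b).
  by rewrite /powR gt_eqF//; congr expR; ring.
rewrite cpowB1 ?line_neq0// /gp.
have -> : t%:C * (d +i* y) * (t^-1)%:C + (- s)%:C * cpow (d +i* y) b * (t `^ (- b))%:C =
    (d +i* y) + (- s)%:C * ((t `^ (- b))%:C * cpow (d +i* y) b).
  congr (_ + _); last by ring.
  by rewrite mulrAC -rmorphM divff ?gt_eqF// mul1r.
by rewrite cexpD; ring.
Qed.

End Phi.

(** * The kernel psi *)

Section Tensor.
Context d1 d2 (T1 : measurableType d1) (T2 : measurableType d2) {R : realType}.
Variables (m1 : {sigma_finite_measure set T1 -> \bar R})
  (m2 : {sigma_finite_measure set T2 -> \bar R}).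

Lemma integrable_tensor (u : T1 -> R) (v : T2 -> R) :
  (forall x, 0 <= u x) -> (forall y, 0 <= v y) ->
  m1.-integrable setT (EFin \o u) -> m2.-integrable setT (EFin \o v) ->
  (m1 \x m2)%E.-integrable setT (EFin \o (fun p => u p.1 * v p.2)).
Proof.
move=> u0 v0 iu iv.
have mu : measurable_fun setT u by apply/measurable_EFinP; exact: measurable_int iu.
have mv : measurable_fun setT v by apply/measurable_EFinP; exact: measurable_int iv.
have [] // := @integrable_tonelli21 _ _ _ _ _ m1 m2 (fun p => u p.1 * v p.2)
  (fun y => (\int[m1]_x u x)%R * v y).
- apply: measurable_funM.
    exact: measurableT_comp mu measurable_fst.
  exact: measurableT_comp mv measurable_snd.
- by move=> p; rewrite mulr_ge0.
- exact: (integrable_scale _ iv).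
move=> y /=; under eq_integral do rewrite EFinM muleC.
rewrite (@integralZl _ _ _ m1 _ measurableT _ iu (v y)) mulrC EFinM.
by rewrite /Rintegral fineK// integrable_fin_num.
Qed.

Lemma cint_tensor (F : T1 -> R[i]) (G : T2 -> R[i]) (u : T1 -> R) (v : T2 -> R) :
  cmeasurable F -> cmeasurable G ->
  m1.-integrable setT (EFin \o u) -> m2.-integrable setT (EFin \o v) ->
  (forall x, cmod (F x) <= u x) -> (forall y, cmod (G y) <= v y) ->
  cintegrable (m1 \x m2)%E (fun p => F p.1 * G p.2) /\
  cint (m1 \x m2)%E (fun p => F p.1 * G p.2) = cint m1 F * cint m2 G.
Proof.
move=> mF mG iu iv Fu Gv.
have u0 x : 0 <= u x := le_trans (cmod_ge0 _) (Fu x).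
have v0 y : 0 <= v y := le_trans (cmod_ge0 _) (Gv y).
have iF : cintegrable m1 F by exact: cintegrable_dom iu Fu.
have iG : cintegrable m2 G by exact: cintegrable_dom iv Gv.
have iFG : cintegrable (m1 \x m2)%E (fun p => F p.1 * G p.2).
  apply: (cintegrable_dom _ (integrable_tensor u0 v0 iu iv)).
    apply: cmeasurableM.
      exact: (cmeasurable_comp mF measurable_fst).
    exact: (cmeasurable_comp mG measurable_snd).
  by move=> p; rewrite cmodM ler_pM ?cmod_ge0.
split=> //; rewrite cint_prod12//=; last by move=> x; exact: cintegrableZ.
rewrite (@eq_cint _ _ _ _ _ (fun x => cint m2 G * F x)).
  by rewrite cintZ// mulrC.
by move=> x; rewrite cintZ// mulrC.
Qed.

End Tensor.

(** * The Laplace transform of [pexp] *)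

Section Laplace.
Context {R : realType}.
Local Notation mu := (@lebesgue_measure R).

(* [A^-1 * ratio a (B / A)] is the Laplace transform of [s |-> pexp a (s B)]
   at [A]. *)
Definition ratio (a : R) (v : R[i]) : R[i] :=
  a%:C * (1 - a%:C) * (v * ((1 + v)^-1 * (1 + v)^-1)) +
  2 * a%:C ^+ 2 * (v * (v * ((1 + v)^-1 * ((1 + v)^-1 * (1 + v)^-1)))).

Lemma sectorial_ratio (a : R) : sectorial pi (ratio a).
Proof.
apply: sectorialD; apply: sectorialZ; first exact: sectorial_ratio2.
exact: sectorial_ratio3.
Qed.

Lemma cmeasurable_ratio d (T : measurableType d) (a : R) (F : T -> R[i]) :
  cmeasurable F -> cmeasurable (fun x => ratio a (F x)).
Proof.
move=> mF; have mi : cmeasurable (fun x => (1 + F x)^-1).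
  by apply/cmeasurableV/cmeasurableD => //; exact: cmeasurable_cst.
apply: cmeasurableD; (apply: cmeasurableM; first exact: cmeasurable_cst).
  by apply: cmeasurableM => //; exact: cmeasurableM.
do 3 (apply: cmeasurableM => //).
exact: cmeasurableM.
Qed.

(** The absolute value keeps the second factor continuous on the whole line without changing it
    where it counts. The bound [A^-1], with [A] of order [|w|^b], supplies the decay that [gp]
    lacks. *)
Lemma halfline_inv_sqr (A : R) : 0 < A ->
  let f (s : R) := (\1_(`]0, +oo[%classic : set R) s) * (1 + `|s| * A) ^- 2 in
  mu.-integrable setT (EFin \o f) /\ (\int[mu]_s (f s)%:E <= (A^-1)%:E)%E.
Proof.
move=> A0 f; pose g (s : R) : R := (1 + `|s| * A) ^- 2.
have p (s : R) : 0 < 1 + `|s| * A by rewrite ltr_pwDl// mulr_ge0// ltW.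
have cg : continuous g.
  move=> s; apply: cvgV; first by rewrite expf_neq0// gt_eqF.
  have c1 : {for s, continuous (fun s : R => 1 + `|s| * A)}.
    apply: cvgD; first exact: cvg_cst.
    by apply: cvgM; [exact: norm_continuous|exact: cvg_cst].
  by rewrite /=; apply: cvgM.
have g0 s : 0 <= g s by rewrite invr_ge0 exprn_ge0// ltW.
have f0 s : 0 <= f s by apply: mulr_ge0 (g0 s); rewrite indicE ler0n.
have mf : measurable_fun setT f.
  apply: measurable_funM; last exact: continuous_measurable_fun.
  by apply: measurable_indic; exact: measurable_itv.
have mg : measurable_fun (`]0, +oo[%classic : set R) (EFin \o g).
  by apply/measurable_EFinP/measurable_funTS; exact: continuous_measurable_fun.
have le : (\int[mu]_s (f s)%:E <= (A^-1)%:E)%E.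
  have -> : (\int[mu]_s (f s)%:E = \int[mu]_(s in `]0%R, +oo[) (g s)%:E)%E.
    rewrite [RHS]integral_mkcond; apply: eq_integral => s _.
    by rewrite patchE /f /g indicE; case: ifP; rewrite ?mul1r ?mul0r.
  rewrite integral_itv_obnd_cbnd//.
  pose F (s : R) : R := - (A * (1 + s * A))^-1.
  have dF (s : R) : 0 <= s -> is_derive s (1 : R) F (g s).
    move=> s0; have q : 0 < 1 + s * A by rewrite ltr_pwDl// mulr_ge0// ltW.
    have dD : is_derive s (1 : R) (fun s => A * (1 + s * A)) (A * A).
      apply: (is_derive_taylor (r := 1) (M := 0)) => // h _.
      by rewrite mul0r (_ : _ - _ - _ = 0) ?normr0//; ring.
    have n0 : A * (1 + s * A) != 0 by rewrite gt_eqF// mulr_gt0.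
    have dV := is_deriveV (f := fun s => A * (1 + s * A)) n0 dD.
    apply: is_derive_eq; rewrite /g ger0_norm// /GRing.scale /=; field.
    by rewrite !gt_eqF.
  rewrite (@ge0_continuous_FTC2y _ g F 0 0)//.
  - by rewrite add0e -EFinN lee_fin /F opprK mul0r addr0 mulr1.
  - exact: continuous_subspaceT.
  - apply/cvgrPdist_le => e e0; near=> s; rewrite sub0r opprK.
    have s0 : 0 <= s by near: s; apply: nbhs_pinfty_ge; rewrite num_real.
    have se : (A * A * e)^-1 <= s by near: s; apply: nbhs_pinfty_ge; rewrite num_real.
    have q : 0 < A * (1 + s * A) by rewrite mulr_gt0// ltr_pwDl// mulr_ge0// ltW.
    rewrite ger0_norm ?invr_ge0 ?(ltW q)//.
    rewrite -[e]invrK lef_pV2 ?posrE ?invr_gt0//.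
    have AA : 0 < A * A by rewrite mulr_gt0.
    have := ler_wpM2l (ltW AA) se; rewrite invfM mulrA divff ?gt_eqF// mul1r.
    by lra.
  - by move=> s s0; case: (dF s (ltW s0)).
  - apply: cvg_at_right_filter; apply: differentiable_continuous.
    by apply/derivable1_diffP; case: (dF 0 (lexx _)).
  - move=> s; rewrite in_itv /= andbT => s0; rewrite derive1E.
    by case: (dF s (ltW s0)).
split=> //; apply/integrableP; split; first exact/measurable_EFinP.
apply: le_lt_trans (ltry (A^-1)); apply: le_trans le.
by under eq_integral do rewrite /= ger0_norm//.
Unshelve. all: by end_near. Qed.

Lemma pow_expN_bounded (l : R) : 0 < l -> exists C : R, 0 <= C /\
  forall s : R, 0 <= s -> (1 + s) ^+ 5 * expR (- (l * s)) <= C.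
Proof.
move=> l0; pose k := 1 + l^-1.
have k0 : 0 < k by rewrite /k ltr_pwDl// invr_ge0 ltW.
exists (k ^+ 5 * (120 * expR 1)); split.
  by rewrite !mulr_ge0 ?exprn_ge0 ?expR_ge0 ?(ltW k0).
move=> s s0; have x0 : 0 <= l * s by rewrite mulr_ge0// ltW.
have h := expR_pow5 x0.
have h1 : 1 + s <= k * (1 + l * s).
  have -> : k * (1 + l * s) = 1 + s + l^-1 + l * s.
    by rewrite /k; field; rewrite gt_eqF.
  have : 0 < l^-1 by rewrite invr_gt0.
  by move=> li; lra.
have h2 : (1 + s) ^+ 5 <= (k * (1 + l * s)) ^+ 5.
  by apply: lerXn2r => //; rewrite nnegrE; [lra|rewrite mulr_ge0 ?(ltW k0)//; lra].
have e0 := expR_gt0 (- (l * s)).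
apply: le_trans (ler_wpM2r (ltW e0) h2) _.
rewrite exprMn -mulrA; apply: ler_wpM2l; first by rewrite exprn_ge0// ltW.
apply: le_trans (ler_wpM2r (ltW e0) h) _.
have eE : expR (l * s) * expR (- (l * s)) = 1 by rewrite -expRD subrr expR0.
by rewrite -[leLHS]mulrA eE mulr1.
Qed.

(** With [l = A + B], [k exp (- l k)] has the primitive [- (k / l + l^-2) exp (- l k)], and
    [k^2 exp (- l k)] has [- (k^2 / l + 2 k / l^2 + 2 / l^3) exp (- l k)]. The integral is [- S 0],
    where only the constant terms of [P] are left. *)
Lemma laplace_pexp (a : R) (A B : R[i]) :
  0 < complex.Re A -> 0 < complex.Re B ->
  let f (s : R) := A * cexp ((- s)%:C * A) * pexp a (s%:C * B) in
  cintegrable mu (fun s => if s \in (`]0%R, +oo[%classic : set R) then f s else 0) ->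
  cintegral `]0, +oo[ f = ratio a (B / A).
Proof.
move=> A0 B0 f fi; pose l := A + B.
have l0 : 0 < complex.Re l by rewrite cReD addr_gt0.
have neq0 (z : R[i]) : 0 < complex.Re z -> z != 0.
  by move=> z0; apply/eqP => e; rewrite e ltxx in z0.
have An := neq0 _ A0; have ln := neq0 _ l0.
pose P k : R[i] := a%:C * (1 - a%:C) * B * (l^-1 * k + l^-1 * l^-1) +
  a%:C ^+ 2 * B ^+ 2 * (l^-1 * (k * k) + 2 * (l^-1 * l^-1) * k + 2 * (l^-1 * l^-1 * l^-1)).
pose S k : R[i] := - A * (P k * cexp (- l * k)).
pose S1 k : R[i] := A * ((a%:C * (1 - a%:C) * (k * B) + a%:C ^+ 2 * (k * B * (k * B))) *
  cexp (- l * k)).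
have fE (s : R) : f s = S1 s%:C.
  rewrite /f /S1 /pexp.
  have -> : cexp (- l * s%:C) = cexp ((- s)%:C * A) * cexp ((-1)%:C * (s%:C * B)).
    by rewrite -cexpD; congr cexp; rewrite /l !rmorphN rmorph1 /=; ring.
  by ring.
have dS k : cdiff S (S1 k) k.
  have h := cdiffZ (- A) (cdiffM (cdiffD
    (cdiffZ (a%:C * (1 - a%:C) * B) (cdiffD (cdiffZ l^-1 (cdiff_id k)) (cdiff_cst (l^-1 * l^-1) k)))
    (cdiffZ (a%:C ^+ 2 * B ^+ 2) (cdiffD (cdiffD
      (cdiffZ l^-1 (cdiffM (cdiff_id k) (cdiff_id k)))
      (cdiffZ (2 * (l^-1 * l^-1)) (cdiff_id k))) (cdiff_cst (2 * (l^-1 * l^-1 * l^-1)) k))))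
    (cdiff_cexp (- l) k)).
  apply: (cdiff_deriv_eq h); rewrite /S1; move: (cexp _) => e; field; exact: ln.
have dS1 k : exists f1, cdiff S1 f1 k.
  eexists; apply: cdiffZ; apply: cdiffM; last exact: cdiff_cexp.
  apply: cdiffD; apply: cdiffZ.
    by apply: cdiffM; [exact: cdiff_id|exact: cdiff_cst].
  by apply: cdiffM; (apply: cdiffM; [exact: cdiff_id|exact: cdiff_cst]).
have [C [C0 HC]] := pow_expN_bounded l0.
pose c1 := cmod (a%:C * (1 - a%:C) * B); pose c2 := cmod (a%:C ^+ 2 * B ^+ 2).
pose m := cmod l^-1.
have m0 : 0 <= m := cmod_ge0 _.
pose M := c1 * (m + m * m) + c2 * (m + 2 * (m * m) + 2 * (m * m * m)).
have M0 : 0 <= M by rewrite /M addr_ge0 ?mulr_ge0 ?addr_ge0 ?mulr_ge0 ?cmod_ge0.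
have S_decay (s : R) : 0 <= s -> cmod (S s%:C) * s <= cmod A * (M * C).
  move=> s0; rewrite /S cmodM cmodN -mulrA ler_wpM2l ?cmod_ge0//.
  rewrite cmodM cmod_cexp [- l * _]mulrC cReZ cReN mulrN [s * _]mulrC.
  have e0 := expR_gt0 (- (complex.Re l * s)).
  have s1 : 1 <= 1 + s by lra.
  have P1 : cmod (P s%:C) <= M * (1 + s) ^+ 2.
    have t1 : cmod (l^-1 * s%:C + l^-1 * l^-1) <= (m + m * m) * (1 + s) ^+ 2.
      apply: le_trans (cmodD _ _) _; rewrite cmodM cmodM cmodR ger0_norm// -/m.
      have : 0 <= m * m by rewrite mulr_ge0.
      by rewrite expr2; nra.
    have t2 : cmod (l^-1 * (s%:C * s%:C) + 2 * (l^-1 * l^-1) * s%:C + 2 * (l^-1 * l^-1 * l^-1))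
        <= (m + 2 * (m * m) + 2 * (m * m * m)) * (1 + s) ^+ 2.
      apply: le_trans (cmodD _ _) _; apply: le_trans (lerD (cmodD _ _) (lexx _)) _.
      have -> : cmod (l^-1 * (s%:C * s%:C)) = m * (s * s).
        by rewrite cmodM -rmorphM cmodR ger0_norm// mulr_ge0.
      have c2E : cmod (2 : R[i]) = 2 by rewrite -(rmorph_nat (real_complex R) 2) cmodR ger0_norm.
      have -> : cmod (2 * (l^-1 * l^-1) * s%:C) = 2 * (m * m) * s.
        by rewrite cmodM cmodM c2E cmodM cmodR ger0_norm.
      have -> : cmod (2 * (l^-1 * l^-1 * l^-1)) = 2 * (m * m * m).
        by rewrite cmodM c2E cmodM cmodM.
      have m2 : 0 <= m * m by rewrite mulr_ge0.
      have m3 : 0 <= m * m * m by rewrite mulr_ge0.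
      have ms : 0 <= m * s by rewrite mulr_ge0.
      have m2s : 0 <= m * m * s by rewrite mulr_ge0.
      have m2ss : 0 <= m * m * (s * s) by rewrite !mulr_ge0.
      have m3s : 0 <= m * m * m * s by rewrite mulr_ge0.
      have m3ss : 0 <= m * m * m * (s * s) by rewrite !mulr_ge0.
      by rewrite expr2; lra.
    rewrite /P /M; apply: le_trans (cmodD _ _) _; rewrite [leRHS]mulrDl; apply: lerD.
      by rewrite cmodM -/c1 -[leRHS]mulrA ler_wpM2l ?cmod_ge0.
    by rewrite cmodM -/c2 -[leRHS]mulrA ler_wpM2l ?cmod_ge0.
  apply: (@le_trans _ _ (M * (1 + s) ^+ 2 * (expR (- (complex.Re l * s)) * (1 + s) ^+ 3))).
    rewrite -mulrA; apply: ler_pM => //; rewrite ?cmod_ge0//.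
      by rewrite mulr_ge0// ltW.
    rewrite ler_pM2l//; apply: (@le_trans _ _ (1 + s)); first by lra.
    by rewrite !exprS expr0 mulr1 ler_peMr//; [lra|nra].
  have -> : M * (1 + s) ^+ 2 * (expR (- (complex.Re l * s)) * (1 + s) ^+ 3) =
    M * ((1 + s) ^+ 5 * expR (- (complex.Re l * s))) by ring.
  by rewrite ler_wpM2l// HC.
have ffE : f = (fun s => S1 s%:C) by apply/funext.
rewrite ffE (@cint_FTC_halfline _ (fun s => S s%:C) _ (cmod A * (M * C))).
- rewrite /S /P /ratio rmorph0 !mulr0 cexp0 /l.
  have An' : A + B != 0 := ln.
  have r1 : 1 + B / A != 0 by rewrite -[1](divff An) -mulrDl mulf_neq0// invr_neq0.
  field; rewrite An' An /=.
  by [].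
- by apply: cderive_real => s; exact: dS.
(* Continuity of [S1] is drawn from its differentiability; a derivative function is picked by
   choice. *)
- have [g hg] := boolp.choice (fun y : R => dS1 y%:C).
  apply: (@cderive_ccontinuous _ _ g); have := @cderive_real R S1 (fun k => g (complex.Re k)).
  by apply => y; exact: hg.
- by move: fi; rewrite ffE.
- exact: S_decay.
Qed.

End Laplace.

Section ProductSigmaFinite.
Local Open Scope ereal_scope.
Context d1 d2 (T1 : measurableType d1) (T2 : measurableType d2) {R : realType}.
Variables (m1 : {sigma_finite_measure set T1 -> \bar R})
  (m2 : {sigma_finite_measure set T2 -> \bar R}).

(* On [\x] itself canonical inference only finds the instance for
   subprobabilities, hence this alias. *)
Definition prod_measure : set (T1 * T2) -> \bar R := m1 \x m2.

HB.instance Definition _ := Measure.on prod_measure.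

(** The rectangles over two increasing exhaustions cover: by monotonicity the larger of two indices
    catches both coordinates. *)
Let prod_measure_sigma_finite : sigma_finite setT prod_measure.
Proof.
have /sigma_finiteP[F [TF ndF Foo]] := sigma_finiteT m1.
have /sigma_finiteP[G [TG ndG Goo]] := sigma_finiteT m2.
exists (fun n => F n `*` G n).
  rewrite -setXTT TF TG; apply/seteqP; split=> -[x y]; last first.
    by move=> [n _ []/= ? ?]; split; exists n.
  move=> [/= [n _ Fnx] [k _ Gky]]; exists (maxn n k) => //; split.
    by move: x Fnx; exact/subsetPset/ndF/leq_maxl.
  by move: y Gky; exact/subsetPset/ndG/leq_maxr.
move=> k; have [mF Fk] := Foo k; have [mG Gk] := Goo k.
split; first exact: measurableX.
by rewrite /prod_measure product_measure1E// lte_mul_pinfty// ge0_fin_numE.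
Qed.

HB.instance Definition _ := Measure_isSigmaFinite.Build _ _ _ prod_measure
  prod_measure_sigma_finite.

End ProductSigmaFinite.

(** * Fubini for the integral defining [psi] *)

Section Psi.
Context {R : realType}.
Local Notation mu := (@lebesgue_measure R).
Local Notation mu2 := (prod_measure mu mu).
Local Notation half := (`]0%R, +oo[%classic : set R).
Variables (c d a b t tau : R).
Hypotheses (c0 : 0 < c) (d0 : 0 < d) (a0 : 0 < a) (a1 : a < 1) (b0 : 0 < b) (b1 : b < 1).
Hypotheses (t0 : 0 < t) (tau0 : 0 < tau).

Definition invpi2i : R[i] := ((2 * pi)%:C * 'i)^-1.
Local Notation K := invpi2i.

Let A (y : R) : R[i] := (t `^ (- b))%:C * cpow (d +i* y) b.
Let B (y : R) : R[i] := cpow (c +i* y) a.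
Let F1 (s y : R) := K * gp d y * (A y * cexp ((- s)%:C * A y)).
Let F2 (s y : R) := K * gf c tau y * pexp a (s%:C * B y).
(** The triple integrand, in [s], the line of [phi] and the line of [f], extended by 0 to [s <= 0]
    so that Fubini takes place on the full space. *)
Let KI (q : R * (R * R)) : R[i] := (\1_half q.1)%:C * (F1 q.1 q.2.1 * F2 q.1 q.2.2).

Let tb0 : 0 < t `^ (- b).
Proof. exact: powR_gt0. Qed.

Let a2 : `|a| <= 2.
Proof. by rewrite gtr0_norm//; have := a1; lra. Qed.

Let b2 : `|b| <= 2.
Proof. by rewrite gtr0_norm//; have := b1; lra. Qed.

Let cmod_A y : cmod (A y) = t `^ (- b) * cmod (d +i* y) `^ b.
Proof. by rewrite cmodM cmodR gtr0_norm// cmod_cpow// line_neq0. Qed.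

Let cmod_B y : cmod (B y) = cmod (c +i* y) `^ a.
Proof. by rewrite cmod_cpow// line_neq0. Qed.

Let A_gt0 y : 0 < cmod (A y).
Proof. by rewrite cmod_A mulr_gt0// powR_gt0// cmod_line_gt0. Qed.

Let ReA y : 0 < complex.Re (A y).
Proof.
rewrite cReZ mulr_gt0//.
have := @cpow_Re_ge R b (d +i* y) b0 b1 d0; apply: lt_le_trans.
by rewrite mulr_gt0 ?cos_bpi_gt0// powR_gt0// cmod_line_gt0.
Qed.

Let ReB y : 0 < complex.Re (B y).
Proof.
have := @cpow_Re_ge R a (c +i* y) a0 a1 c0; apply: lt_le_trans.
by rewrite mulr_gt0 ?cos_bpi_gt0// powR_gt0// cmod_line_gt0.
Qed.

Let mA : cmeasurable A.
Proof. by apply: cmeasurableM; [exact: cmeasurable_cst|exact: cmeasurable_cpow_line]. Qed.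

Let mB : cmeasurable B.
Proof. exact: cmeasurable_cpow_line. Qed.

Let mF1 s : cmeasurable (F1 s).
Proof.
apply: cmeasurableM.
  by apply: cmeasurableM; [exact: cmeasurable_cst|exact: cmeasurable_gp].
apply: cmeasurableM => //; apply: cmeasurable_cexp.
by apply: cmeasurableM => //; exact: cmeasurable_cst.
Qed.

Let mF2 s : cmeasurable (F2 s).
Proof.
apply: cmeasurableM.
  by apply: cmeasurableM; [exact: cmeasurable_cst|exact: cmeasurable_gf].
by apply: cmeasurable_pexp; apply: cmeasurableM => //; exact: cmeasurable_cst.
Qed.

Let half_gt0 s : s \in half -> 0 < s.
Proof. by rewrite inE /= in_itv /= andbT. Qed.

Let exp_bound : exists C : R, 0 < C /\ forall s y, 0 < s ->
  cmod (cexp ((- s)%:C * A y)) <= C / (1 + s * cmod (A y)) ^+ 3.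
Proof.
have p0 := pi_gt0 R.
have e0 : 0 <= b * (pi / 2) by rewrite mulr_ge0 ?(ltW b0) ?divr_ge0 ?(ltW p0).
have e1 : b * (pi / 2) < pi / 2 by have := b1; nra.
have [C [dlt [C0 _ _ H]]] := quad_cexp_decay (ltr01 : 0 < 1 :> R) e0 e1.
exists C; split=> // s y s0.
have ss : insec (b * (pi / 2)) (s%:C * A y).
  have h := insecM (insec_real s0) (insecM (insec_real tb0)
    (@insec_cpow_Re_gt0 R (d +i* y) b d0)).
  by rewrite gtr0_norm// !add0r in h.
have := quad_cmod (H _ ss).
rewrite [cmod (s%:C * A y)]cmodM cmodR gtr0_norm//.
by rewrite mulrA -rmorphM mulN1r.
Qed.

Let pexp_bd : exists C : R, 0 < C /\ forall s y, 0 < s ->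
  cmod (pexp a (s%:C * B y)) <= C * bump (s * cmod (B y)).
Proof.
have ab : `|a| * (pi / 2) < pi / 2.
  by rewrite gtr0_norm//; have := pi_gt0 R; have := a1; nra.
have [C [C0 H]] := sectorial_cpow_bound (sectorial_pexp a) ab.
by exists C; split=> // s y s0; rewrite cmod_B; exact: (H s (c +i* y) s0 c0).
Qed.

Let iw : mu.-integrable setT (EFin \o (fun y => cmod (d +i* y) `^ (- 1 - b))).
Proof. exact: line_pow_integrable. Qed.

Let iz : mu.-integrable setT (EFin \o (fun y => cmod (c +i* y) `^ (- 1 - (1 - a)))).
Proof. by apply: line_pow_integrable => //; rewrite subr_gt0. Qed.

Let iz2 : mu.-integrable setT (EFin \o (fun y => cmod (c +i* y) `^ (- 1 - 1))).
Proof. exact: line_pow_integrable. Qed.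

Let gpA y : cmod (K * gp d y) / cmod (A y) =
  (cmod K * expR d / t `^ (- b)) * cmod (d +i* y) `^ (- 1 - b).
Proof.
have m0 := cmod_line_gt0 d0 y.
rewrite cmodM cmod_gp cmod_A powRB; last by rewrite (gt_eqF m0) implybT.
by rewrite powR_inv1 ?(ltW m0)//; field; rewrite !gt_eqF// powR_gt0.
Qed.

Let gfB y : cmod (K * gf c tau y) * cmod (B y) =
  (cmod K * (expR (tau * c) * tau ^- 2)) * cmod (c +i* y) `^ (- 1 - (1 - a)).
Proof.
have m0 := cmod_line_gt0 c0 y.
rewrite cmodM cmod_gf// cmod_B -!mulrA -powRD; last by rewrite (gt_eqF m0) implybT.
by congr (_ * (_ * (_ * _ `^ _))); ring.
Qed.

Let gfE y : cmod (K * gf c tau y) =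
  (cmod K * (expR (tau * c) * tau ^- 2)) * cmod (c +i* y) `^ (- 1 - 1).
Proof. by rewrite cmodM cmod_gf// -!mulrA. Qed.

(** The cubic decay of [exp (- s A)] compensates the factor [|A|] and leaves [s^-2 / |A|], which
    [gpA] makes integrable against [gp]. The bound degenerates as [s] tends to 0 and serves for
    single sections only. *)
Let F1_dom s : 0 < s -> exists2 u : R -> R, mu.-integrable setT (EFin \o u) &
  forall y, cmod (F1 s y) <= u y.
Proof.
move=> s0; have [C [C0 H]] := exp_bound.
exists (fun y => C * s ^- 2 * (cmod K * expR d / t `^ (- b)) *
  cmod (d +i* y) `^ (- 1 - b)); first exact: (integrable_scale _ iw).
move=> y; rewrite -[leRHS]mulrA -gpA /F1 cmodM [leRHS]mulrCA.
apply: ler_wpM2l; first exact: cmod_ge0.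
have h := H s y s0; have A0 := A_gt0 y; rewrite cmodM; set m := cmod (A y) in h A0 *.
have sA : 0 < s * m by rewrite mulr_gt0.
apply: le_trans (ler_wpM2l (ltW A0) h) _.
rewrite mulrA ler_pdivrMr ?exprn_gt0//; last by lra.
have -> : C * s ^- 2 / m * (1 + s * m) ^+ 3 = C * m * ((1 + s * m) ^+ 3 / (s * m) ^+ 2).
  by field; rewrite !gt_eqF.
rewrite [m * C]mulrC ler_peMr ?mulr_ge0 ?(ltW C0) ?(ltW A0)//.
rewrite ler_pdivlMr ?exprn_gt0// mul1r !expr2 !exprS expr0 mulr1.
by nra.
Qed.

Let F2_dom s : 0 < s -> exists2 u : R -> R, mu.-integrable setT (EFin \o u) &
  forall y, cmod (F2 s y) <= u y.
Proof.
move=> s0; have [C [C0 H]] := pexp_bd.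
exists (fun y => C * (cmod K * (expR (tau * c) * tau ^- 2)) *
  cmod (c +i* y) `^ (- 1 - 1)); first exact: (integrable_scale _ iz2).
move=> y; rewrite -[leRHS]mulrA -gfE /F2 cmodM [leRHS]mulrC.
apply: ler_wpM2l; first exact: cmod_ge0.
apply: le_trans (H s y s0) _; rewrite ler_piMr ?(ltW C0)// bump_le1//.
by rewrite mulr_ge0 ?cmod_ge0 ?(ltW s0).
Qed.

(** [bump r <= r] turns the bound of [pexp] into [s |B|], and [s |A| <= 1 + s |A|] absorbs this [s]
    together with the factor [|A|] into one power of the cubic decay of [exp (- s A)]. What remains
    is integrable in [s]. *)
Let inner_bound : exists C : R, 0 < C /\ forall s y z, 0 < s ->
  cmod (A y * cexp ((- s)%:C * A y) * pexp a (s%:C * B z)) <=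
  C * cmod (B z) * (1 + `|s| * cmod (A y)) ^- 2.
Proof.
have [C1 [C10 H1]] := exp_bound; have [C2 [C20 H2]] := pexp_bd.
exists (C1 * C2); split; first by rewrite mulr_gt0.
move=> s y z s0; rewrite gtr0_norm// cmodM cmodM.
have h1 := H1 s y s0.
have h2 : cmod (pexp a (s%:C * B z)) <= C2 * (s * cmod (B z)).
  apply: le_trans (H2 s z s0) _; rewrite ler_pM2l// bump_le//.
  by rewrite mulr_ge0 ?cmod_ge0 ?(ltW s0).
have A0 := A_gt0 y; set m := cmod (A y) in h1 A0 *.
have sA : 0 < s * m by rewrite mulr_gt0.
apply: (@le_trans _ _ (m * (C1 / (1 + s * m) ^+ 3) * (C2 * (s * cmod (B z))))).
  apply: ler_pM => //; rewrite ?mulr_ge0 ?cmod_ge0 ?(ltW A0)//.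
  by apply: ler_wpM2l => //; exact: ltW.
have -> : m * (C1 / (1 + s * m) ^+ 3) * (C2 * (s * cmod (B z))) =
  C1 * C2 * cmod (B z) * (1 + s * m) ^- 2 * ((s * m) / (1 + s * m)).
  by field; rewrite gt_eqF//; lra.
rewrite ler_piMr//; last by rewrite ler_pdivrMr; lra.
by rewrite !mulr_ge0 ?cmod_ge0 ?(ltW C10) ?(ltW C20)// invr_ge0 exprn_ge0//; lra.
Qed.

Let mKI : cmeasurable KI.
Proof.
have mfst : measurable_fun setT (fun q : R * (R * R) => q.1) by exact: measurable_fst.
have msnd : measurable_fun setT (fun q : R * (R * R) => q.2) by exact: measurable_snd.
have m1 : measurable_fun setT (fun q : R * (R * R) => q.2.1).
  exact: (measurableT_comp measurable_fst msnd).
have m2 : measurable_fun setT (fun q : R * (R * R) => q.2.2).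
  exact: (measurableT_comp measurable_snd msnd).
have mA' : cmeasurable (fun q : R * (R * R) => A q.2.1) := cmeasurable_comp mA m1.
have mB' : cmeasurable (fun q : R * (R * R) => B q.2.2) := cmeasurable_comp mB m2.
apply: cmeasurableM.
  apply: cmeasurable_real.
  have mi : measurable_fun setT (\1_half : R -> R).
    by apply: measurable_indic; exact: measurable_itv.
  exact: (measurableT_comp mi mfst).
apply: cmeasurableM.
  apply: cmeasurableM.
    apply: cmeasurableM; first exact: cmeasurable_cst.
    exact: (cmeasurable_comp (cmeasurable_gp d) m1).
  apply: cmeasurableM => //; apply/cmeasurable_cexp/cmeasurableM => //.
  by apply: cmeasurable_real; exact: measurableT_comp mfst.
apply: cmeasurableM.
  apply: cmeasurableM; first exact: cmeasurable_cst.
  exact: (cmeasurable_comp (cmeasurable_gf c tau) m2).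
by apply: cmeasurable_pexp; apply: cmeasurableM.
Qed.

(** Integrating [inner_bound] in [s] by [halfline_inv_sqr] leaves [|gp| / |A|] times [|gf| |B|], of
    orders [|w|^(-1 - b)] and [|z|^(a - 2)]: integrable since [b > 0] and [a < 1]. *)
Let iKI : cintegrable (mu \x mu2)%E KI.
Proof.
have [C [C0 H]] := inner_bound.
pose Dm (q : R * (R * R)) : R := \1_half q.1 * (1 + `|q.1| * cmod (A q.2.1)) ^- 2 *
  (cmod (K * gp d q.2.1) * (C * (cmod (K * gf c tau q.2.2) * cmod (B q.2.2)))).
have Dm0 q : 0 <= Dm q.
  have h0 : 0 <= 1 + `|q.1| * cmod (A q.2.1) by rewrite addr_ge0// mulr_ge0 ?cmod_ge0.
  rewrite /Dm !mulr_ge0 ?cmod_ge0 ?(ltW C0) ?invr_ge0 ?exprn_ge0 ?indicE ?ler0n//.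
have KD q : cmod (KI q) <= Dm q.
  have := Dm0 q; rewrite /KI /Dm indicE.
  case: (boolP (q.1 \in half)) => [/half_gt0 s0 _|_ _]; last by rewrite !mul0r cmod0.
  rewrite !mul1r.
  have -> : F1 q.1 q.2.1 * F2 q.1 q.2.2 = (K * gp d q.2.1) * (K * gf c tau q.2.2) *
     (A q.2.1 * cexp ((- q.1)%:C * A q.2.1) * pexp a (q.1%:C * B q.2.2)).
    by rewrite /F1 /F2; ring.
  rewrite cmodM cmodM.
  have h := ler_wpM2l (mulr_ge0 (cmod_ge0 (K * gp d q.2.1)) (cmod_ge0 (K * gf c tau q.2.2)))
    (H q.1 q.2.1 q.2.2 s0).
  apply: (le_trans h); rewrite le_eqVlt; apply/orP; left; apply/eqP; ring.
have mD : measurable_fun setT Dm.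
  have mfst : measurable_fun setT (fun q : R * (R * R) => q.1) by exact: measurable_fst.
  have msnd : measurable_fun setT (fun q : R * (R * R) => q.2) by exact: measurable_snd.
  have m1 : measurable_fun setT (fun q : R * (R * R) => q.2.1).
    exact: (measurableT_comp measurable_fst msnd).
  have m2 : measurable_fun setT (fun q : R * (R * R) => q.2.2).
    exact: (measurableT_comp measurable_snd msnd).
  have mA' := measurable_cmod (cmeasurable_comp mA m1).
  have mB' := measurable_cmod (cmeasurable_comp mB m2).
  have mg1 : measurable_fun setT (fun q : R * (R * R) => cmod (K * gp d q.2.1)).
    apply: measurable_cmod; apply: cmeasurableM; first exact: cmeasurable_cst.
    exact: (cmeasurable_comp (cmeasurable_gp d) m1).
  have mg2 : measurable_fun setT (fun q : R * (R * R) => cmod (K * gf c tau q.2.2)).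
    apply: measurable_cmod; apply: cmeasurableM; first exact: cmeasurable_cst.
    exact: (cmeasurable_comp (cmeasurable_gf c tau) m2).
  have mi : measurable_fun setT (\1_half : R -> R).
    by apply: measurable_indic; exact: measurable_itv.
  apply: measurable_funM; last first.
    apply: measurable_funM => //; apply: measurable_funM; first exact: measurable_cst.
    exact: measurable_funM.
  apply: measurable_funM; first exact: (measurableT_comp mi mfst).
  have e (q : R * (R * R)) : (1 + `|q.1| * cmod (A q.2.1)) ^- 2 =
      ((1 + `|q.1| * cmod (A q.2.1)) ^+ 2) `^ (-1).
    by rewrite powR_inv1// sqr_ge0.
  under eq_fun do rewrite e.
  apply: (measurableT_comp (@measurable_powR R (-1))).
  apply: measurable_funX; apply: measurable_funD; first exact: measurable_cst.
  by apply: measurable_funM => //; exact: measurableT_comp mfst.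
apply: (@cintegrable_dom _ _ _ (mu \x mu2)%E KI Dm mKI _ KD).
pose u y := C * (cmod K * expR d / t `^ (- b)) * cmod (d +i* y) `^ (- 1 - b).
pose v y := (cmod K * (expR (tau * c) * tau ^- 2)) * cmod (c +i* y) `^ (- 1 - (1 - a)).
have u0 y : 0 <= u y.
  by rewrite /u !mulr_ge0 ?(ltW C0) ?cmod_ge0 ?expR_ge0 ?powR_ge0 ?invr_ge0 ?powR_ge0.
have v0 y : 0 <= v y by rewrite /v -gfB mulr_ge0 ?cmod_ge0.
have iu : mu.-integrable setT (EFin \o u) by exact: (integrable_scale _ iw).
have iv : mu.-integrable setT (EFin \o v) by exact: (integrable_scale _ iz).
have [] // := @integrable_tonelli21 _ _ _ _ R mu mu2 Dm (fun p => u p.1 * v p.2) mD Dm0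
  (@integrable_tensor _ _ _ _ R mu mu u v u0 v0 iu iv).
move=> p; have [hi hle] := halfline_inv_sqr (A_gt0 p.1).
pose k := cmod (K * gp d p.1) * (C * (cmod (K * gf c tau p.2) * cmod (B p.2))).
have k0 : 0 <= k by rewrite /k !mulr_ge0 ?cmod_ge0 ?(ltW C0).
rewrite /Dm /= -/k; under eq_integral do rewrite EFinM muleC.
rewrite (@integralZl _ _ _ mu _ measurableT _ hi k).
apply: (@le_trans _ _ (k%:E * ((cmod (A p.1))^-1)%:E)%E).
  by apply: lee_wpmul2l; rewrite ?lee_fin.
rewrite -EFinM lee_fin /u /v -gfB -[C * _ * _]mulrA -gpA /k.
by rewrite le_eqVlt; apply/orP; left; apply/eqP; ring.
Qed.

(** The order of integration that gives back the product of the two kernels at [s]. *)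
Let sec1 s : cintegrable mu2 (fun p => KI (s, p)) /\ cint mu2 (fun p => KI (s, p)) =
  if s \in half then cint mu (F1 s) * cint mu (F2 s) else 0.
Proof.
rewrite /KI /=; case: ifPn => [sh|sh].
  have s0 := half_gt0 sh; have [u iu Hu] := F1_dom s0; have [v iv Hv] := F2_dom s0.
  have [h1 h2] := @cint_tensor _ _ _ _ R mu mu _ _ u v (mF1 s) (mF2 s) iu iv Hu Hv.
  have -> : (fun p : R * R => (\1_half s)%:C * (F1 s p.1 * F2 s p.2)) =
      (fun p => F1 s p.1 * F2 s p.2).
    by apply/funext => p; rewrite indicE sh mul1r.
  by split.
have -> : (fun p : R * R => (\1_half s)%:C * (F1 s p.1 * F2 s p.2)) = (fun=> 0).
  by apply/funext => p; rewrite indicE (negPf sh) mul0r.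
split; last by apply: complexP; rewrite /= /Rintegral integral0.
by split; exact: integrable0.
Qed.

(** The other order, in which the integral over [s] is the Laplace transform of [laplace_pexp]. *)
Let sec2 p : cintegrable mu (fun s => KI (s, p)) /\ cint mu (fun s => KI (s, p)) =
  (K * gp d p.1) * (K * gf c tau p.2) * ratio a (B p.2 / A p.1).
Proof.
have [C [C0 H]] := inner_bound.
pose f s := A p.1 * cexp ((- s)%:C * A p.1) * pexp a (s%:C * B p.2).
have [hi _] := halfline_inv_sqr (A_gt0 p.1).
have mf : cmeasurable f.
  apply: cmeasurableM.
    apply: cmeasurableM; first exact: cmeasurable_cst.
    apply/cmeasurable_cexp/cmeasurableM; last exact: cmeasurable_cst.
    by apply: cmeasurable_real; apply: measurable_funN; exact: measurable_id.
  apply: cmeasurable_pexp; apply: cmeasurableM; last exact: cmeasurable_cst.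
  exact: cmeasurable_real.
have fE : (fun s => if s \in half then f s else 0) = (fun s => (\1_half s)%:C * f s).
  by apply/funext => s; rewrite indicE; case: ifP; rewrite ?mul1r ?mul0r.
have iF : cintegrable mu (fun s => if s \in half then f s else 0).
  rewrite fE; apply: (@cintegrable_dom _ _ _ mu _ _ _ (integrable_scale (C * cmod (B p.2)) hi)).
    apply: cmeasurableM => //; apply: cmeasurable_real.
    by apply: measurable_indic; exact: measurable_itv.
  move=> s; rewrite cmodM cmodR indicE; case: (boolP (s \in half)) => [/half_gt0 s0|_].
    by rewrite normr1 !mul1r; exact: H.
  by rewrite mulr0n normr0 !mul0r mulr0.
have KE : (fun s => KI (s, p)) = (fun s => (K * gp d p.1) * (K * gf c tau p.2) *
    (if s \in half then f s else 0)).
  apply/funext => s; rewrite /KI /= indicE; case: ifP => _.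
    by rewrite mul1r /F1 /F2 /f; ring.
  by rewrite mul0r mulr0.
rewrite KE; split; first exact: cintegrableZ.
by rewrite (cintZ _ iF) -cintegralE (laplace_pexp (ReA p.1) (ReB p.2) iF).
Qed.

Definition psi_weight (p : R * R) := (K * gp d p.1) * (K * gf c tau p.2).

Definition psi_phase (p : R * R) := cpow (c +i* p.2) a * cpow (d +i* p.1) (- b).

(** The two orders of integration of [KI] agree by [iKI]; the quotient [B / A] is [t^b z^a w^-b], so
    that [t] occurs as a power only. *)
Lemma psi_kernel_ratio : psi_kernel c d a b t tau =
  cint mu2 (fun p => psi_weight p * ratio a (cpow t%:C b * psi_phase p)).
Proof.
rewrite /psi_kernel lt_eqF// lt_eqF// cintegralE.
transitivity (cint mu (fun s => cint mu2 (fun p => KI (s, p)))).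
  apply: eq_cint => s; have [_ ->] := sec1 s; case: ifPn => // sh.
  have s0 := half_gt0 sh.
  have iF1 : cintegrable mu (fun y => gp d y * (A y * cexp ((- s)%:C * A y))).
    have [u iu Hu] := F1_dom s0.
    have := cintegrableZ K^-1 (@cintegrable_dom _ _ _ mu _ u (mF1 s) iu Hu).
    rewrite (_ : (fun x => _) = (fun y => gp d y * (A y * cexp ((- s)%:C * A y))))//.
    apply/funext => y; rewrite /F1 -mulrA mulKf// /K invr_neq0// mulf_neq0//.
      by rewrite -cmod_eq0 cmodR normr_eq0 mulf_neq0// gt_eqF// pi_gt0.
    by rewrite -cmod_eq0 cmodi oner_eq0.
  have iF2 : cintegrable mu (fun y => gf c tau y * pexp a (s%:C * B y)).
    have [u iu Hu] := F2_dom s0.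
    have := cintegrableZ K^-1 (@cintegrable_dom _ _ _ mu _ u (mF2 s) iu Hu).
    rewrite (_ : (fun x => _) = (fun y => gf c tau y * pexp a (s%:C * B y)))//.
    apply/funext => y; rewrite /F2 -mulrA mulKf// /K invr_neq0// mulf_neq0//.
      by rewrite -cmod_eq0 cmodR normr_eq0 mulf_neq0// gt_eqF// pi_gt0.
    by rewrite -cmod_eq0 cmodi oner_eq0.
  rewrite (phi_kernel_dilated d0 b0 b1 t0 s0) (f_kernel_pexp c0 a0 a1 s0 tau0).
  by congr (_ * _); rewrite -cintZ//; apply: eq_cint => y; rewrite mulrA.
rewrite -(@cint_prod12 _ _ _ _ _ mu mu2 KI iKI); last by move=> s; case: (sec1 s).
rewrite (@cint_prod21 _ _ _ _ _ mu mu2 KI iKI); last by move=> p; case: (sec2 p).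
apply: eq_cint => p; have [_ ->] := sec2 p; congr (_ * ratio a _).
rewrite /A /B /psi_phase cpow_real// cpowN powRN.
have -> : (t `^ b)^-1%:C = ((t `^ b)%:C)^-1 :> R[i] by rewrite fmorphV.
have tbn : (t `^ b)%:C != 0 :> R[i] by rewrite -cmod_eq0 cmodR normr_eq0 gt_eqF// powR_gt0.
by field; rewrite tbn cpow_neq0.
Qed.

End Psi.

(** * The extension *)

Section BumpBounded.
Context d (T : measurableType d) {R : realType} (mu : {measure set T -> \bar R}).
Implicit Types (g e : T -> R[i]) (P : R[i] -> R[i]).

Lemma measurable_bump (f : T -> R) : measurable_fun setT f ->
  measurable_fun setT (fun x => bump (f x)).
Proof.
move=> mf; have e x : bump (f x) = f x * ((1 + f x) ^+ 2) `^ (-1).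
  by rewrite powR_inv1// sqr_ge0.
under eq_fun do rewrite e.
apply: measurable_funM => //; apply: (measurableT_comp (@measurable_powR R (-1))).
by apply: measurable_funX; apply: measurable_funD => //; exact: measurable_cst.
Qed.

Lemma measurable_mul_bump g e rho : cmeasurable g -> cmeasurable e ->
  measurable_fun setT (fun x => cmod (g x) * bump (rho * cmod (e x))).
Proof.
move=> mg me; apply: measurable_funM; first exact: measurable_cmod.
apply: measurable_bump; apply: measurable_funM; first exact: measurable_cst.
exact: measurable_cmod.
Qed.

Lemma bump_bounded_scale k g e : bump_bounded mu g e ->
  bump_bounded mu (fun x => k * g x) e.
Proof.
move=> [M HM]; exists (cmod k * M) => rho r0; have [i1 i2] := HM rho r0.
have E : (fun x => cmod (k * g x) * bump (rho * cmod (e x))) =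
    (fun x => cmod k * (cmod (g x) * bump (rho * cmod (e x)))).
  by apply/funext => x; rewrite cmodM mulrA.
rewrite E; split; last by rewrite RintegralZl// ler_wpM2l ?cmod_ge0.
have -> : (fun x => (cmod (k * g x) * bump (rho * cmod (e x)))%:E) =
    (fun x => (cmod k * (cmod (g x) * bump (rho * cmod (e x))))%:E).
  by apply/funext => x; rewrite cmodM mulrA.
exact: integrable_scale.
Qed.

Lemma bump_bounded_integrable g e : cmeasurable g -> cmeasurable e ->
  mu.-integrable setT (EFin \o (fun x => cmod (g x))) -> bump_bounded mu g e.
Proof.
move=> mg me ig; exists (\int[mu]_x cmod (g x))%R => rho r0.
have re x : 0 <= rho * cmod (e x) by rewrite mulr_ge0 ?cmod_ge0 ?(ltW r0).
have le x : cmod (g x) * bump (rho * cmod (e x)) <= cmod (g x).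
  by rewrite ler_piMr ?cmod_ge0 ?bump_le1.
have i1 : mu.-integrable setT
    (EFin \o (fun x => cmod (g x) * bump (rho * cmod (e x)))).
  apply: (@integrable_dom _ _ _ mu _ (fun x => cmod (g x))) => //.
    exact: measurable_mul_bump.
  by move=> x; rewrite ger0_norm; [exact: le|exact: mulr_ge0 (cmod_ge0 _) (bump_ge0 (re x))].
by split=> //; apply: le_Rintegral => // x _; exact: le.
Qed.

(** The constant [k] is put into the weight, so that the extension is a single transform; on the
    positive reals it is taken out again, by the integrability of the integrand at [t^a]. *)
Lemma transform_extension_real g e P (omega eta0 a th : R) (k : R[i]) :
  sectorial omega P -> (forall x, insec eta0 (e x)) ->
  cmeasurable g -> (forall w, cmeasurable (fun x => P (w * e x))) ->
  bump_bounded mu g e ->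
  a != 0 -> `|a| <= 2 -> 0 < th -> th <= pi / 2 -> `|a| * th + eta0 <= omega ->
  exists F : R[i] -> R[i],
    [/\ holomorphic_on (sector th) F,
        forall t : R, 0 < t ->
          F t%:C = k * cint mu (fun x => g x * P (cpow t%:C a * e x)) &
        forall theta, 0 < theta -> theta < th -> bounded_on (closed_sector theta) F].
Proof.
move=> sP se mg mP bb a0 a2 t0 t2 hO.
have mkg : cmeasurable (fun x => k * g x).
  by apply: cmeasurableM => //; exact: cmeasurable_cst.
have [h b] := transform_extension sP se mkg mP (bump_bounded_scale k bb) a0 a2 t2 hO.
eexists; split; [exact: h| |by move=> theta _; exact: b].
move=> t tp /=; rewrite -cintZ; first by apply: eq_cint => x; rewrite mulrA.
have lt_om : 0 + eta0 < omega.
  by apply: lt_le_trans hO; rewrite ltrD2r mulr_gt0 ?normr_gt0.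
have st : insec 0 (cpow t%:C a).
  by rewrite cpow_real//; apply: insec_real; exact: powR_gt0.
have [P1 HP] := sP; have [C [dlt [_ q]]] := HP _ lt_om; have [M HM] := bb.
have s0 : 0 < cmod (cpow t%:C a) by rewrite cmod_gt0 (insec_neq0 st).
have [i1 _] := HM _ s0.
apply: (cintegrable_dom _ (integrable_scale C i1)); first exact: cmeasurableM.
move=> x; rewrite cmodM mulrCA ler_wpM2l ?cmod_ge0// -cmodM.
exact: quad_cmod (q _ (insecM st (se x))).
Qed.

End BumpBounded.

(** For fixed [y] the factor [|e2 y|] merely changes [rho] into [rho |e2 y|], and the bound for [g1]
    and [e1] is uniform in that parameter; the integral of [|g2|] is all that remains. *)
Lemma bump_bounded_prod d1 d2 (T1 : measurableType d1) (T2 : measurableType d2)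
  (R : realType) (m1 : {sigma_finite_measure set T1 -> \bar R})
  (m2 : {sigma_finite_measure set T2 -> \bar R}) (g1 e1 : T1 -> R[i])
  (g2 e2 : T2 -> R[i]) :
  cmeasurable g1 -> cmeasurable e1 -> cmeasurable g2 -> cmeasurable e2 ->
  (forall y, 0 < cmod (e2 y)) -> bump_bounded m1 g1 e1 ->
  m2.-integrable setT (EFin \o (fun y => cmod (g2 y))) ->
  bump_bounded (prod_measure m1 m2) (fun p => g1 p.1 * g2 p.2)
    (fun p => e2 p.2 * e1 p.1).
Proof.
move=> mg1 me1 mg2 me2 e20 [M HM] ig2.
exists (\int[m2]_y (M * cmod (g2 y)))%R => rho r0.
pose D p := cmod (g1 p.1 * g2 p.2) * bump (rho * cmod (e2 p.2 * e1 p.1)).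
have mD : measurable_fun setT D.
  by apply: measurable_mul_bump; apply: cmeasurableM;
    apply: (cmeasurable_comp _ measurable_fst) || apply: (cmeasurable_comp _ measurable_snd).
have D0 p : 0 <= D p.
  by rewrite mulr_ge0 ?bump_ge0 ?mulr_ge0 ?cmod_ge0 ?(ltW r0).
apply: (@integrable_tonelli21 _ _ _ _ _ m1 m2 D _ mD D0).
  exact: (integrable_scale _ ig2).
move=> y; have rp : 0 < rho * cmod (e2 y) by rewrite mulr_gt0.
have [i1 leM] := HM _ rp.
have DE x : D (x, y) = cmod (g2 y) * (cmod (g1 x) * bump (rho * cmod (e2 y) * cmod (e1 x))).
  by rewrite /D /= cmodM cmodM mulrAC mulrC !mulrA.
under eq_integral do rewrite DE EFinM.
rewrite (@integralZl _ _ _ m1 _ measurableT _ i1 (cmod (g2 y))).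
rewrite [leRHS](_ : _ = ((cmod (g2 y))%:E * M%:E)%E); last by rewrite -EFinM mulrC.
apply: lee_wpmul2l; first by rewrite lee_fin cmod_ge0.
rewrite -[leLHS]fineK; last exact: integrable_fin_num i1.
by rewrite lee_fin.
Qed.

Section Lines.
Context {R : realType}.
Local Notation mu := (@lebesgue_measure R).

(** [gp] is of order [1 / |w|], not integrable by itself: convergence and uniformity in [rho] both
    come from [bump]. *)
Lemma bump_bounded_gp (d b : R) : 0 < d -> b != 0 ->
  bump_bounded mu (gp d) (fun y => cpow (d +i* y) b).
Proof.
move=> d0 b0; have [M HM] := bump_line d0 b0.
exists (expR d * M) => rho r0; have [i1 i2] := HM rho r0.
have E y : cmod (gp d y) * bump (rho * cmod (cpow (d +i* y) b)) =
    expR d * ((cmod (d +i* y))^-1 * bump (rho * cmod (d +i* y) `^ b)).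
  by rewrite cmod_gp (cmod_cpow _ (line_neq0 d0 y)) [RHS]mulrA.
split; first by under eq_fun do rewrite E; exact: integrable_scale.
by under eq_Rintegral do rewrite E; rewrite RintegralZl// ler_wpM2l ?expR_ge0.
Qed.

Lemma integrable_gf (c tau : R) : 0 < c -> 0 < tau ->
  mu.-integrable setT (EFin \o (fun y => cmod (gf c tau y))).
Proof.
move=> c0 tau0; rewrite (_ : (fun y => _) = (fun y =>
  expR (tau * c) * tau ^- 2 * cmod (c +i* y) `^ (-1 - 1))); last first.
  by apply/funext => y; rewrite cmod_gf.
by apply: integrable_scale; exact: line_pow_integrable.
Qed.

End Lines.

Section Theta0.
Context {R : realType} (a b : R).
Hypotheses (b0 : 0 < b) (ab : a + b < 2).

Lemma theta0_gt0 : 0 < theta0 a b.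
Proof.
have p0 := pi_gt0 R; rewrite lt_min; apply/andP; split; last by rewrite divr_gt0.
by rewrite divr_gt0 ?mulr_gt0//; have := ab; lra.
Qed.

Lemma theta0_le_pihalf : theta0 a b <= pi / 2.
Proof. by rewrite ge_min lexx orbT. Qed.

(** The inequality that [theta0] is made for. With [b = 1] or [a = 1], subtracting [pi / 2] gives
    the condition for [exp (- u)] to decay. *)
Lemma theta0_opening : b * theta0 a b + (a * (pi / 2) + b * (pi / 2)) <= pi.
Proof.
have h : theta0 a b <= (2 - a - b) * pi / (2 * b) by rewrite ge_min lexx.
have b2 : 0 < 2 * b by rewrite mulr_gt0.
by move: h; rewrite ler_pdivlMr//; lra.
Qed.

End Theta0.

(** * The three cases of the definition of [psi] *)

Section Cases.
Context {R : realType}.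
Local Notation mu := (@lebesgue_measure R).
Variables (c d a b tau : R).
Hypotheses (c0 : 0 < c) (d0 : 0 < d) (a0 : 0 < a) (b0 : 0 < b) (tau0 : 0 < tau).

Definition has_bounded_extension (th : R) (f : R -> R[i]) := exists F : R[i] -> R[i],
  [/\ holomorphic_on (sector th) F, forall t : R, 0 < t -> F t%:C = f t &
      forall theta, 0 < theta -> theta < th -> bounded_on (closed_sector theta) F].

(** Here [t] enters to the power 1 and [pi / 2] is the limit for the decay of [exp (- u)] in [pexp];
    the weight [gf] being integrable, [bump <= 1] is enough. *)
Lemma f_kernel_extension : a < 1 ->
  has_bounded_extension (theta0 a 1) (fun t => f_kernel c a t tau).
Proof.
move=> a1; have th := @theta0_opening R a 1 ltr01.
have [|||||||||F [Fh Fv Fb]] := @transform_extension_real _ _ _ mu (gf c tau)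
  (fun y => cpow (c +i* y) a) (pexp a) (pi / 2) (`|a| * (pi / 2)) 1 (theta0 a 1)
  (invpi2i) (sectorial_pexp a).
- by move=> y; apply: insec_cpow_Re_gt0.
- exact: cmeasurable_gf.
- move=> w; apply: cmeasurable_pexp; apply: cmeasurableM; first exact: cmeasurable_cst.
  by apply: cmeasurable_cpow_line => //; rewrite gtr0_norm//; lra.
- apply: bump_bounded_integrable; first exact: cmeasurable_gf.
    by apply: cmeasurable_cpow_line => //; rewrite gtr0_norm//; lra.
  exact: integrable_gf.
- exact: oner_neq0.
- by rewrite normr1; lra.
- by apply: theta0_gt0 => //; lra.
- exact: theta0_le_pihalf.
- by rewrite normr1 gtr0_norm//; lra.
exists F; split=> // t t0; rewrite (Fv t t0) (f_kernel_pexp c0 a0 a1 t0 tau0).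
by rewrite cpow1// -cmod_eq0 cmodR normr_eq0 gt_eqF.
Qed.

(** Here [t] enters to the power [- b], and the weight [gp] calls for the uniform estimate of
    [bump_bounded_gp]. *)
Lemma phi_kernel_extension : b < 1 ->
  has_bounded_extension (theta0 1 b) (fun t => phi_kernel d b t tau).
Proof.
move=> b1; have th := @theta0_opening R 1 b b0.
have b2 : `|b| <= 2 by rewrite gtr0_norm//; lra.
have mA : cmeasurable (fun y => cpow (d +i* y) b) by exact: cmeasurable_cpow_line.
have [|||||||||F [Fh Fv Fb]] := @transform_extension_real _ _ _ mu (gp d)
  (fun y => cpow (d +i* y) b) _ (pi / 2) (`|b| * (pi / 2)) (- b) (theta0 1 b)
  (invpi2i) (sectorial_mulexp tau0).
- by move=> y; apply: insec_cpow_Re_gt0.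
- exact: cmeasurable_gp.
- move=> w; have mwA : cmeasurable (fun y => w * cpow (d +i* y) b).
    by apply: cmeasurableM => //; exact: cmeasurable_cst.
  apply: cmeasurableM => /=; first exact: mwA.
  apply: cmeasurable_cexp; apply: cmeasurableM; last exact: mwA.
  exact: cmeasurable_cst.
- by apply: bump_bounded_gp; rewrite // gt_eqF.
- by rewrite oppr_eq0 gt_eqF.
- by rewrite normrN.
- by apply: theta0_gt0 => //; lra.
- exact: theta0_le_pihalf.
- by rewrite normrN gtr0_norm//; lra.
exists F; split=> // t t0; rewrite (Fv t t0) (phi_kernel_dilated d0 b0 b1 t0 tau0).
by congr (_ * _); apply: eq_cint => y; rewrite cpow_real.
Qed.

(** Here [t] enters to the power [b], and [ratio], whose only pole is [-1], allows the full opening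
    [pi]. [bump_bounded_prod] joins the integrability of [gf] on one line to the uniform estimate
    for [gp] on the other. *)
Lemma psi_kernel_extension : a < 1 -> b < 1 ->
  has_bounded_extension (theta0 a b) (fun t => psi_kernel c d a b t tau).
Proof.
move=> a1 b1; have th := @theta0_opening R a b b0.
have a2 : `|a| <= 2 by rewrite gtr0_norm//; lra.
have b2 : `|- b| <= 2 by rewrite normrN gtr0_norm//; lra.
pose g1 y := invpi2i * gp d y; pose e1 y := cpow (d +i* y) (- b).
pose g2 y := invpi2i * gf c tau y; pose e2 y := cpow (c +i* y) a.
have mg1 : cmeasurable g1.
  by apply: cmeasurableM; [exact: cmeasurable_cst|exact: cmeasurable_gp].
have mg2 : cmeasurable g2.
  by apply: cmeasurableM; [exact: cmeasurable_cst|exact: cmeasurable_gf].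
have me1 : cmeasurable e1 by exact: cmeasurable_cpow_line.
have me2 : cmeasurable e2 by exact: cmeasurable_cpow_line.
have bb : bump_bounded (prod_measure mu mu) (psi_weight c d tau) (psi_phase c d a b).
  apply: (@bump_bounded_prod _ _ _ _ R mu mu g1 e1 g2 e2) => //.
  - by move=> y; rewrite cmod_gt0 cpow_neq0// line_neq0.
  - apply: bump_bounded_scale; apply: bump_bounded_gp => //.
    by rewrite oppr_eq0 gt_eqF.
  rewrite (_ : (fun y => _) = (fun y => cmod invpi2i * cmod (gf c tau y))).
    by apply: integrable_scale; exact: integrable_gf.
  by apply/funext => y; rewrite cmodM.
have [|||||||||F [Fh Fv Fb]] := @transform_extension_real _ _ _ (prod_measure mu mu)
  (psi_weight c d tau) (psi_phase c d a b) (ratio a) pi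
  (`|a| * (pi / 2) + `|- b| * (pi / 2)) b (theta0 a b) 1 (sectorial_ratio a).
- by move=> p; apply: insecM; apply: insec_cpow_Re_gt0.
- apply: cmeasurableM.
    exact: (cmeasurable_comp mg1 measurable_fst).
  exact: (cmeasurable_comp mg2 measurable_snd).
- move=> w; apply: cmeasurable_ratio; apply: cmeasurableM; first exact: cmeasurable_cst.
  apply: cmeasurableM.
    exact: (cmeasurable_comp me2 measurable_snd).
  exact: (cmeasurable_comp me1 measurable_fst).
- exact: bb.
- by rewrite gt_eqF.
- by rewrite -normrN.
- by apply: theta0_gt0 => //; lra.
- exact: theta0_le_pihalf.
- by rewrite normrN !gtr0_norm//; lra.
by exists F; split=> // t t0; rewrite Fv// mul1r psi_kernel_ratio.
Qed.

End Cases.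

Theorem proposition2p5 (R : realType) (alpha beta : R)
  (alpha_gt0 : 0 < alpha) (alpha_le1 : alpha <= 1)
  (beta_gt0 : 0 < beta) (beta_le1 : beta <= 1)
  (alpha_beta_lt2 : alpha + beta < 2)
  (c d : R) (c_gt0 : 0 < c) (d_gt0 : 0 < d)
  (tau : R) (tau_gt0 : 0 < tau) :
  exists F : R[i] -> R[i],
    [/\ holomorphic_on (sector (theta0 alpha beta)) F,
        forall t : R, 0 < t -> F t%:C = psi_kernel c d alpha beta t tau &
        forall theta : R, 0 < theta -> theta < theta0 alpha beta ->
          bounded_on (closed_sector theta) F].
Proof.
(* The cases follow the order of the tests in [psi_kernel]; for [beta = 1], [alpha + beta < 2]
   forces [alpha < 1]. *)
have [b1|b1] := eqVneq beta 1.
  rewrite b1 in alpha_beta_lt2 *; rewrite /psi_kernel eqxx.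
  by apply: f_kernel_extension => //; lra.
have bl1 : beta < 1 by rewrite lt_neqAle b1.
have [a1|a1] := eqVneq alpha 1.
  rewrite a1 /psi_kernel (negPf b1) eqxx.
  exact: phi_kernel_extension.
by apply: psi_kernel_extension => //; rewrite lt_neqAle a1.
Qed.
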